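(* Let $a,b,c,d,e\in\mathbb{R}$ with $b\neq 0$, let $\mu>-1/2$, and let $f\in L^2_\mu(\mathbb{R})$. Then $$\left(\int_{\mathbb{R}}|v|^2|f(v)|^2|v|^{2\mu+1}\,dv\right)\left(\int_{\mathbb{R}}|w|^2\left|\mathcal{D}^{a,b,c}_{d,e,\mu}[f](w)\right|^2|w|^{2\mu+1}\,dw\right)\geq |b|^2\left(\mu+\tfrac12\right)^2\left(\int_{\mathbb{R}}|f(v)|^2|v|^{2\mu+1}\,dv\right)^2.$$
   Context: For $\mu>-1/2$ and $1\le p<\infty$, $L^p_\mu(\mathbb{R})$ is the space of measurable $f:\mathbb{R}\to\mathbb{C}$ with $\|f\|_{\mu,p}=\left(\int_{\mathbb{R}}|f(v)|^p|v|^{2\mu+1}dv\right)^{1/p}<\infty$. Put $c_\mu=\frac{1}{2^{\mu+1}\Gamma(\mu+1)}$. The normalized spherical Bessel function is $j_\mu(z)=\Gamma(\mu+1)\sum_{n=0}^{\infty}\frac{(-1)^n (z/2)^{2n}}{n!\,\Gamma(n+\mu+1)}$, and the Dunkl kernel is $E_\mu(iw,v)=j_\mu(wv)+\frac{iwv}{2(\mu+1)}\,j_{\mu+1}(wv)$ for $w,v\in\mathbb{R}$. For real $a,b,c,d,e$ with $b\neq0$, the quadratic-phase Dunkl kernel is $\Psi^{a,b,c}_{d,e,\mu}(w,v)=e^{-i(av^2+cw^2+dv+ew)}E_\mu(-iw/b,v)$, and the quadratic-phase Dunkl transform of $f\in L^1_\mu(\mathbb{R})$ is $\mathcal{D}^{a,b,c}_{d,e,\mu}[f](w)=\frac{c_\mu}{(ib)^{\mu+1}}\int_{\mathbb{R}}\Psi^{a,b,c}_{d,e,\mu}(w,v)f(v)|v|^{2\mu+1}dv$.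 Complex powers are taken with the principal branch. On $L^2_\mu(\mathbb{R})$, $\mathcal{D}^{a,b,c}_{d,e,\mu}$ denotes the unique continuous linear operator $L^2_\mu(\mathbb{R})\to L^2_\mu(\mathbb{R})$ that agrees with the integral formula on the Schwartz space $\mathcal{S}(\mathbb{R})$. The integrals on the left-hand side take values in $[0,\infty]$. *)

(* Defs.v *)
From mathcomp Require Import all_boot all_order all_algebra.
From mathcomp Require Import all_classical all_reals all_analysis.
From mathcomp Require Export complex.

Set Implicit Arguments.
Unset Strict Implicit.
Unset Printing Implicit Defensive.

Import Order.TTheory GRing.Theory Num.Theory.
Import numFieldNormedType.Exports.
Local Open Scope classical_set_scope.
Local Open Scope ring_scope.
Local Open Scope complex_scope.

(* MathComp's norm on R[i] takes values in R[i]; this one is real-valued. *)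
Definition cabs {R : realType} (z : R[i]) : R := ComplexField.Normc.normc z.

Definition cis {R : realType} (t : R) : R[i] := cos t +i* sin t.

(* Principal argument, in ]-pi, pi], of a nonzero z (junk value at 0). *)
Definition carg {R : realType} (z : R[i]) : R :=
  let t := acos (complex.Re z / cabs z) in if 0 <= complex.Im z then t else - t.

(* Principal branch of z ^ s for z nonzero and s real:
   exp (s Log z) = |z| ^ s * exp (i s Arg z). *)
Definition cpow {R : realType} (z : R[i]) (s : R) : R[i] :=
  (cabs z `^ s)%:C * cis (s * carg z).

Definition cmeasurable {R : realType} (f : R -> R[i]) : Prop :=
  measurable_fun setT (fun v : R => complex.Re (f v)) /\
  measurable_fun setT (fun v : R => complex.Im (f v)).

Definition cintegral {R : realType} (f : R -> R[i]) : R[i] :=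
  (\int[@lebesgue_measure R]_v complex.Re (f v)) +i*
  (\int[@lebesgue_measure R]_v complex.Im (f v)).

Definition aeq {R : realType} (f g : R -> R[i]) : Prop :=
  {ae @lebesgue_measure R, forall v, f v = g v}.

(* Euler's integral; it represents Gamma for 0 < x, the only arguments used. *)
Definition Gamma {R : realType} (x : R) : R :=
  \int[@lebesgue_measure R]_(t in `]0, +oo[) (t `^ (x - 1) * expR (- t)).

Definition weight {R : realType} (mu v : R) : R := `|v| `^ (2 * mu + 1).

Definition Lnorm_mu {R : realType} (mu p : R) (f : R -> R[i]) : \bar R :=
  ((\int[@lebesgue_measure R]_v (cabs (f v) `^ p * weight mu v)%:E) `^ p^-1)%E.

(* Functions representing the elements of L^p_mu; elements of L^p_mu are
   classes of such functions modulo [aeq]. *)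
Definition inLp_mu {R : realType} (mu p : R) (f : R -> R[i]) : Prop :=
  cmeasurable f /\ (Lnorm_mu mu p f < +oo)%E.

Definition c_mu {R : realType} (mu : R) : R :=
  (2 `^ (mu + 1) * Gamma (mu + 1))^-1.

Definition bessel_j {R : realType} (mu z : R) : R :=
  Gamma (mu + 1) *
  limn (series (fun n : nat =>
    (-1) ^+ n * (z / 2) ^+ (2 * n) / (n`!%:R * Gamma (n%:R + mu + 1)))).

(* [dunkl_E mu w v] is E_mu (i w, v). *)
Definition dunkl_E {R : realType} (mu w v : R) : R[i] :=
  (bessel_j mu (w * v))%:C +
  ('i * (w * v)%:C / (2 * (mu + 1))%:C) * (bessel_j (mu + 1) (w * v))%:C.

Definition qp_kernel {R : realType} (a b c d e mu w v : R) : R[i] :=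
  cis (- (a * v ^+ 2 + c * w ^+ 2 + d * v + e * w)) * dunkl_E mu (- (w / b)) v.

Definition qp_dunkl {R : realType} (a b c d e mu : R) (f : R -> R[i]) (w : R)
    : R[i] :=
  (c_mu mu)%:C / cpow ('i * b%:C) (mu + 1) *
  cintegral (fun v => qp_kernel a b c d e mu w v * f v * (weight mu v)%:C).

Definition cderive1n {R : realType} (n : nat) (f : R -> R[i]) (x : R) : R[i] :=
  derive1n n (fun v : R => complex.Re (f v)) x +i*
  derive1n n (fun v : R => complex.Im (f v)) x.

Definition schwartz {R : realType} (f : R -> R[i]) : Prop :=
  (forall (n : nat) (x : R),
      derivable (derive1n n (fun v : R => complex.Re (f v))) x 1 /\
      derivable (derive1n n (fun v : R => complex.Im (f v))) x 1) /\
  (forall m n : nat, exists M : R, forall x : R,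
      `|x| ^+ m * cabs (cderive1n n f x) <= M).

(* [D] represents the continuous linear operator on L^2_mu extending the
   integral formula on Schwartz functions.  It acts on functions; since
   equality in L^2_mu is [aeq], values of [D] are only specified a.e., and
   continuity at each point makes [D] compatible with [aeq]. *)
Record is_qp_dunkl_L2 {R : realType} (a b c d e mu : R)
    (D : (R -> R[i]) -> (R -> R[i])) : Prop := {
  qpL2_stable : forall f, inLp_mu mu 2 f -> inLp_mu mu 2 (D f);
  qpL2_linear : forall (z : R[i]) f g, inLp_mu mu 2 f -> inLp_mu mu 2 g ->
    aeq (D (fun v => z * f v + g v)) (fun w => z * D f w + D g w);
  qpL2_continuous : forall f, inLp_mu mu 2 f ->
    forall eps : R, 0 < eps -> exists2 delta : R, 0 < delta &
      forall g, inLp_mu mu 2 g ->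
        (Lnorm_mu mu 2 (fun v => (g v - f v)%R) < delta%:E)%E ->
        (Lnorm_mu mu 2 (fun w => (D g w - D f w)%R) < eps%:E)%E;
  qpL2_schwartz : forall f, schwartz f -> aeq (D f) (qp_dunkl a b c d e mu f)
}.

(* Main.v *)
From HB Require Import structures.
Require Import Defs.
From mathcomp Require Import all_boot all_order all_algebra.
From mathcomp Require Import all_classical all_reals all_analysis.
From mathcomp Require Import measurable_realfun.
From mathcomp Require Import ring lra.

(* After a dilation by [sg] and modulations, the transform becomes an operator that
   multiplies the [n]-th generalized Hermite function by ['i ^+ n], where the Hermite
   functions form a complete orthogonal system and multiplication by the variable acts
   on them as a Jacobi matrix: [x h_n = h_(n+1) + alpha_n h_(n-1)].  On the side of the
   transform the phases ['i ^+ n] change the sign in the coefficients of [x f], so the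
   two second moments have coefficients [p_(n+1) + alpha_n p_(n-1)] and
   [- p_(n+1) + alpha_n p_(n-1)].  The cross terms cancel in the sum of the squares, and
   Bessel's inequality together with [mu + 1 <= alpha_n + alpha_(n+1)] bounds the sum of
   the moments below by [2 (mu + 1)] times the squared norm of [f].  Optimizing over [sg]
   gives the product, even with the constant [mu + 1].
   Only the values of the integral formula on chirped Hermite functions are used; they
   determine the coefficients of [D f] by continuity. *)

Set Implicit Arguments.
Unset Strict Implicit.
Unset Printing Implicit Defensive.

Import Order.TTheory GRing.Theory Num.Theory.
Import numFieldNormedType.Exports.
Local Open Scope classical_set_scope.
Local Open Scope ring_scope.

(** * Lebesgue measure and nonnegative integrals under dilation and reflection *)

Section lebesgue_scaling.
Context {R : realType}.
Local Notation leb := (@lebesgue_measure R).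
Local Open Scope ereal_scope.

(** The hypotheses on [D] give neither an isometry nor an inversion formula, and [f] has no
    smoothness. Working with coefficients avoids both: multiplication by the variable is a matrix
    there, so no derivative of [f] appears, and what is known about [D] is a list of eigenvalues.
    Completeness is applied to the input only; the output enters through Bessel's inequality, which
    is the direction that a lower bound calls for. The eigenvalues are found algebraically. The
    kernel is a power series over Dunkl factorials; integrated term by term against a polynomial
    times a Gaussian it leaves moments, on which the Dunkl operator is antisymmetric up to
    multiplication by ['X]. Completeness is built by hand: Taylor expansion produces translated
    Gaussians from polynomials times one Gaussian, and high powers of [1 - G], for narrow Gaussians
    [G], tend to indicators of sets [|v - r| > rho]. The constant comes from
    [alpha n + alpha n.+1 = n + mu + 1], smallest at [n = 0]. *)

Lemma measurable_mull (t : R) :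
  measurable_fun setT (fun x : measurableTypeR R => (t * x)%R : measurableTypeR R).
Proof. exact: measurable_funM. Qed.

(** The image of Lebesgue measure under the dilation, multiplied by [t], has the right value on
    half-open intervals; uniqueness of Lebesgue measure does the rest. *)
Lemma lebesgue_measure_mull (t : R) (A : set R) : (0 < t)%R -> measurable A ->
  leb A = t%:E * leb ((fun x => t * x)%R @^-1` A).
Proof.
move=> t0 mA.
pose phi : measurableTypeR R -> measurableTypeR R := fun x => (t * x)%R.
have mphi : measurable_fun setT phi by exact: measurable_mull.
pose m' := mscale (NngNum (ltW t0)) (pushforward leb phi); pose m := m' mphi.
have -> : t%:E * leb ((fun x => t * x)%R @^-1` A) = m A by [].
apply: lebesgue_measure_unique mA => _ [[a b]] _ <-.
transitivity (t%:E * leb (phi @^-1` `]a, b])); last by [].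
have -> : phi @^-1` `]a, b] = `](t^-1 * a)%R, (t^-1 * b)%R]%classic.
  apply/seteqP; split => x /=; rewrite !in_itv/= => /andP[h1 h2]; apply/andP; split.
  - by rewrite ltr_pdivrMl.
  - by rewrite ler_pdivlMl.
  - by rewrite -ltr_pdivrMl.
  - by rewrite -ler_pdivlMl.
rewrite !lebesgue_measure_itv/= !lte_fin ltr_pM2l ?invr_gt0//.
case: ifPn => _; last by rewrite mule0.
by rewrite -!EFinD -EFinM mulrBr !mulVKf ?gt_eqF.
Qed.

Lemma ge0_integral_mull_pos (t : R) (f : R -> \bar R) : (0 < t)%R ->
  measurable_fun [set: R] f -> (forall x, 0 <= f x) ->
  \int[leb]_x f x = t%:E * \int[leb]_x f (t * x)%R.
Proof.
move=> t0 mf f0.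
pose phi : measurableTypeR R -> measurableTypeR R := fun x => (t * x)%R.
have mphi : measurable_fun setT phi by exact: measurable_mull.
pose m' := mscale (NngNum (ltW t0)) (pushforward leb phi); pose m := m' mphi.
have -> : \int[leb]_x f x = \int[m]_x f x.
  apply: eq_measure_integral => A mA _; rewrite /m /m' /mscale/=.
  exact: lebesgue_measure_mull.
rewrite /m /m' ge0_integral_mscale// ge0_integral_pushforward//.
Qed.

Lemma ge0_integral_opp (f : R -> \bar R) :
  measurable_fun [set: R] f -> (forall x, 0 <= f x) ->
  \int[leb]_x f x = \int[leb]_x f (- x)%R.
Proof.
move=> mf f0.
pose phi : measurableTypeR R -> measurableTypeR R := -%R.
have mphi : measurable_fun setT phi by exact: measurable_funN.
have -> : \int[leb]_x f x = \int[pushforward leb phi]_x f x.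
  apply: eq_measure_integral => A mA _.
  exact/esym/lebesgue_measureN.
by rewrite ge0_integral_pushforward.
Qed.

Lemma ge0_integral_mull (t : R) (f : R -> \bar R) : (t != 0)%R ->
  measurable_fun [set: R] f -> (forall x, 0 <= f x) ->
  \int[leb]_x f x = `|t|%:E * \int[leb]_x f (t * x)%R.
Proof.
move=> t0 mf f0; have [tp|tn|/eqP] := ltgtP t 0%R; last by rewrite (negbTE t0).
  rewrite ltr0_norm// ge0_integral_opp// (@ge0_integral_mull_pos (- t)%R) ?oppr_gt0//.
    by under [in RHS]eq_integral => x _ do rewrite -[(t * x)%R]opprK -mulNr.
  by apply: measurableT_comp => //; exact: measurable_funN.
by rewrite gtr0_norm//; exact: ge0_integral_mull_pos.
Qed.

End lebesgue_scaling.

Ltac mfun := repeat first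
  [ assumption
  | exact: measurable_cst
  | exact: measurable_id
  | exact: measurable_powR
  | exact: measurable_expR
  | exact: normr_measurable
  | apply: measurable_funM
  | apply: measurable_funD
  | apply: measurable_funB
  | apply: measurable_funN
  | apply: measurable_funX
  | apply: (measurableT_comp (@measurable_expR _))
  | apply: (measurableT_comp (@measurable_powR _ _))
  | apply: (measurableT_comp (@normr_measurable _ _)) ].

(** * Integrals over the positive half line *)

Section half_line.
Context {R : realType}.
Local Notation leb := (@lebesgue_measure R).
Local Open Scope ereal_scope.

Lemma ge0_integral_even (f : R -> \bar R) :
  measurable_fun [set: R] f -> (forall x, 0 <= f x) -> (forall x, f (- x)%R = f x) ->
  \int[leb]_x f x = 2%:E * \int[leb]_(x in `]0%R, +oo[) f x.
Proof.
move=> mf f0 fN.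
have mI : measurable (`]0%R, +oo[%classic : set R) by [].
have -> : \int[leb]_x f x =
    \int[leb]_(x in `]-oo, 0%R]%classic `|` `]0%R, +oo[%classic) f x.
  congr (integral _ _ _); apply/seteqP; split => // x _ /=.
  by rewrite !in_itv/= andbT; have [xle|xgt] := leP x 0%R; [left|right].
rewrite ge0_integral_setU//; last 2 first.
- exact: measurable_funTS.
- apply/disj_setPLR => x /=; rewrite !in_itv/= andbT => x0 x1.
  by have := le_lt_trans x0 x1; rewrite ltxx.
rewrite -integral_itv_bndo_bndc; last exact: measurable_funTS.
have -> : \int[leb]_(x in `]-oo, 0%R[) f x = \int[leb]_(x in `]0%R, +oo[) f x.
  rewrite integral_mkcond [RHS]integral_mkcond ge0_integral_opp.
  - apply: eq_integral => x _; rewrite !patchE fN.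
    by rewrite !mem_setE !in_itv/= andbT oppr_lt0.
  - by apply/(measurable_restrictT f) => //; exact: measurable_funTS.
  - by move=> x; rewrite patchE; case: ifPn.
by rewrite -mule2n muleC mule_natr.
Qed.

(** Integration by parts and substitution are carried out on compact intervals, which stay away from
    the possible singularity at 0; monotone exhaustion then recovers the half line. *)
Lemma ge0_cvg_integral_half_line (f : R -> \bar R) (a b : R^nat) :
  measurable_fun (`]0%R, +oo[%classic : set R) f -> (forall x, (0 < x)%R -> 0 <= f x) ->
  (forall n, (0 < a n)%R) ->
  {homo a : m n / (m <= n)%N >-> (n <= m)%R} ->
  {homo b : m n / (m <= n)%N >-> (m <= n)%R} ->
  (forall x, (0 < x)%R -> exists n, (a n <= x <= b n)%R) ->
  \int[leb]_(x in `[a n, b n]) f x @[n --> \oo] --> \int[leb]_(x in `]0%R, +oo[) f x.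
Proof.
move=> mf f0 a0 na nb ex.
have sub n : `[a n, b n]%classic `<=` `]0%R, +oo[%classic.
  by move=> x /=; rewrite !in_itv/= andbT => /andP[+ _]; exact: lt_le_trans.
have -> : `]0%R, +oo[%classic = \bigcup_n `[a n, b n]%classic.
  apply/seteqP; split => x /=.
    by rewrite in_itv/= andbT => /ex[n xn]; exists n => //=; rewrite in_itv.
  by move=> [n _ xn]; exact: (sub n).
apply: ge0_nondecreasing_set_cvg_integral => //.
- move=> m n mn; apply/subsetPset => x /=; rewrite !in_itv/= => /andP[h1 h2].
  by rewrite (le_trans (na _ _ mn))//= (le_trans h2)// nb.
- by move=> n; exact: measurable_funS mf.
- by move=> n x /sub /=; rewrite in_itv/= andbT; exact: f0.
Qed.

End half_line.

(** * Powers and exponentials dominated by Gaussians *)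

Section gaussian_growth.
Context {R : realType}.
Local Notation leb := (@lebesgue_measure R).

Lemma exprn_le_exp (t : R) n : 0 <= t -> t ^+ n <= n`!%:R * expR t.
Proof.
move=> t0; case: n => [|n]; first by rewrite expr0 mul1r -expR0 ler_expR.
rewrite mulrC -ler_pdivrMr ?ltr0n ?fact_gt0//.
by apply: le_trans (expR_ge1Dxn n t0); rewrite lerDr.
Qed.

Lemma powR_le_exp (p : R) : 0 <= p ->
  exists2 K, 0 < K & forall t, 0 <= t -> t `^ p <= K * expR t.
Proof.
move=> p0; pose k := (Num.trunc p).+1.
exists (1 + k`!%:R); first by rewrite ltr_pwDl.
move=> t t0; rewrite mulrDl mul1r; have e1 : 1 <= expR t by rewrite -expR0 ler_expR.
have [t1|/ltW t1] := leP t 1.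
  apply: (@le_trans _ _ 1); last by rewrite (le_trans e1)// lerDl mulr_ge0 ?expR_ge0.
  have [->|tn0] := eqVneq t 0; last first.
    by rewrite -[leRHS](powRr0 t) ger_powR// lt0r tn0 t0.
  by have [->|pn0] := eqVneq p 0; rewrite ?powRr0 ?powR0.
apply: (@le_trans _ _ (t `^ k%:R)).
  by rewrite ler_powR// ltW// truncnS_gt.
by rewrite powR_mulrn// (le_trans (exprn_le_exp k t0))// lerDr expR_ge0.
Qed.

(** The power costs one factor [exp |v|], whence [c + 1]; completing the square then pays for the
    linear exponent with half of the quadratic one. *)
Lemma gauss_growth (p c s : R) : 0 <= p -> 0 < s -> exists2 K, 0 < K &
  forall v, `|v| `^ p * expR (c * `|v| - s * v ^+ 2) <= K * expR (- (s / 2 * v ^+ 2)).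
Proof.
move=> p0 s0; have [K K0 HK] := powR_le_exp p0.
exists (K * expR ((c + 1) ^+ 2 / (2 * s))); first by rewrite mulr_gt0 ?expR_gt0.
move=> v; apply: (@le_trans _ _ (K * expR `|v| * expR (c * `|v| - s * v ^+ 2))).
  by rewrite ler_wpM2r ?expR_ge0// HK.
rewrite -[leLHS]mulrA -[leRHS]mulrA -!expRD ler_pM2l// ler_expR -subr_ge0.
rewrite -(real_normK (num_real v)).
have -> : (c + 1) ^+ 2 / (2 * s) + - (s / 2 * `|v| ^+ 2) - (`|v| + (c * `|v| - s * `|v| ^+ 2))
   = s / 2 * (`|v| - (c + 1) / s) ^+ 2 by field; rewrite gt_eqF.
by rewrite mulr_ge0 ?sqr_ge0// divr_ge0// ltW.
Qed.

Lemma integrable_gauss (s : R) : 0 < s ->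
  leb.-integrable [set: R] (EFin \o (fun v => expR (- (s * v ^+ 2)))).
Proof.
move=> s0; apply/integrableP; split; first by apply/measurable_EFinP; mfun.
under eq_integral do rewrite /= ger0_norm ?expR_ge0//.
have r0 : 0 < Num.sqrt s by rewrite sqrtr_gt0.
have := @integralT_gauss R.
rewrite (@ge0_integral_mull _ (Num.sqrt s)) ?gt_eqF//; last 2 first.
- by apply/measurable_EFinP; rewrite /gauss_fun; mfun.
- by move=> x; rewrite lee_fin gauss_fun_ge0.
rewrite gtr0_norm//.
have E x : gauss_fun (Num.sqrt s * x) = expR (- (s * x ^+ 2)).
  by rewrite /gauss_fun exprMn sqr_sqrtr// ltW.
have -> : (\int[leb]_x (gauss_fun (Num.sqrt s * x))%:E =
    \int[leb]_x (expR (- (s * x ^+ 2)))%:E)%E by apply: eq_integral => x _; rewrite E.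
set I := (\int[_]_ _ _)%E => H.
have I0 : (0 <= I)%E by apply: integral_ge0 => x _; rewrite lee_fin expR_ge0.
rewrite ltey; apply/negP => /eqP Iy.
by move: H; rewrite Iy gt0_muley.
Qed.

Lemma integrable_gauss_dom (f : R -> R) (K s : R) : 0 < s ->
  measurable_fun [set: R] f -> (forall v, `|f v| <= K * expR (- (s * v ^+ 2))) ->
  leb.-integrable [set: R] (EFin \o f).
Proof.
move=> s0 mf fK.
apply: (@le_integrable _ _ R leb setT measurableT (EFin \o f)
  (fun v => (K%:E * (expR (- (s * v ^+ 2)))%:E)%E)) => //.
- exact/measurable_EFinP.
- by move=> v _; rewrite /= lee_fin (le_trans (fK v))// ler_norm.
- by apply: integrableZl => //; exact: integrable_gauss.
Qed.

End gaussian_growth.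

(** * Euler's integral, its functional equation and its Gaussian form *)

Section gamma_integral.
Context {R : realType}.
Local Notation leb := (@lebesgue_measure R).

(** The shift by two keeps [lower n < 1 < upper n] already at [n = 0]: integration by parts asks for
    a nondegenerate interval. *)
Definition lower (n : nat) : R := n.+2%:R^-1.
Definition upper (n : nat) : R := n.+2%:R.

Lemma lower_gt0 n : 0 < lower n. Proof. by rewrite invr_gt0. Qed.
Lemma upper_gt0 n : 0 < upper n. Proof. by []. Qed.

Lemma lower_ge0 n : 0 <= lower n. Proof. exact/ltW/lower_gt0. Qed.
Lemma upper_ge0 n : 0 <= upper n. Proof. by []. Qed.

Lemma lower_upper n : lower n < upper n.
Proof. by rewrite (@lt_trans _ _ 1)// ?invf_lt1 // ltr1n. Qed.

Lemma lower_homo : {homo lower : m n / (m <= n)%N >-> n <= m}.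
Proof. by move=> m n mn; rewrite lef_pV2 ?posrE// ler_nat !ltnS. Qed.

Lemma upper_homo : {homo upper : m n / (m <= n)%N >-> m <= n}.
Proof. by move=> m n mn; rewrite ler_nat !ltnS. Qed.

Lemma cvg_lower : lower n @[n --> \oo] --> 0.
Proof.
have -> : lower = [sequence (harmonic (n + 1)%N : R)]_n.
  by apply/funext => n; rewrite /lower /= /harmonic addn1.
by rewrite (cvg_shiftn 1 (@harmonic R : R^nat)); exact: cvg_harmonic.
Qed.

Lemma cvg_upper : upper n @[n --> \oo] --> +oo.
Proof.
have -> : upper = [sequence ((n + 2)%:R : R)]_n.
  by apply/funext => n; rewrite /upper /= addn2.
by rewrite (cvg_shiftn 2 (fun n => n%:R : R)); exact: cvgr_idn.
Qed.

Lemma lower_upper_exhaust x : 0 < x -> exists n, lower n <= x <= upper n.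
Proof.
move=> x0; pose n := maxn (Num.trunc x) (Num.trunc x^-1).
have h y : 0 < y -> (Num.trunc y <= n)%N -> y <= upper n.
  move=> y0 yn; have := truncnS_gt y => /ltW/le_trans; apply.
  by rewrite ler_nat ltnS (leq_trans yn).
exists n; rewrite h ?leq_maxl// andbT.
rewrite /lower invf_ple ?posrE//; apply: h; rewrite ?invr_gt0//.
exact: leq_maxr.
Qed.

(** With values in [\bar R] the functional equation can be proved before finiteness, which is drawn
    later from a Gaussian integral. *)
Definition egamma (x : R) : \bar R :=
  (\int[leb]_(t in `]0%R, +oo[) (t `^ (x - 1) * expR (- t))%:E)%E.

Lemma egamma_ge0 x : (0 <= egamma x)%E.
Proof. by apply: integral_ge0 => t _; rewrite lee_fin mulr_ge0 ?powR_ge0 ?expR_ge0. Qed.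

Lemma cvg_egamma x :
  (\int[leb]_(t in `[lower n, upper n]) (t `^ (x - 1) * expR (- t))%:E @[n --> \oo]
    --> egamma x)%E.
Proof.
apply: ge0_cvg_integral_half_line.
- by apply/measurable_EFinP; apply: measurable_funTS; mfun.
- by move=> t _; rewrite lee_fin mulr_ge0 ?powR_ge0 ?expR_ge0.
- exact: lower_gt0.
- exact: lower_homo.
- exact: upper_homo.
- exact: lower_upper_exhaust.
Qed.

End gamma_integral.

Section gamma_equations.
Context {R : realType}.
Local Notation leb := (@lebesgue_measure R).

Lemma ecvg_unique (u : (\bar R)^nat) (a b : \bar R) :
  u n @[n --> \oo] --> a -> u n @[n --> \oo] --> b -> a = b.
Proof. by move=> /(cvg_lim (@ereal_hausdorff R)) <- /(cvg_lim (@ereal_hausdorff R)). Qed.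

Lemma continuous_powR (p x : R) : 0 < x -> {for x, continuous (@powR R ^~ p)}.
Proof.
by move=> x0; apply/differentiable_continuous/derivable1_diffP/derivable_powR;
  rewrite in_itv/= x0.
Qed.

Lemma continuous_gamma_integrand (p x : R) : 0 < x ->
  {for x, continuous (fun t : R => t `^ p * expR (- t))}.
Proof.
move=> x0; apply: cvgM; first exact: continuous_powR.
by apply: continuous_comp; [exact: continuousN|exact: continuous_expR].
Qed.

Lemma within_continuous_pos (f : R -> R) (a b : R) : 0 < a ->
  (forall x, 0 < x -> {for x, continuous f}) -> {within `[a, b], continuous f}.
Proof.
move=> a0 cf; apply: continuous_in_subspaceT => x; rewrite inE/= in_itv/= => /andP[ax _].
by apply: cf; exact: lt_le_trans ax.
Qed.

Lemma derivable_pos_LR (f : R -> R) (a b : R) : 0 < a -> a <= b ->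
  (forall x, 0 < x -> derivable f x 1) -> derivable_oo_LRcontinuous f a b.
Proof.
move=> a0 ab df; split.
- by move=> x; rewrite in_itv/= => /andP[ax _]; apply: df; exact: lt_trans ax.
- by apply/cvg_at_right_filter/differentiable_continuous/derivable1_diffP/df.
- apply/cvg_at_left_filter/differentiable_continuous/derivable1_diffP/df.
  exact: lt_le_trans ab.
Qed.

Lemma is_derive_oppexp (t : R) : is_derive t 1 (fun t => - expR (- t)) (expR (- t)).
Proof.
by apply: is_derive_eq; rewrite mulrN1 opprK.
Qed.

Lemma egamma_add1 (x : R) : 0 < x -> egamma (x + 1) = (x%:E * egamma x)%E.
Proof.
(* [r n] is the boundary term of the integration by parts on [[lower n, upper n]]. *)
move=> x0; pose r n := (upper n `^ x * - expR (- upper n) - lower n `^ x * - expR (- lower n) : R).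
have E n : (\int[leb]_(t in `[lower n, upper n]) (t `^ (x + 1 - 1) * expR (- t))%:E =
    (r n)%:E + x%:E * \int[leb]_(t in `[lower n, upper n]) (t `^ (x - 1) * expR (- t))%:E)%E.
  rewrite addrK; rewrite (@integration_by_parts _ (@powR R ^~ x) (fun t => - expR (- t))
    (fun t => x * t `^ (x - 1)) (fun t => expR (- t))).
  - congr (_ + _)%E; rewrite -ge0_integralZl//; last 3 first.
    + by apply/measurable_EFinP; apply: measurable_funTS; mfun.
    + by move=> t _; rewrite lee_fin mulr_ge0 ?powR_ge0 ?expR_ge0.
    + exact: ltW.
    rewrite -integralN; last first.
      apply: fin_num_adde_defr; rewrite integral0_eq// => t _.
      rewrite funeposE; apply/max_idPr; rewrite lee_fin.
      by rewrite mulrN oppr_le0 !mulr_ge0 ?powR_ge0 ?expR_ge0 ?ltW.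
    by apply: eq_integral => t _; rewrite -EFinN -EFinM; congr EFin; ring.
  - exact: lower_upper.
  - apply: within_continuous_pos; first exact: lower_gt0.
    by move=> t t0; apply: cvgM; [exact: cvg_cst|exact: continuous_powR].
  - apply: derivable_pos_LR; [exact: lower_gt0|exact/ltW/lower_upper|].
    by move=> t t0; apply: derivable_powR; rewrite in_itv/= t0.
  - move=> t; rewrite in_itv/= => /andP[lt _].
    by rewrite powR_derive1// in_itv/= (lt_trans (lower_gt0 n)).
  - apply: continuous_subspaceT => t.
    by apply: continuous_comp; [exact: continuousN|exact: continuous_expR].
  - apply: derivable_pos_LR; [exact: lower_gt0|exact/ltW/lower_upper|].
    by move=> t t0; have [] := is_derive_oppexp t.
  - by move=> t _; rewrite derive1E; have [_ ->] := is_derive_oppexp t.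
have r0 : r n @[n --> \oo] --> 0.
  have -> : (0 : R) = - 0 - 0 * - 1 by rewrite mul0r subr0 oppr0.
  apply: cvgB.
    have -> : (fun n => upper n `^ x * - expR (- upper n)) =
      (fun n => - (upper n `^ x * expR (- upper n))) :> (nat -> R).
      by apply/funext => n; rewrite mulrN.
    apply: cvgN.
    have [K K0 HK] := powR_le_exp (ltW x0).
    (* With [upper n = 2 * u], one of the two factors [expR (- u)] absorbs the power of [u]; the
       other one tends to 0. *)
    apply: (@squeeze_cvgr _ _ _ _ (cst 0) (fun n => 2 `^ x * K * expR (- (upper n / 2)))).
    - apply: nearW => n; rewrite /= mulr_ge0 ?powR_ge0 ?expR_ge0//=.
      set u := upper n / 2; have u0 : 0 <= u by rewrite divr_ge0// ltW// upper_gt0.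
      have -> : upper n = 2 * u by rewrite /u mulrC divfK.
      rewrite powRM//.
      have -> : expR (- u) = expR u * expR (- (2 * u)).
        by rewrite -expRD; congr expR; ring.
      by rewrite mulrA ler_wpM2r ?expR_ge0// -[leRHS]mulrA ler_wpM2l ?powR_ge0// HK.
    - exact: cvg_cst.
    - rewrite -[X in _ --> X](mulr0 (2 `^ x * K)); apply: cvgM; first exact: cvg_cst.
      apply: (cvg_comp _ (fun t => expR (- (t / 2))) cvg_upper).
      apply: (cvg_comp (fun t => t / 2) (fun t => expR (- t)) _ (@cvgr_expR R)).
      by apply: gt0_cvgMly; [by rewrite invr_gt0|exact: cvg_id].
  apply: cvgM.
    have /cvg_at_rightP := @powR_cvg0 R _ x0; apply.
    by split; [exact: lower_gt0|exact: cvg_lower].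
  apply: cvgN; rewrite -[1](@expR0 R) -[X in _ --> expR X]oppr0.
  apply: continuous_cvg; first exact: continuous_expR.
  by apply: cvgN; exact: cvg_lower.
have L : (\int[leb]_(t in `[lower n, upper n]) (t `^ (x + 1 - 1) * expR (- t))%:E @[n --> \oo]
    --> x%:E * egamma x)%E.
  under eq_fun do rewrite E.
  rewrite -(add0e (x%:E * egamma x)%E); apply: cvgeD => //.
  - by apply: cvg_EFin => //; exact: nearW.
  - by apply: cvgeZl => //; exact: cvg_egamma.
exact: (ecvg_unique (@cvg_egamma R (x + 1)) L).
Qed.

(** Evenness reduces to the half line, where [t = v ^+ 2 / 2] is substituted. The images of the
    intervals [[lower n, upper n]] exhaust the half line as well, so both sides are limits of the
    same sequence. *)
Lemma gauss_gamma (x : R) : 0 < x ->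
  (\int[leb]_v (`|v| `^ (2 * x - 1) * expR (- (v ^+ 2 / 2)))%:E = (2 `^ x)%:E * egamma x)%E.
Proof.
move=> x0; rewrite ge0_integral_even; last 3 first.
- by apply/measurable_EFinP; mfun.
- by move=> v; rewrite lee_fin mulr_ge0 ?powR_ge0 ?expR_ge0.
- by move=> v; rewrite normrN sqrrN.
pose G (t : R) := t `^ (x - 1) * expR (- t).
pose F (v : R) := v ^+ 2 / 2.
have dF (v : R) : is_derive v 1 F v.
  rewrite /F; apply: is_derive_eq; rewrite /GRing.scale/=; by field.
have F' : derive1 F = id.
  by apply/funext => v; rewrite derive1E; have [_ ->] := dF v.
have S n : (\int[leb]_(t in `[F (lower n), F (upper n)]) (G t)%:E =
   \int[leb]_(v in `[lower n, upper n])
     (2 `^ (1 - x) * (`|v| `^ (2 * x - 1) * expR (- (v ^+ 2 / 2))))%:E)%E.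
  rewrite (@integration_by_substitution_increasing _ F G).
  - apply: eq_integral => v; rewrite inE/= in_itv/= => /andP[lv _].
    have v0 : 0 < v by exact: lt_le_trans (lower_gt0 n) lv.
    rewrite F' /= /G /F fctE /=; congr EFin.
    rewrite (gtr0_norm v0) mulrAC mulrA; congr (_ * _).
    rewrite powRM ?sqr_ge0// ?invr_ge0// -powR_mulrn ?ltW// -powRrM.
    have -> : (2^-1 : R) = 2 `^ (-1) by rewrite powR_inv1.
    rewrite -powRrM mulN1r opprB mulrAC mulrC; congr (_ * _).
    rewrite -[X in _ * X](@powRr1 _ v) ?ltW// -powRD; last by rewrite (gt_eqF v0) implybT.
    by congr (_ `^ _); ring.
  - exact/ltW/lower_upper.
  - move=> u v; rewrite !in_itv/= => /andP[lu _] _ uv; rewrite /F ltr_pM2r ?invr_gt0//.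
    have u0 : 0 < u by exact: lt_le_trans (lower_gt0 n) lu.
    by rewrite ltr_pXn2r// nnegrE ltW// (lt_trans u0).
  - by rewrite F' => v _; exact: cvg_id.
  - by rewrite F'; apply/cvg_ex; exists (lower n); apply: cvg_at_right_filter; exact: cvg_id.
  - by rewrite F'; apply/cvg_ex; exists (upper n); apply: cvg_at_left_filter; exact: cvg_id.
  - apply: derivable_pos_LR; [exact: lower_gt0|exact/ltW/lower_upper|].
    by move=> v _; have [] := dF v.
  - apply: within_continuous_pos.
      by rewrite /F divr_gt0 ?exprn_gt0 ?lower_gt0.
    by move=> t; exact: continuous_gamma_integrand.
have C1 : (\int[leb]_(t in `[F (lower n), F (upper n)]) (G t)%:E @[n --> \oo] --> egamma x)%E.
  apply: ge0_cvg_integral_half_line.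
  - by apply/measurable_EFinP; apply: measurable_funTS; mfun.
  - by move=> t _; rewrite lee_fin mulr_ge0 ?powR_ge0 ?expR_ge0.
  - by move=> n; rewrite /F divr_gt0 ?exprn_gt0 ?lower_gt0.
  - move=> m n mn; rewrite /F ler_pM2r ?invr_gt0//.
    by apply: lerXn2r; rewrite ?nnegrE ?lower_ge0// lower_homo.
  - move=> m n mn; rewrite /F ler_pM2r ?invr_gt0//.
    by apply: lerXn2r; rewrite ?nnegrE ?upper_ge0// upper_homo.
  - move=> t t0; have [|n /andP[h1 h2]] := @lower_upper_exhaust R (Num.sqrt (2 * t)).
      by rewrite sqrtr_gt0 mulr_gt0.
    exists n; have E : t = F (Num.sqrt (2 * t)).
      by rewrite /F sqr_sqrtr ?mulr_ge0 ?ltW// mulrAC divff ?mul1r.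
    rewrite [in X in X && _]E [in X in _ && X]E /F !ler_pM2r ?invr_gt0//.
    by apply/andP; split; apply: lerXn2r; rewrite ?nnegrE ?sqrtr_ge0 ?lower_ge0 ?upper_ge0.
have C2 := @ge0_cvg_integral_half_line R
  (fun v => (2 `^ (1 - x) * (`|v| `^ (2 * x - 1) * expR (- (v ^+ 2 / 2))))%:E)
  lower upper.
have -> : egamma x = (\int[leb]_(v in `]0%R, +oo[)
    (2 `^ (1 - x) * (`|v| `^ (2 * x - 1) * expR (- (v ^+ 2 / 2))))%:E)%E.
  move: C1; under eq_fun do rewrite S.
  move=> C1; apply: (ecvg_unique C1).
  apply: C2.
  - by apply/measurable_EFinP; apply: measurable_funTS; mfun.
  - by move=> t _; rewrite lee_fin !mulr_ge0 ?powR_ge0 ?expR_ge0.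
  - exact: lower_gt0.
  - exact: lower_homo.
  - exact: upper_homo.
  - exact: lower_upper_exhaust.
under [in RHS]eq_integral do rewrite EFinM.
rewrite ge0_integralZl//; last first.
  by apply/measurable_EFinP; apply: measurable_funTS; mfun.
have h : 2 `^ x * 2 `^ (1 - x) = 2 :> R.
  by rewrite -powRD ?pnatr_eq0 ?implybT// addrC subrK powRr1.
by rewrite muleA -EFinM h.
Qed.

End gamma_equations.

Section gamma_values.
Context {R : realType}.
Local Notation leb := (@lebesgue_measure R).

Lemma integrable_gauss_weight (q : R) : 0 <= q -> leb.-integrable [set: R]
  (EFin \o (fun v => `|v| `^ q * expR (- (v ^+ 2 / 2)))).
Proof.
move=> q0; have s0 : 0 < 1 / 2 :> R by lra.
have [K K0 HK] := gauss_growth 0 q0 s0.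
apply: (@integrable_gauss_dom _ _ K (1 / 2 / 2)); first lra.
- by mfun.
- move=> v; rewrite ger0_norm ?mulr_ge0 ?powR_ge0 ?expR_ge0//.
  apply: le_trans (HK v); rewrite mul0r sub0r.
  by rewrite (_ : v ^+ 2 / 2 = 1 / 2 * v ^+ 2)//; field.
Qed.

(** For [1 / 2 < x] the exponent [2 * x - 1] is positive, so the Gaussian form of the integral has
    no singularity at 0. The arguments met later, from [mu + 1] upwards, lie in this range. *)
Lemma egamma_fin_num (x : R) : 1 / 2 < x -> egamma x \is a fin_num.
Proof.
move=> x0; have xp : 0 < x by rewrite (lt_trans _ x0)// divr_gt0.
have := gauss_gamma xp.
have q0 : 0 <= 2 * x - 1 by lra.
have := integrable_gauss_weight q0.
move=> /integrable_fin_num; set I := (\int[_]_ _ _)%E => /(_ measurableT) Ifin IE.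
rewrite ge0_fin_numE ?egamma_ge0// ltey; apply/negP => /eqP gy.
move: Ifin; rewrite (_ : I = +oo%E)// IE gy gt0_muley// lte_fin powR_gt0//.
Qed.

Lemma Gamma_egamma (x : R) : 1 / 2 < x -> (Gamma x)%:E = egamma x.
Proof. by move=> x0; rewrite /Gamma /Rintegral fineK// egamma_fin_num. Qed.

Lemma Gamma_add1 (x : R) : 1 / 2 < x -> Gamma (x + 1) = x * Gamma x.
Proof.
move=> x0; apply: EFin_inj; rewrite EFinM !Gamma_egamma ?egamma_add1//; lra.
Qed.

Lemma gauss_Gamma (x : R) : 1 / 2 < x ->
  \int[leb]_v (`|v| `^ (2 * x - 1) * expR (- (v ^+ 2 / 2))) = 2 `^ x * Gamma x.
Proof. by move=> x0; rewrite /Rintegral gauss_gamma ?fineM ?egamma_fin_num//; lra. Qed.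

(** A zero integral would make []0, 1[] negligible. Strict positivity is asked only off 0, because
    the weight vanishes there. *)
Lemma Rintegral_gt0 (f : R -> R) : leb.-integrable [set: R] (EFin \o f) ->
  (forall v, 0 <= f v) -> (forall v, v != 0 -> 0 < f v) -> 0 < \int[leb]_v f v.
Proof.
move=> fi f0 fp; rewrite lt0r Rintegral_ge0// andbT; apply/eqP => I0.
have : (\int[leb]_v `|(f v)%:E|)%E = 0%E.
  under eq_integral do rewrite gee0_abs ?lee_fin//.
  rewrite -[LHS]fineK ?integrable_fin_num//.
  by move: I0; rewrite /Rintegral => ->.
move/(ae_eq_integral_abs leb measurableT (measurable_int _ fi)) => [N [mN N0 sN]].
have : (leb `]0%R, 1%R[ <= leb N)%E.
  apply: le_measure; rewrite ?inE// => v /=; rewrite in_itv/= => /andP[v0 _].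
  by apply: sN => /(_ I)/= [] fv; have := fp v; rewrite fv ltxx gt_eqF// => /(_ isT).
by rewrite N0 lebesgue_measure_itv/= lte_fin ltr01 -EFinB subr0 lee_fin ler10.
Qed.

Lemma Gamma_gt0 (x : R) : 1 / 2 < x -> 0 < Gamma x.
Proof.
move=> x0; have q0 : 0 <= 2 * x - 1 by lra.
rewrite -(pmulr_rgt0 _ (powR_gt0 x (@ltr0Sn R 1))) -gauss_Gamma//.
apply: Rintegral_gt0.
- exact: integrable_gauss_weight.
- by move=> v; rewrite mulr_ge0 ?powR_ge0 ?expR_ge0.
- by move=> v v0; rewrite mulr_gt0 ?expR_gt0 ?powR_gt0 ?normr_gt0.
Qed.

End gamma_values.

(** * The Dunkl operator on polynomials and the generalized Hermite polynomials *)

Section hermite.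
Context {R : realType}.
Variable mu : R.
Hypothesis hmu : - (1 / 2) < mu.

(** Dunkl's analogue of the integer [n]: the factor that appears when the Dunkl operator lowers
    ['X^n]. *)
Definition theta (n : nat) : R := n%:R + (if odd n then 2 * mu + 1 else 0).

Lemma theta0 : theta 0 = 0. Proof. by rewrite /theta addr0. Qed.

Lemma thetaS (n : nat) : theta n.+1 = theta n + 1 + (-1) ^+ n * (2 * mu + 1).
Proof. by rewrite /theta -natr1 /= -signr_odd; case: (odd n) => /=; ring. Qed.

Lemma theta_doubleS (n : nat) : theta n.*2.+1 = 2 * (n%:R + mu + 1).
Proof. by rewrite /theta /= odd_double/= -natr1 -mul2n natrM; ring. Qed.

(** Exactly one of [a] and [b] is odd, so the correction [2 * mu + 1] occurs once on either side. *)
Lemma thetaD (a b : nat) : odd (a + b) -> theta a + theta b = theta (a + b).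
Proof. by rewrite /theta natrD oddD; case: (odd a); case: (odd b) => //= _; ring. Qed.

Lemma theta_ge (n : nat) : n%:R <= theta n.
Proof. by rewrite /theta lerDl; case: ifP => // _; move: hmu; lra. Qed.

Lemma theta_gt0 (n : nat) : 0 < theta n.+1.
Proof. by apply: lt_le_trans (theta_ge _). Qed.

(* The Dunkl kernel [E_mu (i z, 1)] is the sum of the [(i z) ^+ n / dfact n]. *)
Definition dfact (n : nat) : R := \prod_(i < n) theta i.+1.

Lemma dfact0 : dfact 0 = 1. Proof. by rewrite /dfact big_ord0. Qed.

Lemma dfactS (n : nat) : dfact n.+1 = dfact n * theta n.+1.
Proof. by rewrite /dfact big_ord_recr. Qed.

Lemma dfact_gt0 (n : nat) : 0 < dfact n.
Proof. by rewrite prodr_gt0// => i _; exact: theta_gt0. Qed.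

Lemma fact_le_dfact (n : nat) : n`!%:R <= dfact n.
Proof.
elim: n => [|n IH]; first by rewrite dfact0.
by rewrite dfactS factS mulnC natrM ler_pM// theta_ge.
Qed.

(* The Dunkl operator [f' + (mu + 1/2) (f x - f (- x)) / x] on polynomials. *)
Definition dunkl_op (p : {poly R}) : {poly R} :=
  \poly_(i < (size p).-1) (theta i.+1 * p`_i.+1).

Lemma coef_dunkl_op p i : (dunkl_op p)`_i = theta i.+1 * p`_i.+1.
Proof.
rewrite coef_poly; case: ltnP => // h.
by rewrite nth_default ?mulr0//; case: (size p) h.
Qed.

Lemma dunkl_op_linear : linear dunkl_op.
Proof.
move=> a p q; apply/polyP => i.
by rewrite coefD coefZ !coef_dunkl_op coefD coefZ; ring.
Qed.
HB.instance Definition _ := GRing.isLinear.Build R {poly R} {poly R} _ dunkl_op dunkl_op_linear.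

Lemma dunkl_op_Xn n : dunkl_op 'X^n = theta n *: 'X^(n.-1).
Proof.
apply/polyP => i; rewrite coef_dunkl_op coefZ !coefXn.
case: n => [|n]; first by rewrite theta0 mul0r mulr0.
by rewrite eqSS; case: eqP => [->|_]; rewrite ?mulr0.
Qed.

(** The monic orthogonal polynomials of the weight [|v|^(2 mu + 1) exp (- v^2)]. Carrying two
    consecutive ones makes the three-term recurrence structural. *)
Fixpoint hermite_pair (n : nat) : {poly R} * {poly R} :=
  if n is m.+1 then
    let: (p, q) := hermite_pair m in (q, 'X * q - (theta m.+1 / 2) *: p)
  else (1, 'X).
Definition hermite n := (hermite_pair n).1.

Lemma hermite0 : hermite 0 = 1. Proof. by []. Qed.
Lemma hermite1 : hermite 1 = 'X. Proof. by []. Qed.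
Lemma hermiteSS n : hermite n.+2 = 'X * hermite n.+1 - (theta n.+1 / 2) *: hermite n.
Proof. by rewrite /hermite /=; case: (hermite_pair n). Qed.

Lemma hermite_parity n i : odd (n + i) -> (hermite n)`_i = 0.
Proof.
elim/ltn_ind: n i => -[|[|n]] IH i h.
- by rewrite hermite0 coef1; case: i h.
- by rewrite hermite1 coefX; case: i h => [|[|]].
- have hn : odd (n + i) by move: h; rewrite !addSn/= negbK.
  rewrite hermiteSS coefB coefZ coefXM (IH n)// mulr0 subr0.
  case: eqP => // i0; apply: IH => //; move: h; case: i i0 {hn} => // i _ /=.
  by rewrite addnS /= negbK.
Qed.

(** The commutator of the Dunkl operator with ['X] is [1 + (2 * mu + 1) S], where [S] is the
    reflection; by parity [S] acts on [hermite n] as the scalar [(-1) ^+ n]. *)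
Lemma dunkl_op_mulX_hermite n :
  dunkl_op ('X * hermite n) =
  'X * dunkl_op (hermite n) + (1 + (-1) ^+ n * (2 * mu + 1)) *: hermite n.
Proof.
apply/polyP => i; rewrite coef_dunkl_op coefD coefZ !coefXM/= coef_dunkl_op.
case: (boolP (odd (n + i))) => ni.
  rewrite (hermite_parity ni) !mulr0 addr0; case: eqP => // /eqP i0.
  by rewrite prednK ?lt0n// hermite_parity ?mulr0.
have -> : (-1) ^+ n = (-1) ^+ i :> R.
  by rewrite -signr_odd -[RHS]signr_odd; move: ni; rewrite oddD; case: (odd n); case: (odd i).
case: eqP => [->|/eqP i0]; first by rewrite /theta/=; ring.
by rewrite prednK ?lt0n// thetaS; ring.
Qed.

(** Applying the operator to the recurrence, the commutator contributes exactly the increment from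
    [theta n.+1] to [theta n.+2], and the remaining terms reassemble into the recurrence one index
    lower. *)
Lemma dunkl_op_hermite n : dunkl_op (hermite n) = theta n *: hermite n.-1.
Proof.
elim/ltn_ind: n => -[|[|n]] IH.
- by rewrite hermite0 -(expr0 'X) dunkl_op_Xn.
- by rewrite hermite1 -{1}(expr1 'X) dunkl_op_Xn /= expr0.
- rewrite hermiteSS linearB linearZ/= dunkl_op_mulX_hermite !IH//=.
  rewrite [in RHS]thetaS.
  case: n IH => [|n] IH.
    by rewrite hermite1 hermite0 theta0 scale0r scaler0 subr0 expr1 /theta/=
      -!mul_polyC !polyCD !polyCM; ring.
  rewrite hermiteSS -!mul_polyC !(polyCD, polyCM, polyCN); ring.
Qed.

(** The recurrence rewritten with ['X - dunkl_op], the operator that the transform turns into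
    multiplication by ['i * xi]. *)
Lemma hermite_raise n :
  hermite n.+2 = ('X * hermite n.+1 - dunkl_op (hermite n.+1)) + (theta n.+1 / 2) *: hermite n.
Proof.
rewrite dunkl_op_hermite hermiteSS /= -!addrA; congr (_ + _).
have {2}-> : theta n.+1 = theta n.+1 / 2 + theta n.+1 / 2 by field.
by rewrite scalerDl opprD subrK.
Qed.

End hermite.

Lemma poly_lin_ind {R : nzRingType} (P : {poly R} -> Prop) :
  (forall a p q, P p -> P q -> P (a *: p + q)) -> (forall n, P 'X^n) -> forall p, P p.
Proof.
move=> PD PX p; have P0 : P 0 by rewrite -(addNr 1) -scaleN1r -(expr0 'X); exact: PD.
rewrite -(coefK p) poly_def; elim/big_ind: _ => // [q1 q2 h1 h2|i _].
  by rewrite -[q1]scale1r; exact: PD.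
by rewrite -[_ *: _]addr0; exact: PD.
Qed.

(** * Moment functionals of Gaussian type and Hermite orthogonality *)

Section moment_functional.
Context {R : realType}.
Variables (mu c : R) (m : nat -> R).
Hypothesis m1 : m 1%N = 0.
Hypothesis mSS : forall n, m n.+2 = c * theta mu n.+1 * m n.

(** The recursion on [m] is all that the algebra uses of a Gaussian. Two cases occur: [c = 1] for
    [exp (- v^2 / 2)], against which the kernel is integrated, and [c = 1 / 2] for [exp (- v^2)],
    which comes from products of two Hermite functions. *)
Definition moment (p : {poly R}) : R := \sum_(i < size p) p`_i * m i.

Lemma momentE (p : {poly R}) N : (size p <= N)%N -> moment p = \sum_(i < N) p`_i * m i.
Proof.
move=> pN; rewrite /moment (big_ord_widen _ (fun i => p`_i * m i) pN) big_mkcond/=.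
by apply: eq_bigr => i _; case: ltnP => // h; rewrite nth_default ?mul0r.
Qed.

Lemma moment_linear : linear_for *%R moment.
Proof.
move=> a p q; pose N := maxn (size (a *: p + q)) (maxn (size p) (size q)).
rewrite !(@momentE _ N) ?leq_max ?leqnn ?orbT//.
rewrite mulr_sumr -big_split/=; apply: eq_bigr => i _.
by rewrite coefD coefZ; ring.
Qed.
HB.instance Definition _ := GRing.isLinear.Build R {poly R} R *%R moment moment_linear.

Lemma moment_Xn n : moment 'X^n = m n.
Proof.
rewrite /moment size_polyXn big_ord_recr/= coefXn eqxx mul1r big1 ?add0r// => i _.
by rewrite coefXn ltn_eqF ?mul0r.
Qed.

Lemma moment_odd n : odd n -> m n = 0.
Proof.
elim/ltn_ind: n => -[|[|n]] IH//= h; rewrite mSS IH ?mulr0//.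
by move: h; rewrite negbK.
Qed.

(** If the exponents have odd sum, [thetaD] adds the two coefficients; if it is even, every moment
    involved is odd and vanishes. *)
Lemma moment_dunkl_Xn a b :
  c * (moment (dunkl_op mu 'X^a * 'X^b) + moment ('X^a * dunkl_op mu 'X^b)) =
  moment ('X * 'X^a * 'X^b).
Proof.
rewrite !dunkl_op_Xn -scalerAl -scalerAr !linearZ/= -exprS -!exprD !moment_Xn.
case: a b => [|a] [|b]; rewrite ?theta0 ?mul0r ?add0r ?addr0 ?mulr0 ?addn0.
- by rewrite m1.
- by rewrite add0n add1n mSS mulrA.
- by rewrite mSS mulrA.
- rewrite /= !addSn !addnS -mulrDl mSS mulrA; case: (boolP (odd (a + b))) => ab.
    by rewrite thetaD ?addSn ?addnS//= negbK.
  by rewrite moment_odd ?mulr0.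
Qed.

(** Integration by parts against the Gaussian in algebraic form; bilinearity reduces it to
    monomials. *)
Lemma moment_dunkl p q :
  c * (moment (dunkl_op mu p * q) + moment (p * dunkl_op mu q)) = moment ('X * p * q).
Proof.
have El a (u v w : {poly R}) : (a *: u + v) * w = a *: (u * w) + v * w.
  by rewrite mulrDl -scalerAl.
have Er a (u v w : {poly R}) : w * (a *: u + v) = a *: (w * u) + w * v.
  by rewrite mulrDr -scalerAr.
elim/(@poly_lin_ind R): p => [a p1 p2 IH1 IH2|a].
  by rewrite linearP/= Er !El !linearP/= -IH1 -IH2; ring.
elim/(@poly_lin_ind R): q => [b q1 q2 IH1 IH2|b]; last exact: moment_dunkl_Xn.
by rewrite linearP/= !Er !linearP/= -IH1 -IH2; ring.
Qed.

End moment_functional.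

Section hermite_orthogonality.
Context {R : realType}.
Variables (mu : R) (m : nat -> R).
Hypothesis m1 : m 1%N = 0.
Hypothesis mSS : forall n, m n.+2 = 2^-1 * theta mu n.+1 * m n.
Local Notation L := (moment m).
Local Notation H := (hermite mu).

(** [hermite n.+1] is the image of [hermite n] under ['X - dunkl_op / 2], whose adjoint for this
    functional is [dunkl_op / 2] by [moment_dunkl]. *)
Lemma moment_hermiteS n q : L (H n.+1 * q) = 2^-1 * L (H n * dunkl_op mu q).
Proof.
have -> : H n.+1 = 'X * H n - 2^-1 *: dunkl_op mu (H n).
  rewrite dunkl_op_hermite; case: n => [|n].
    by rewrite hermite1 hermite0 theta0 scale0r scaler0 subr0 mulr1.
  by rewrite hermiteSS scalerA [2^-1 * _]mulrC.
rewrite mulrBl linearB/= -scalerAl linearZ/= -(moment_dunkl m1 mSS); ring.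
Qed.

Lemma moment_hermite_lt n k : (k < n)%N -> L (H n * H k) = 0.
Proof.
elim: n k => // n IH k; rewrite ltnS => kn.
rewrite moment_hermiteS dunkl_op_hermite -scalerAr linearZ/=.
case: k kn => [|k] kn; first by rewrite theta0 mul0r mulr0.
by rewrite /= IH ?mulr0.
Qed.

Lemma moment_hermite_orth n k : n != k -> L (H n * H k) = 0.
Proof.
case: ltngtP => // [nk|kn] _; last exact: moment_hermite_lt.
by rewrite mulrC moment_hermite_lt.
Qed.

Lemma moment_hermite_normS n :
  L (H n.+1 * H n.+1) = theta mu n.+1 / 2 * L (H n * H n).
Proof. by rewrite moment_hermiteS dunkl_op_hermite -scalerAr linearZ/=; ring. Qed.

End hermite_orthogonality.

(** * The power series of the Dunkl kernel *)

Section dunkl_series.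
Context {R : realType}.
Variable mu : R.
Hypothesis hmu : - (1 / 2) < mu.

(* The real and imaginary parts of ['i ^+ n]. *)
Definition ci (n : nat) : R := if odd n then 0 else (-1) ^+ n./2.
Definition si (n : nat) : R := if odd n then (-1) ^+ n./2 else 0.

Lemma siS n : si n.+1 = ci n.
Proof. by rewrite /si /ci /= uphalf_half; case: (odd n). Qed.

Lemma ciS n : ci n.+1 = - si n.
Proof.
by rewrite /si /ci /= uphalf_half; case: (odd n) => /=; rewrite ?oppr0// exprS mulN1r.
Qed.

Lemma ci_le1 n : `|ci n| <= 1.
Proof. by rewrite /ci; case: ifP; rewrite ?normr0// normrX normrN1 expr1n. Qed.

Lemma si_le1 n : `|si n| <= 1.
Proof. by rewrite /si; case: ifP; rewrite ?normr0// normrX normrN1 expr1n. Qed.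

(** Leaving [eps] free treats the real part of the kernel ([ci]) and its imaginary part ([si]) by
    the same lemmas. *)
Definition dunkl_term (eps : nat -> R) (z : R) (n : nat) : R := eps n * z ^+ n / dfact mu n.
Definition dunkl_ser (eps : nat -> R) (z : R) : R := limn (series (dunkl_term eps z)).

Section bounded_coefficients.
Variable eps : nat -> R.
Hypothesis eps1 : forall n, `|eps n| <= 1.

Lemma dunkl_term_le z n : `|dunkl_term eps z n| <= exp_coeff `|z| n.
Proof.
rewrite /dunkl_term /exp_coeff /= normrM normfV (ger0_norm (ltW (dfact_gt0 hmu n))).
rewrite ler_pM ?invr_ge0 ?(ltW (dfact_gt0 hmu n))//.
  by rewrite normrM normrX ler_piMl// exprn_ge0.
by rewrite lef_pV2 ?posrE ?dfact_gt0 ?ltr0n ?fact_gt0// fact_le_dfact.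
Qed.

Lemma cvg_dunkl_ser z : series (dunkl_term eps z) n @[n --> \oo] --> dunkl_ser eps z.
Proof.
apply: (@normed_cvg _ R^o).
apply: series_le_cvg (is_cvg_series_exp_coeff `|z|) => n //=.
- by rewrite /exp_coeff /= mulr_ge0 ?exprn_ge0.
- exact: dunkl_term_le.
Qed.

Lemma dunkl_ser_le z N : `|series (dunkl_term eps z) N| <= expR `|z|.
Proof.
apply: (@le_trans _ _ (series (exp_coeff `|z|) N)).
  rewrite /series /= (le_trans (ler_norm_sum _ _ _))//.
  by apply: ler_sum => i _; exact: dunkl_term_le.
rewrite /expR; apply: nondecreasing_cvgn_le; last exact: is_cvg_series_exp_coeff.
by apply: nondecreasing_series => n _; rewrite /exp_coeff /= mulr_ge0 ?exprn_ge0.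
Qed.

Lemma measurable_dunkl_partial (xi : R) N :
  measurable_fun [set: R] (fun v => series (dunkl_term eps (xi * v)) N).
Proof.
rewrite /series/=; apply: measurable_sum => n.
by rewrite /dunkl_term; mfun.
Qed.

Lemma measurable_dunkl_ser (xi : R) : measurable_fun [set: R] (fun v => dunkl_ser eps (xi * v)).
Proof.
apply: (measurable_fun_cvg (h := fun N v => series (dunkl_term eps (xi * v)) N)).
- by move=> N; exact: measurable_dunkl_partial.
- by move=> v _; exact: cvg_dunkl_ser.
Qed.

End bounded_coefficients.

End dunkl_series.

(** * Signed integrals under dilation *)

Section integral_changes.
Context {R : realType}.
Local Notation leb := (@lebesgue_measure R).

Lemma integrable_mull (t : R) (f : R -> R) : t != 0 ->
  leb.-integrable [set: R] (EFin \o f) ->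
  leb.-integrable [set: R] (EFin \o (fun v => f (t * v))).
Proof.
move=> t0 /integrableP[mf fi].
have mf' : measurable_fun [set: R] f by exact/measurable_EFinP.
apply/integrableP; split.
  apply/measurable_EFinP; apply: (measurableT_comp mf').
  exact: measurable_mull.
move: fi; rewrite (ge0_integral_mull t0) /=; last 2 first.
- by apply/measurable_EFinP; mfun.
- by move=> x; rewrite lee_fin.
move=> h; rewrite ltey; apply/negP => /eqP hy; move: h.
by rewrite hy gt0_muley// lte_fin normr_gt0.
Qed.

Lemma Rintegral_mull (t : R) (f : R -> R) : t != 0 ->
  leb.-integrable [set: R] (EFin \o f) ->
  \int[leb]_v f v = `|t| * \int[leb]_v f (t * v).
Proof.
move=> t0 fi; have fti := integrable_mull t0 fi.
have mf := measurable_int _ fi.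
apply: EFin_inj; rewrite EFinM /Rintegral !fineK ?integrable_fin_num//.
have HP := ge0_integral_mull t0 (measurable_funepos mf) (fun x => funepos_ge0 _ x).
have HN := ge0_integral_mull t0 (measurable_funeneg mf) (fun x => funeneg_ge0 _ x).
have -> : (\int[leb]_v (f v)%:E = \int[leb]_v (EFin \o f)^\+ v - \int[leb]_v (EFin \o f)^\- v)%E.
  exact: integralE.
have -> : (\int[leb]_v (f (t * v))%:E =
    \int[leb]_v (EFin \o f)^\+ (t * v)%R - \int[leb]_v (EFin \o f)^\- (t * v)%R)%E.
  by rewrite integralE; congr (_ - _)%E; apply: eq_integral => v _;
    rewrite ?funeposE ?funenegE.
rewrite HP HN [RHS]muleBr//.
apply: fin_num_adde_defr; rewrite ge0_fin_numE; last first.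
  by apply: integral_ge0 => x _; exact: funepos_ge0.
have -> : (\int[leb]_v (EFin \o f)^\+ (t * v)%R =
    \int[leb]_v (EFin \o (fun v => f (t * v)%R))^\+ v)%E.
  by apply: eq_integral => v _; rewrite !funeposE.
exact: (integral_funepos_lt_pinfty measurableT fti).
Qed.

Lemma Rintegral_odd0 (f : R -> R) : leb.-integrable [set: R] (EFin \o f) ->
  (forall v, f (- v) = - f v) -> \int[leb]_v f v = 0.
Proof.
move=> fi fN; have N1 : -1 != 0 :> R by rewrite oppr_eq0 oner_eq0.
have := Rintegral_mull N1 fi; rewrite normrN1 mul1r.
under [in X in _ = X -> _]eq_Rintegral do rewrite mulN1r fN -mulN1r.
by rewrite RintegralZl// mulN1r => /eqP; rewrite -addr_eq0 -mulr2n mulrn_eq0 => /eqP.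
Qed.

End integral_changes.

(** * Moments of weighted Gaussians *)

Section gaussian_weight.
Context {R : realType}.
Variable mu : R.
Hypothesis hmu : - (1 / 2) < mu.
Local Notation leb := (@lebesgue_measure R).

Definition gw (s v : R) : R := `|v| `^ (2 * mu + 1) * expR (- (s * v ^+ 2)).

Lemma gw_ge0 s v : 0 <= gw s v. Proof. by rewrite mulr_ge0 ?powR_ge0 ?expR_ge0. Qed.

Lemma weight_exp_gt0 : 0 < 2 * mu + 1. Proof. by move: hmu; lra. Qed.

Lemma measurable_gw s : measurable_fun [set: R] (gw s).
Proof. by rewrite /gw; mfun. Qed.

Lemma measurable_horner (p : {poly R}) : measurable_fun [set: R] (fun v => p.[v]).
Proof.
have -> : (fun v => p.[v]) = (fun v => \sum_(i < size p) p`_i * v ^+ i).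
  by apply/funext => v; rewrite horner_coef.
by apply: measurable_sum => i; mfun.
Qed.

Lemma horner_gw_dom (p : {poly R}) (s : R) : 0 < s -> exists2 K, 0 < K &
  forall v, `|p.[v]| * gw s v <= K * expR (- (s / 2 * v ^+ 2)).
Proof.
move=> s0; elim/(@poly_lin_ind R): p => [a p q [K1 K10 h1] [K2 K20 h2]|n].
  exists (`|a| * K1 + K2); first by rewrite ltr_wpDl// mulr_ge0// ltW.
  move=> v; rewrite hornerD hornerZ mulrDl -[`|a| * K1 * _]mulrA.
  apply: (@le_trans _ _ (`|a| * (`|p.[v]| * gw s v) + `|q.[v]| * gw s v)).
    by rewrite mulrA -mulrDl ler_wpM2r ?gw_ge0// (le_trans (ler_normD _ _))// normrM.
  by rewrite lerD// ler_wpM2l.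
have q0 : 0 <= n%:R + (2 * mu + 1) by rewrite addr_ge0// ltW// weight_exp_gt0.
have [K K0 HK] := gauss_growth 0 q0 s0; exists K => // v.
apply: le_trans (HK v); rewrite mul0r sub0r hornerXn normrX mulrA.
rewrite (@powRD _ _ n%:R) ?powR_mulrn//.
by rewrite gt_eqF// ltr_wpDl// weight_exp_gt0.
Qed.

Lemma integrable_horner_gw (p : {poly R}) (s : R) : 0 < s ->
  leb.-integrable [set: R] (EFin \o (fun v => p.[v] * gw s v)).
Proof.
move=> s0; have [K K0 HK] := horner_gw_dom p s0.
apply: (@integrable_gauss_dom _ _ K (s / 2)); first by rewrite divr_gt0.
- by apply: measurable_funM; [exact: measurable_horner|exact: measurable_gw].
- by move=> v; rewrite normrM (ger0_norm (gw_ge0 _ _)) HK.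
Qed.

Definition gmoment (s : R) (n : nat) : R := \int[leb]_v (v ^+ n * gw s v).

Lemma gmoment_odd s n : 0 < s -> odd n -> gmoment s n = 0.
Proof.
move=> s0 on; apply: Rintegral_odd0.
  have := integrable_horner_gw 'X^n s0.
  by under eq_fun do rewrite /= hornerXn.
move=> v; rewrite /gw normrN sqrrN exprNn -signr_odd on expr1; ring.
Qed.

Lemma moment_gmoment s (p : {poly R}) : 0 < s ->
  moment (gmoment s) p = \int[leb]_v (p.[v] * gw s v).
Proof.
move=> s0; elim/(@poly_lin_ind R): p => [a p q IH1 IH2|n].
  rewrite linearP/= IH1 IH2.
  have E v : (a *: p + q).[v] * gw s v = a * (p.[v] * gw s v) + q.[v] * gw s v.
    by rewrite hornerD hornerZ; ring.
  under [in RHS]eq_Rintegral do rewrite E.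
  rewrite RintegralD//; last 2 first.
  - have := integrable_horner_gw (a *: p) s0.
    by under eq_fun do rewrite /= hornerZ -mulrA.
  - exact: integrable_horner_gw.
  by rewrite RintegralZl//; exact: integrable_horner_gw.
by rewrite moment_Xn /gmoment; apply: eq_Rintegral => v _; rewrite hornerXn.
Qed.

Lemma gmoment_half j :
  gmoment (1 / 2) j.*2 = 2 `^ (j%:R + mu + 1) * Gamma (j%:R + mu + 1).
Proof.
rewrite -gauss_Gamma; last by have := ler0n R j; move: hmu; lra.
apply: eq_Rintegral => v _; rewrite /gw mulrA; congr (_ * expR (- _)); last by field.
rewrite -[v ^+ _]ger0_norm; last by rewrite -mul2n exprM exprn_ge0// sqr_ge0.
rewrite normrX -powR_mulrn// -powRD; last first.
  by rewrite gt_eqF// ltr_wpDl// weight_exp_gt0.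
by congr (_ `^ _); rewrite -mul2n natrM; ring.
Qed.

(** On even indices this is [Gamma_add1]. The factor [1] is the constant [c] of the moment
    recursion. *)
Lemma gmoment_halfSS n : gmoment (1 / 2) n.+2 = 1 * theta mu n.+1 * gmoment (1 / 2) n.
Proof.
have h : 0 < 1 / 2 :> R by lra.
case: (boolP (odd n)) => on; first by rewrite !gmoment_odd ?mulr0//= on.
rewrite -(even_halfK on) -doubleS !gmoment_half.
have -> : (n./2.+1)%:R + mu + 1 = n./2%:R + mu + 1 + 1 :> R by rewrite -natr1; ring.
rewrite Gamma_add1; last by have := ler0n R n./2; move: hmu; lra.
rewrite powRD ?pnatr_eq0 ?implybT// powRr1// theta_doubleS; ring.
Qed.

Lemma gmoment_scale (t : R) n : 0 < t ->
  gmoment (1 / 2) n = t ^+ n * t `^ (2 * mu + 2) * gmoment (t ^+ 2 / 2) n.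
Proof.
move=> t0; have h : 0 < 1 / 2 :> R by lra.
rewrite /gmoment (@Rintegral_mull _ t) ?gt_eqF//; last first.
  have := integrable_horner_gw 'X^n h.
  by under eq_fun do rewrite /= hornerXn.
rewrite gtr0_norm//.
have E v : (t * v) ^+ n * gw (1 / 2) (t * v) =
   t ^+ n * t `^ (2 * mu + 1) * (v ^+ n * gw (t ^+ 2 / 2) v).
  rewrite /gw normrM (gtr0_norm t0) powRM ?normr_ge0 ?ltW// !exprMn.
  have -> : 1 / 2 * (t ^+ 2 * v ^+ 2) = t ^+ 2 / 2 * v ^+ 2 by field.
  ring.
under eq_Rintegral do rewrite E.
rewrite RintegralZl//; last first.
  have := @integrable_horner_gw 'X^n (t ^+ 2 / 2).
  by under eq_fun do rewrite /= hornerXn; apply; rewrite divr_gt0 ?exprn_gt0.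
have -> : t `^ (2 * mu + 2) = t * t `^ (2 * mu + 1).
  rewrite -mulr_powRB1 ?ltW//; last by move: weight_exp_gt0; lra.
  by congr (_ * _ `^ _); ring.
by ring.
Qed.

(** A dilation by the square root of 2 carries one Gaussian into the other and halves the constant
    [c]. *)
Lemma gmoment_oneSS n : gmoment 1 n.+2 = 2^-1 * theta mu n.+1 * gmoment 1 n.
Proof.
have t0 : 0 < Num.sqrt 2 :> R by rewrite sqrtr_gt0.
have E : Num.sqrt 2 ^+ 2 / 2 = 1 :> R by rewrite sqr_sqrtr// divff.
have := gmoment_halfSS n; rewrite !(gmoment_scale _ t0) E.
rewrite !exprSr -[_ ^+ n * _ * _]mulrA -expr2 sqr_sqrtr// mul1r => h.
have c0 : Num.sqrt 2 ^+ n * Num.sqrt 2 `^ (2 * mu + 2) != 0 :> R.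
  by rewrite gt_eqF// mulr_gt0 ?exprn_gt0 ?powR_gt0.
apply: (mulfI c0); move: h; set u := gmoment 1 n.+2; set w := gmoment 1 n.
move=> h; have -> : Num.sqrt 2 ^+ n * Num.sqrt 2 `^ (2 * mu + 2) * u =
  2^-1 * (Num.sqrt 2 ^+ n * 2 * Num.sqrt 2 `^ (2 * mu + 2) * u) by field.
by rewrite h; ring.
Qed.

End gaussian_weight.

Lemma integrable_mulr_cst {R : realType} (k : R) (f : R -> R) :
  (@lebesgue_measure R).-integrable [set: R] (EFin \o f) ->
  (@lebesgue_measure R).-integrable [set: R] (EFin \o (fun v => k * f v)).
Proof. by move=> h; have := integrableZl measurableT k h. Qed.

(** * The Dunkl transform of Hermite functions *)

Section transform.
Context {R : realType}.
Variable mu : R.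
Hypothesis hmu : - (1 / 2) < mu.
Local Notation leb := (@lebesgue_measure R).
Local Notation w := (gw mu (1 / 2)).
Local Notation L := (moment (gmoment mu (1 / 2))).

Let half_gt0 : 0 < 1 / 2 :> R. Proof. by lra. Qed.

Section one_series.
Variable eps : nat -> R.
Hypothesis eps1 : forall n, `|eps n| <= 1.

Definition dtrans (p : {poly R}) (xi : R) : R :=
  \int[leb]_v (dunkl_ser mu eps (xi * v) * (p.[v] * w v)).

(** The bound has to be uniform in [N]: the partial sums are at most [exp |xi v|], which half of the
    remaining Gaussian absorbs. *)
Lemma dtrans_dom (p : {poly R}) (xi : R) : exists2 K, 0 < K & exists2 s, 0 < s &
  forall N v, `|series (dunkl_term mu eps (xi * v)) N * (p.[v] * w v)| <=
    K * expR (- (s * v ^+ 2)).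
Proof.
have [K K0 HK] := horner_gw_dom hmu p half_gt0.
have s0 : 0 < 1 / 2 / 2 :> R by lra.
have [K' K'0 HK'] := gauss_growth `|xi| (lexx 0) s0.
exists (K * K'); first exact: mulr_gt0.
exists (1 / 2 / 2 / 2) => [|N v]; first by lra.
rewrite normrM (le_trans (ler_wpM2r _ (dunkl_ser_le hmu eps1 _ N)))//.
rewrite [`|_ * gw _ _ _|]normrM (ger0_norm (gw_ge0 _ _ _)).
apply: le_trans (ler_wpM2l (expR_ge0 _) (HK v)) _.
rewrite -[leRHS]mulrA mulrCA ler_pM2l// -expRD normrM.
by have := HK' v; rewrite powRr0 mul1r.
Qed.

Lemma measurable_dtrans (p : {poly R}) (xi : R) :
  measurable_fun [set: R] (fun v => dunkl_ser mu eps (xi * v) * (p.[v] * w v)).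
Proof.
apply: measurable_funM; first exact: measurable_dunkl_ser.
by apply: measurable_funM; [exact: measurable_horner|exact: measurable_gw].
Qed.

(** Termwise integration by dominated convergence. The transform becomes a numerical series of
    moments, where the identities of the moment functional apply. *)
Lemma dtrans_cvg (p : {poly R}) (xi : R) :
  leb.-integrable [set: R]
    (EFin \o (fun v => dunkl_ser mu eps (xi * v) * (p.[v] * w v))) /\
  (series (fun n => eps n * xi ^+ n / dfact mu n * L ('X^n * p)) N @[N --> \oo]
    --> dtrans p xi).
Proof.
have [K K0 [s s0 dom]] := dtrans_dom p xi.
pose f N v := series (dunkl_term mu eps (xi * v)) N * (p.[v] * w v).
have mf N : measurable_fun [set: R] (f N).
  apply: measurable_funM; first exact: measurable_dunkl_partial.
  by apply: measurable_funM; [exact: measurable_horner|exact: measurable_gw].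
have fcvg v : f N v @[N --> \oo] --> dunkl_ser mu eps (xi * v) * (p.[v] * w v).
  by apply: cvgM; [exact: cvg_dunkl_ser|exact: cvg_cst].
have [|||||fi _ fc] := @dominated_convergence _ _ R leb setT measurableT (fun N => EFin \o f N)
  (EFin \o (fun v => dunkl_ser mu eps (xi * v) * (p.[v] * w v)))
  (EFin \o (fun v => K * expR (- (s * v ^+ 2)))).
- by move=> N; apply/measurable_EFinP; exact: mf.
- by apply/measurable_EFinP; exact: measurable_dtrans.
- by apply: aeW => v _; apply: cvg_EFin; [exact: nearW|exact: fcvg].
- by apply: integrable_mulr_cst; exact: integrable_gauss.
- by apply: aeW => v N _; rewrite lee_fin dom.
split => //.
have E N : series (fun n => eps n * xi ^+ n / dfact mu n * L ('X^n * p)) N =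
    \int[leb]_v f N v.
  rewrite /f; elim: N => [|N IH].
    rewrite /series/= big_geq//; under eq_Rintegral do rewrite big_geq// mul0r.
    by rewrite Rintegral_cst// mul0r.
  rewrite [LHS]seriesSr IH moment_gmoment// -RintegralZl//; last exact: integrable_horner_gw.
  rewrite -RintegralD//.
  - apply: eq_Rintegral => v _; rewrite [in RHS]seriesSr mulrDl; congr (_ + _).
    by rewrite /dunkl_term hornerM hornerXn exprMn; ring.
  - exact: (integrable_gauss_dom s0 (mf N) (dom N)).
  - by apply: integrable_mulr_cst; exact: integrable_horner_gw.
have -> : (series (fun n => eps n * xi ^+ n / dfact mu n * L ('X^n * p)) : nat -> R) =
    (fun N => fine (\int[leb]_v (f N v)%:E)).
  by apply/funext => N; rewrite E.
apply: fine_cvg; rewrite fineK//; exact: integrable_fin_num.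
Qed.

End one_series.

Lemma rcvg_unique (u : R^nat) (a b : R) :
  u n @[n --> \oo] --> a -> u n @[n --> \oo] --> b -> a = b.
Proof. by move=> /(cvg_lim (@Rhausdorff R)) <- /(cvg_lim (@Rhausdorff R)). Qed.

Lemma cvg_double_nat : N.*2 @[N --> \oo] --> \oo.
Proof.
move=> P [N _ NP]; exists N => // n /= Nn; apply: NP => /=.
by rewrite (leq_trans Nn)// -addnn leq_addr.
Qed.

Lemma dtransP eps a p q xi : (forall n, `|eps n| <= 1) ->
  dtrans eps (a *: p + q) xi = a * dtrans eps p xi + dtrans eps q xi.
Proof.
move=> eps1; have [_ h] := dtrans_cvg eps1 (a *: p + q) xi.
have [_ h1] := dtrans_cvg eps1 p xi; have [_ h2] := dtrans_cvg eps1 q xi.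
apply: rcvg_unique h _.
have -> : series (fun n => eps n * xi ^+ n / dfact mu n * L ('X^n * (a *: p + q))) =
    (fun N => a * series (fun n => eps n * xi ^+ n / dfact mu n * L ('X^n * p)) N +
              series (fun n => eps n * xi ^+ n / dfact mu n * L ('X^n * q)) N).
  apply/funext => N; rewrite /series/= mulr_sumr -big_split/=; apply: eq_bigr => i _.
  by rewrite mulrDr -scalerAr linearP/=; ring.
by apply: cvgD h2; apply: cvgM h1; exact: cvg_cst.
Qed.

(* Multiplying the transform by [xi] shifts the series by one term, and the
   factor [theta n.+1] gained from [dfact] turns ['X^n] into [dunkl_op 'X^n.+1],
   which the antisymmetry of the Dunkl operator moves to the other factor. *)
Lemma dtrans_raise eps eps' p xi : (forall n, `|eps n| <= 1) -> (forall n, `|eps' n| <= 1) ->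
  (forall n, eps n.+1 = eps' n) ->
  dtrans eps ('X * p - dunkl_op mu p) xi = xi * dtrans eps' p xi.
Proof.
move=> h h' E; have [_] := dtrans_cvg h ('X * p - dunkl_op mu p) xi.
have [_ c'] := dtrans_cvg h' p xi.
have m1 : gmoment mu (1 / 2) 1 = 0 by exact: gmoment_odd.
have mE q r : L (dunkl_op mu q * r) = L ('X * q * r) - L (q * dunkl_op mu r).
  have := moment_dunkl m1 (gmoment_halfSS hmu) q r; rewrite mul1r => <-.
  by rewrite addrK.
rewrite -cvg_shiftS => c; apply: rcvg_unique c _.
have -> : (fun N => series (fun n => eps n * xi ^+ n / dfact mu n *
      L ('X^n * ('X * p - dunkl_op mu p))) N.+1) =
    (fun N => xi * series (fun n => eps' n * xi ^+ n / dfact mu n * L ('X^n * p)) N).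
  apply/funext => N; rewrite /series/= big_nat_recl// [RHS]mulr_sumr.
  have T q : L (q * ('X * p - dunkl_op mu p)) = L (dunkl_op mu q * p).
    by rewrite mE mulrBr linearB/= mulrA [q * 'X]mulrC.
  rewrite T dunkl_op_Xn theta0 scale0r mul0r linear0 mulr0 add0r.
  apply: eq_bigr => i _; rewrite T dunkl_op_Xn -[(_ *: _) * p]scalerAl linearZ/= E dfactS exprS.
  by field; rewrite !gt_eqF ?dfact_gt0 ?theta_gt0.
by apply: cvgM c'; exact: cvg_cst.
Qed.

Lemma dtrans_ci_one xi :
  dtrans ci 1 xi = gmoment mu (1 / 2) 0 * expR (- (xi ^+ 2 / 2)).
Proof.
have [_ c] := dtrans_cvg ci_le1 1 xi.
have c2 : series (fun n => ci n * xi ^+ n / dfact mu n * L ('X^n * 1)) N.*2 @[N --> \oo] -->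
    dtrans ci 1 xi.
  by apply: cvg_comp c; exact: cvg_double_nat.
apply: rcvg_unique c2 _.
(* The moment recursion cancels the factors [theta] of odd index in [dfact]; those of even index are
   [2 * j] and give the denominators of the exponential series. As [ci] vanishes on odd indices,
   partial sums of even length are compared. *)
have mj j : gmoment mu (1 / 2) j.*2 / dfact mu j.*2 =
    gmoment mu (1 / 2) 0 / (2 ^+ j * j`!%:R).
  elim: j => [|j IH]; first by rewrite dfact0 fact0 expr0 mulr1.
  rewrite doubleS gmoment_halfSS// !dfactS -[j.*2.+2]doubleS.
  have -> : theta mu j.+1.*2 = 2 * j.+1%:R by rewrite /theta odd_double addr0 -mul2n natrM.
  transitivity (gmoment mu (1 / 2) j.*2 / dfact mu j.*2 / (2 * j.+1%:R)).
    by field; rewrite !gt_eqF ?dfact_gt0 ?theta_gt0// nat1r pnatr_eq0.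
  rewrite IH factS natrM exprS; field.
  by rewrite !gt_eqF ?exprn_gt0 ?ltr0n ?fact_gt0// nat1r pnatr_eq0.
have -> : (fun N => series (fun n => ci n * xi ^+ n / dfact mu n * L ('X^n * 1)) N.*2) =
    (fun N => gmoment mu (1 / 2) 0 * series (exp_coeff (- (xi ^+ 2 / 2))) N).
  apply/funext; elim => [|N IH].
    by rewrite /series/= !big_geq// mulr0.
  rewrite doubleS !seriesSr IH mulrDr -addrA; congr (_ + _).
  rewrite !mulr1 !moment_Xn /ci /= odd_double/= doubleK !mul0r addr0.
  transitivity ((-1) ^+ N * xi ^+ N.*2 * (gmoment mu (1 / 2) N.*2 / dfact mu N.*2)).
    by ring.
  rewrite mj /exp_coeff /=.
  rewrite -mul2n exprM [(- (_ / _)) ^+ _]exprNn expr_div_n; field.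
  by rewrite !gt_eqF ?exprn_gt0 ?ltr0n ?fact_gt0.
apply: cvgM; [exact: cvg_cst|exact: is_cvg_series_exp_coeff].
Qed.

Lemma dtrans_si_one xi : dtrans si 1 xi = 0.
Proof.
have [_ c] := dtrans_cvg si_le1 1 xi; apply: rcvg_unique c _.
have -> : series (fun n => si n * xi ^+ n / dfact mu n * L ('X^n * 1)) = cst 0.
  apply/funext => N; rewrite /series/= big1// => i _.
  rewrite mulr1 moment_Xn; case: (boolP (odd i)) => io; first by rewrite gmoment_odd ?mulr0.
  by rewrite /si (negbTE io) !mul0r.
exact: cvg_cst.
Qed.

(** [Rc] and [Rs] together say that raising multiplies the transform by ['i * xi]. Since
    ['i ^+ n = - 'i ^+ n.+2], the plus sign in [hermite_raise] becomes the minus sign of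
    [hermiteSS], so that the transforms satisfy the Hermite recurrence again. *)
Lemma dtrans_hermite n xi :
  dtrans ci (hermite mu n) xi =
    ci n * gmoment mu (1 / 2) 0 * ((hermite mu n).[xi] * expR (- (xi ^+ 2 / 2))) /\
  dtrans si (hermite mu n) xi =
    si n * gmoment mu (1 / 2) 0 * ((hermite mu n).[xi] * expR (- (xi ^+ 2 / 2))).
Proof.
have nsi1 k : `|(fun j => - si j : R) k| <= 1 by rewrite normrN si_le1.
have nsi p : dtrans (fun j => - si j) p xi = - dtrans si p xi.
  have [_ c1] := dtrans_cvg nsi1 p xi; have [_ c2] := dtrans_cvg si_le1 p xi.
  apply: rcvg_unique c1 _.
  have -> : series (fun n => - si n * xi ^+ n / dfact mu n * L ('X^n * p)) =
      (fun N => - series (fun n => si n * xi ^+ n / dfact mu n * L ('X^n * p)) N).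
    by apply/funext => N; rewrite /series/= -sumrN; apply: eq_bigr => i _; rewrite !mulNr.
  exact: cvgN.
have Rc p : dtrans ci ('X * p - dunkl_op mu p) xi = - (xi * dtrans si p xi).
  by rewrite (dtrans_raise _ _ ci_le1 nsi1) ?nsi ?mulrN// => k; rewrite ciS.
have Rs p : dtrans si ('X * p - dunkl_op mu p) xi = xi * dtrans ci p xi.
  by rewrite (dtrans_raise _ _ si_le1 ci_le1)// => k; rewrite siS.
elim/ltn_ind: n => -[|[|n]] IH.
- by rewrite hermite0 dtrans_ci_one dtrans_si_one /ci /si /= hornerC; split; ring.
- have -> : hermite mu 1 = 'X * 1 - dunkl_op mu 1.
    by rewrite hermite1 -(expr0 'X) dunkl_op_Xn theta0 scale0r subr0 expr0 mulr1.
  rewrite Rc Rs dtrans_ci_one dtrans_si_one /ci /si /=.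
  rewrite hornerD hornerN -(expr0 'X) dunkl_op_Xn theta0 scale0r horner0 subr0 expr0 mulr1 hornerX.
  by split; ring.
have [IHc IHs] := IH n.+1 (ltnSn _); have [IHc0 IHs0] := IH n (ltnW (ltnSn _)).
have E eps : (forall k, `|eps k| <= 1) -> dtrans eps (hermite mu n.+2) xi =
    theta mu n.+1 / 2 * dtrans eps (hermite mu n) xi +
    dtrans eps ('X * hermite mu n.+1 - dunkl_op mu (hermite mu n.+1)) xi.
  by move=> e1; rewrite hermite_raise addrC dtransP.
rewrite !E; [|exact: si_le1|exact: ci_le1].
rewrite Rc Rs IHc IHs IHc0 IHs0 hermiteSS hornerD hornerN hornerZ hornerM hornerX.
by rewrite !ciS !siS ciS; split; ring.
Qed.

End transform.

(** * Spherical Bessel functions as the even and odd parts of the kernel series *)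

Section bessel.
Context {R : realType}.
Variable mu : R.
Hypothesis hmu : - (1 / 2) < mu.

Lemma Gamma_shift (x : R) n : 1 / 2 < x ->
  Gamma (n%:R + x) = Gamma x * \prod_(i < n) (x + i%:R).
Proof.
move=> x0; elim: n => [|n IH]; first by rewrite add0r big_ord0 mulr1.
rewrite big_ord_recr/= mulrA -IH -natr1 -addrA [1 + x]addrC addrA Gamma_add1.
  by ring.
by have := ler0n R n; lra.
Qed.

(** The factors of even index give powers of 2 and [n!]; those of odd index give the rising
    factorial of [mu + 1], which is a quotient of Gamma values by [Gamma_shift]. *)
Lemma dfact_double n :
  dfact mu n.*2 = (2 ^+ n) ^+ 2 * n`!%:R * \prod_(i < n) (mu + 1 + i%:R).
Proof.
elim: n => [|n IH]; first by rewrite dfact0 big_ord0 expr0 expr1n !mulr1.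
have e : theta mu n.*2.+2 = 2 * n.+1%:R :> R.
  by rewrite -doubleS /theta odd_double addr0 -mul2n natrM.
rewrite doubleS !dfactS IH big_ord_recr/= e theta_doubleS factS natrM [2 ^+ n.+1]exprS.
by rewrite -natr1; ring.
Qed.

Lemma dfact_doubleS n :
  dfact mu n.*2.+1 =
  (2 ^+ n) ^+ 2 * n`!%:R * (2 * (mu + 1)) * \prod_(i < n) (mu + 1 + 1 + i%:R).
Proof.
rewrite dfactS dfact_double theta_doubleS -[RHS]mulrA.
have -> : 2 * (mu + 1) * \prod_(i < n) (mu + 1 + 1 + i%:R) =
    2 * \prod_(i < n.+1) (mu + 1 + i%:R) :> R.
  rewrite big_ord_recl /= addr0 mulrA; congr (_ * _).
  by apply: eq_bigr => i _; rewrite /bump/= add1n -natr1; ring.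
by rewrite big_ord_recr/=; ring.
Qed.

Lemma prod_gt0_shift (x : R) n : 0 < x -> 0 < \prod_(i < n) (x + i%:R).
Proof. by move=> x0; apply: prodr_gt0 => i _; rewrite ltr_wpDr. Qed.

Definition bessel_term (nu z : R) (n : nat) : R :=
  (-1) ^+ n * (z / 2) ^+ (2 * n) / (n`!%:R * Gamma (n%:R + nu + 1)).

Lemma bessel_termE nu z n : - (1 / 2) < nu ->
  Gamma (nu + 1) * bessel_term nu z n =
  (-1) ^+ n * z ^+ n.*2 / ((2 ^+ n) ^+ 2 * n`!%:R * \prod_(i < n) (nu + 1 + i%:R)).
Proof.
move=> hnu; have h : 1 / 2 < nu + 1 by lra.
rewrite /bessel_term -addrA Gamma_shift// mul2n expr_div_n.
have -> : 2 ^+ n.*2 = (2 ^+ n) ^+ 2 :> R by rewrite -exprM muln2.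
field; rewrite !gt_eqF ?Gamma_gt0 ?exprn_gt0 ?ltr0n ?fact_gt0//.
by rewrite prod_gt0_shift//; lra.
Qed.

Lemma series_dunkl_ci z N :
  series (dunkl_term mu ci z) N.*2 = Gamma (mu + 1) * series (bessel_term mu z) N.
Proof.
elim: N => [|N IH]; first by rewrite /series/= !big_geq// mulr0.
rewrite doubleS !seriesSr IH mulrDr -addrA
    bessel_termE//; congr (_ + _).
by rewrite /dunkl_term /ci /= odd_double/= doubleK !mul0r addr0 dfact_double.
Qed.

Lemma series_dunkl_si z N :
  series (dunkl_term mu si z) N.*2 =
  z / (2 * (mu + 1)) * (Gamma (mu + 1 + 1) * series (bessel_term (mu + 1) z) N).
Proof.
have h : - (1 / 2) < mu + 1 by move: hmu; lra.
have mu1 : 0 < mu + 1 by move: hmu; lra.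
elim: N => [|N IH]; first by rewrite /series/= !big_geq// !mulr0.
rewrite doubleS !seriesSr IH (mulrDr (Gamma _)) (mulrDr (z / _)) -addrA
    bessel_termE//; congr (_ + _).
rewrite /dunkl_term /si /= odd_double/= !mul0r add0r uphalf_double dfact_doubleS exprS.
field; rewrite !gt_eqF ?exprn_gt0 ?ltr0n ?fact_gt0//.
by rewrite prod_gt0_shift//; move: hmu; lra.
Qed.

Lemma bessel_j_ci z : bessel_j mu z = dunkl_ser mu ci z.
Proof.
have G0 : Gamma (mu + 1) != 0 by rewrite gt_eqF// Gamma_gt0//; move: hmu; lra.
have c : series (dunkl_term mu ci z) N.*2 @[N --> \oo] --> dunkl_ser mu ci z.
  by apply: (cvg_comp _ _ cvg_double_nat); apply: cvg_dunkl_ser => //; exact: ci_le1.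
have c2 : series (bessel_term mu z) N @[N --> \oo] -->
    (Gamma (mu + 1))^-1 * dunkl_ser mu ci z.
  have -> : series (bessel_term mu z) =
      (fun N => (Gamma (mu + 1))^-1 * series (dunkl_term mu ci z) N.*2).
    by apply/funext => N; rewrite series_dunkl_ci mulKf.
  by apply: cvgM c; exact: cvg_cst.
by rewrite /bessel_j -/(bessel_term mu z) (cvg_lim (@Rhausdorff R) c2) mulVKf.
Qed.

Lemma bessel_j_si z : z / (2 * (mu + 1)) * bessel_j (mu + 1) z = dunkl_ser mu si z.
Proof.
have mu1 : 0 < mu + 1 by move: hmu; lra.
have G0 : Gamma (mu + 1 + 1) != 0 by rewrite gt_eqF// Gamma_gt0//; move: hmu; lra.
have c : series (dunkl_term mu si z) N.*2 @[N --> \oo] --> dunkl_ser mu si z.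
  by apply: (cvg_comp _ _ cvg_double_nat); apply: cvg_dunkl_ser => //; exact: si_le1.
(* The Bessel series is recovered below by dividing by [z], so 0 is treated apart. *)
have [z0|z0] := eqVneq z 0.
  move: c; rewrite z0 !mul0r => c; symmetry; apply: rcvg_unique c _.
  have -> : (fun N => series (dunkl_term mu si 0) N.*2) = cst 0.
    by apply/funext => N; rewrite series_dunkl_si !mul0r.
  exact: cvg_cst.
have d0 : z / (2 * (mu + 1)) != 0 by rewrite mulf_neq0// invr_eq0 gt_eqF// mulr_gt0.
have c2 : series (bessel_term (mu + 1) z) N @[N --> \oo] -->
    (Gamma (mu + 1 + 1))^-1 * ((z / (2 * (mu + 1)))^-1 * dunkl_ser mu si z).
  have -> : series (bessel_term (mu + 1) z) = (fun N =>
      (Gamma (mu + 1 + 1))^-1 * ((z / (2 * (mu + 1)))^-1 * series (dunkl_term mu si z) N.*2)).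
    by apply/funext => N; rewrite series_dunkl_si !mulKf.
  by apply: cvgM; [exact: cvg_cst|apply: cvgM c; exact: cvg_cst].
by rewrite /bessel_j -/(bessel_term (mu + 1) z) (cvg_lim (@Rhausdorff R) c2) mulVKf// mulVKf.
Qed.

Local Open Scope complex_scope.

Lemma dunkl_EE (w v : R) :
  dunkl_E mu w v = dunkl_ser mu ci (w * v) +i* dunkl_ser mu si (w * v).
Proof.
rewrite /dunkl_E bessel_j_ci -bessel_j_si.
have mu1 : mu + 1 != 0 by rewrite gt_eqF//; move: hmu; lra.
rewrite -fmorphV -mulrA -!rmorphM/=.
by apply/eqP; rewrite eq_complex /= ; apply/andP; split; apply/eqP => /=; ring.
Qed.

End bessel.

(** * Real square-integrable functions and their inner product *)

Section real_L2.
Context {R : realType}.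
Local Notation leb := (@lebesgue_measure R).
Implicit Types F G H : R -> R.

Definition L2 F := measurable_fun [set: R] F /\
  leb.-integrable [set: R] (EFin \o (fun v => F v ^+ 2)).

Definition ip F G : R := \int[leb]_v (F v * G v).

Lemma integrable_le (F G : R -> R) : measurable_fun [set: R] F ->
  leb.-integrable [set: R] (EFin \o G) -> (forall v, `|F v| <= G v) ->
  leb.-integrable [set: R] (EFin \o F).
Proof.
move=> mF iG FG; apply: (le_integrable measurableT _ _ iG) => /=.
- exact/measurable_EFinP.
- by move=> v _; rewrite lee_fin (le_trans (FG v))// ler_norm.
Qed.

Lemma integrable_add F G :
  leb.-integrable [set: R] (EFin \o F) -> leb.-integrable [set: R] (EFin \o G) ->
  leb.-integrable [set: R] (EFin \o (fun v => F v + G v)).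
Proof. by move=> h1 h2; have := integrableD measurableT h1 h2. Qed.

Lemma ae_imp (P Q : R -> Prop) :
  {ae leb, forall v, P v} -> (forall v, P v -> Q v) -> {ae leb, forall v, Q v}.
Proof.
by move=> [N [mN N0 sN]] PQ; exists N; split => // v /= nQ; apply: sN => /= /PQ.
Qed.

Lemma L2_le F G : measurable_fun [set: R] F -> L2 G -> (forall v, `|F v| <= `|G v|) -> L2 F.
Proof.
move=> mF [mG iG] FG; split => //; apply: integrable_le iG _; first by mfun.
move=> v; rewrite ger0_norm ?sqr_ge0// -[F v ^+ 2]real_normK ?num_real//.
by rewrite -[G v ^+ 2]real_normK ?num_real// lerXn2r ?nnegrE.
Qed.

Lemma integrable_mul F G : L2 F -> L2 G ->
  leb.-integrable [set: R] (EFin \o (fun v => F v * G v)).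
Proof.
move=> [mF iF] [mG iG]; apply: (@integrable_le _ (fun v => F v ^+ 2 + G v ^+ 2)).
- by mfun.
- exact: integrable_add.
- move=> v; rewrite normrM -[F v ^+ 2]real_normK ?num_real// -[G v ^+ 2]real_normK ?num_real//.
  have := sqr_ge0 (`|F v| - `|G v|); have := normr_ge0 (F v); have := normr_ge0 (G v).
  by nra.
Qed.

Lemma L2_lin a F G : L2 F -> L2 G -> L2 (fun v => a * F v + G v).
Proof.
move=> hF hG; have [mF iF] := hF; have [mG iG] := hG; split; first by mfun.
have -> : (fun v => (a * F v + G v) ^+ 2) =
    (fun v => (a ^+ 2 * F v ^+ 2 + (2 * a) * (F v * G v)) + G v ^+ 2).
  by apply/funext => v; ring.
apply: (integrable_add _ iG); apply: (integrable_add (integrable_mulr_cst _ iF)).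
exact/integrable_mulr_cst/integrable_mul.
Qed.

Lemma L20 : L2 (fun=> 0).
Proof.
split; first exact: measurable_cst.
have -> : (fun _ : R => (0 : R) ^+ 2) = (fun=> 0) by apply/funext => v; rewrite expr0n.
exact: integrable0.
Qed.

Lemma L2Z a F : L2 F -> L2 (fun v => a * F v).
Proof.
move=> hF; have := L2_lin a hF L20.
by under [X in L2 X -> _]eq_fun do rewrite addr0.
Qed.

Lemma L2B F G : L2 F -> L2 G -> L2 (fun v => F v - G v).
Proof.
move=> hF hG; have := L2_lin (-1) hG hF.
by under [X in L2 X -> _]eq_fun do rewrite mulN1r addrC.
Qed.

Lemma ipC F G : ip F G = ip G F.
Proof. by apply: eq_Rintegral => v _; rewrite mulrC. Qed.

Lemma ip_linl a F G H : L2 F -> L2 G -> L2 H ->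
  ip (fun v => a * F v + G v) H = a * ip F H + ip G H.
Proof.
move=> hF hG hH; rewrite /ip.
have E v : (a * F v + G v) * H v = a * (F v * H v) + G v * H v by ring.
under eq_Rintegral do rewrite E.
rewrite RintegralD//; last 2 first.
- exact/integrable_mulr_cst/integrable_mul.
- exact: integrable_mul.
by rewrite RintegralZl//; exact: integrable_mul.
Qed.

Lemma ip_linr a F G H : L2 F -> L2 G -> L2 H ->
  ip H (fun v => a * F v + G v) = a * ip H F + ip H G.
Proof. by move=> hF hG hH; rewrite ipC ip_linl// ![ip _ H]ipC. Qed.

Lemma ip0l F : ip (fun=> 0) F = 0.
Proof. by rewrite /ip; under eq_Rintegral do rewrite mul0r; rewrite Rintegral_cst// mul0r. Qed.

Lemma ipZl a F H : L2 F -> L2 H -> ip (fun v => a * F v) H = a * ip F H.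
Proof.
move=> hF hH; have := ip_linl a hF L20 hH; rewrite ip0l addr0 => <-.
by apply: eq_Rintegral => v _; rewrite addr0.
Qed.

Lemma ipBl F G H : L2 F -> L2 G -> L2 H ->
  ip (fun v => F v - G v) H = ip F H - ip G H.
Proof.
move=> hF hG hH; have := ip_linl (-1) hG hF hH; rewrite mulN1r addrC => <-.
by apply: eq_Rintegral => v _; ring.
Qed.

Lemma ip_sqr_ge0 F : 0 <= ip F F.
Proof. by apply: Rintegral_ge0 => v _; rewrite -expr2 sqr_ge0. Qed.

Lemma ip_sqr_linE a F G : L2 F -> L2 G ->
  ip (fun v => a * F v + G v) (fun v => a * F v + G v) =
  a ^+ 2 * ip F F + 2 * a * ip F G + ip G G.
Proof.
by move=> hF hG; rewrite ip_linl ?ip_linr//; [rewrite (ipC G F); ring|exact: L2_lin].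
Qed.

Lemma ip_sqrZ a F : L2 F -> ip (fun v => a * F v) (fun v => a * F v) = a ^+ 2 * ip F F.
Proof. by move=> hF; rewrite ipZl ?(ipC F) ?ipZl//; [ring|exact: L2Z]. Qed.

Lemma cauchy_schwarz F G : L2 F -> L2 G -> ip F G ^+ 2 <= ip F F * ip G G.
Proof.
move=> hF hG; have FF := ip_sqr_ge0 F; have GG := ip_sqr_ge0 G.
have Q a : 0 <= a ^+ 2 * ip F F + 2 * a * ip F G + ip G G.
  by rewrite -ip_sqr_linE// ip_sqr_ge0.
have [F0|F0] := eqVneq (ip F F) 0.
  have [->|FG0] := eqVneq (ip F G) 0; first by rewrite expr0n mulr_ge0.
  (* With [ip F F = 0] the quadratic is affine in its parameter; this parameter would give it the
     value -1. *)
  have := Q (- (ip G G + 1) / (2 * ip F G)); rewrite F0 mulr0 add0r.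
  have -> : 2 * (- (ip G G + 1) / (2 * ip F G)) * ip F G + ip G G = -1 by field.
  by rewrite lerNr oppr0 ler10.
have Fp : 0 < ip F F by rewrite lt0r F0.
have := Q (- ip F G / ip F F); rewrite -(ler_pM2l Fp) mulr0.
have -> : ip F F * ((- ip F G / ip F F) ^+ 2 * ip F F + 2 * (- ip F G / ip F F) * ip F G + ip G G)
  = ip F F * ip G G - ip F G ^+ 2 by field.
by rewrite subr_ge0.
Qed.

Lemma ip_sqr_addr_le F G : L2 F -> L2 G ->
  ip (fun v => F v + G v) (fun v => F v + G v) <= 2 * ip F F + 2 * ip G G.
Proof.
move=> hF hG; have := ip_sqr_linE 1 hF hG; have := ip_sqr_linE (-1) hF hG.
have := ip_sqr_ge0 (fun v => -1 * F v + G v).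
have -> : (fun v => 1 * F v + G v) = (fun v => F v + G v) by apply/funext => v; rewrite mul1r.
by move=> h1 h2 h3; nra.
Qed.

End real_L2.

(** * The closure of a linear class in the mean square *)

Section approximation.
Context {R : realType}.
Local Notation leb := (@lebesgue_measure R).
Variable S : set (R -> R).
Hypothesis SL2 : forall G, S G -> L2 G.
Hypothesis Slin : forall a G H, S G -> S H -> S (fun v => a * G v + H v).
Implicit Types F G H : R -> R.

Definition approx F := L2 F /\
  forall eps, 0 < eps -> exists2 G, S G & ip (fun v => F v - G v) (fun v => F v - G v) < eps.

Lemma approx_L2 F : approx F -> L2 F. Proof. by case. Qed.

Lemma approx_in G : S G -> approx G.
Proof.
move=> SG; split; first exact: SL2.
move=> eps e0; exists G => //; rewrite /ip.
by under eq_Rintegral do rewrite subrr mul0r; rewrite Rintegral_cst// mul0r.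
Qed.

Lemma approx_closed F : L2 F ->
  (forall eps, 0 < eps -> exists2 G, approx G &
    ip (fun v => F v - G v) (fun v => F v - G v) < eps) ->
  approx F.
Proof.
move=> hF h; split => // eps e0; have e4 : 0 < eps / 4 by rewrite divr_gt0.
have [G [hG aG] FG] := h _ e4; have [H SH GH] := aG _ e4.
exists H => //; have hH := SL2 SH.
have := ip_sqr_addr_le (L2B hF hG) (L2B hG hH).
have -> : (fun v => F v - G v + (G v - H v)) = (fun v => F v - H v).
  by apply/funext => v; rewrite addrA subrK.
by move=> /le_lt_trans; apply; lra.
Qed.

Lemma approx_lin a F G : approx F -> approx G -> approx (fun v => a * F v + G v).
Proof.
move=> [hF aF] [hG aG]; split; first exact: L2_lin.
move=> eps e0; have a0 : 0 < 4 * (a ^+ 2 + 1) by rewrite mulr_gt0// ltr_wpDl ?sqr_ge0.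
have [|F' SF' FF'] := aF (eps / (4 * (a ^+ 2 + 1))); first by rewrite divr_gt0.
have [|G' SG' GG'] := aG (eps / 4); first by rewrite divr_gt0.
exists (fun v => a * F' v + G' v); first exact: Slin.
have hF' := L2B hF (SL2 SF'); have hG' := L2B hG (SL2 SG').
have := ip_sqr_addr_le (L2Z a hF') hG'.
have -> : (fun v => a * (F v - F' v) + (G v - G' v)) =
    (fun v => a * F v + G v - (a * F' v + G' v)) by apply/funext => v; ring.
move=> /le_lt_trans; apply; rewrite ip_sqrZ//.
move: FF' GG'; rewrite ltr_pdivlMr// => FF' GG'.
have := ip_sqr_ge0 (fun v => F v - F' v); have := sqr_ge0 a.
by nra.
Qed.

Lemma approxZ a F : approx F -> approx (fun v => a * F v).
Proof.
(* Any approximant of [F], subtracted from itself, shows that [S] contains 0. *)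
move=> aF; have a0 : approx (fun=> 0).
  have [G SG _] := (approx_L2 aF, aF).2.2 1 ltr01.
  have := approx_in (Slin (-1) SG SG).
  by under [X in approx X -> _]eq_fun do rewrite mulN1r addNr.
have := approx_lin a aF a0.
by under [X in approx X -> _]eq_fun do rewrite addr0.
Qed.

(** Dominated convergence applied to the squared differences, with majorant [4 * H v ^+ 2]. Every
    limit in the density proof passes through this lemma. *)
Lemma approx_dominated (f : (R -> R)^nat) F H :
  measurable_fun [set: R] F -> L2 H ->
  (forall n, approx (f n)) ->
  (forall n v, `|f n v| <= H v) -> (forall v, `|F v| <= H v) ->
  {ae leb, forall v, f n v @[n --> \oo] --> F v} ->
  approx F.
Proof.
move=> mF hH af fH FH fF.
have H0 v : 0 <= H v by exact: le_trans (FH v).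
have hF : L2 F by apply: L2_le hH _ => // v; rewrite (ger0_norm (H0 v)).
apply: approx_closed => // eps e0.
have [|||||_ _ c] := @dominated_convergence _ _ R leb setT measurableT
  (fun n => EFin \o (fun v => (F v - f n v) * (F v - f n v))) (EFin \o (fun=> 0))
  (EFin \o (fun v => 4 * H v ^+ 2)).
- by move=> n; apply/measurable_EFinP; have [mf _] := approx_L2 (af n); mfun.
- exact/measurable_EFinP/measurable_cst.
- apply: ae_imp fF _ => v fv _ /=.
  apply: cvg_EFin; first exact: nearW.
  have d : F v - f n v @[n --> \oo] --> 0.
    by rewrite -(subrr (F v)); apply: cvgB fv; exact: cvg_cst.
  have := cvgM d d; rewrite mulr0 => d2; exact: d2.
- by apply: integrable_mulr_cst; case: hH.
- apply: aeW => v n _ /=; rewrite lee_fin normrM -expr2.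
  have -> : 4 * H v ^+ 2 = (H v + H v) ^+ 2 by ring.
  rewrite lerXn2r ?nnegrE ?addr_ge0// (le_trans (ler_normB _ _))//.
  by rewrite lerD.
have c0 : ip (fun v => F v - f n v) (fun v => F v - f n v) @[n --> \oo] --> 0.
  apply: fine_cvg; move: c; rewrite /= integral0_eq//.
move/cvgr0Pnorm_lt : c0 => /(_ eps e0) [N _ /(_ N (leqnn N)) h]; exists (f N) => //.
by move: h; rewrite /= ger0_norm// ip_sqr_ge0.
Qed.

End approximation.

(** * Step functions as limits of powers *)

Section sharp_cutoff.
Context {R : realType}.

Lemma bernoulli_le (z : R) m : 0 <= z <= 1 -> 1 - m%:R * z <= (1 - z) ^+ m.
Proof.
move=> /andP[z0 z1]; elim: m => [|m IH]; first by rewrite mul0r subr0.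
rewrite exprS -natr1.
apply: le_trans (ler_wpM2l _ IH); last by rewrite subr_ge0.
by have := ler0n R m; nra.
Qed.

Lemma cvg_expR_natmul (d : R) : 0 < d -> expR (- (n%:R * d)) @[n --> \oo] --> (0 : R).
Proof.
move=> d0; apply: (cvg_comp _ (fun t => expR (- (t * d))) (@cvgr_idn R)).
apply: (cvg_comp (fun t => t * d) (fun t => expR (- t)) _ (@cvgr_expR R)).
by apply: gt0_cvgMly => //; exact: cvg_id.
Qed.

(** An integer exponent of size [expR (n y)] makes the cutoff a polynomial in [expR (- (n x))]. When
    [x] is a multiple of a squared distance, this is a combination of Gaussians. *)
Definition cutoff_exp (y : R) (n : nat) : nat := (Num.trunc (expR (n%:R * y))).+1.

(* A double exponential: below [y] the power beats [expR (n * y)], above it does not. *)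
Lemma cvg_cutoff_lt (x y : R) : 0 <= x -> x < y ->
  (1 - expR (- (n%:R * x))) ^+ cutoff_exp y n @[n --> \oo] --> (0 : R).
Proof.
move=> x0 xy; have d0 : 0 < y - x by rewrite subr_gt0.
apply: (@squeeze_cvgr _ _ _ _ (cst 0) (fun n => expR (- (n%:R * (y - x))))).
- apply: nearW => n; have e1 : expR (- (n%:R * x)) <= 1.
    by rewrite -[leRHS]expR0 ler_expR oppr_le0 mulr_ge0.
  rewrite /= exprn_ge0 ?subr_ge0//=.
  apply: (@le_trans _ _ (expR (- expR (- (n%:R * x))) ^+ cutoff_exp y n)).
    apply: lerXn2r; rewrite ?nnegrE ?subr_ge0 ?expR_ge0//.
    exact: expR_ge1Dx.
  rewrite -expRM_natl ler_expR mulrN lerN2.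
  apply: (@le_trans _ _ (expR (n%:R * (y - x)))).
    by rewrite (le_trans _ (expR_ge1Dx _))// lerDr.
  rewrite mulrBr expRD ler_wpM2r ?expR_ge0//.
  by rewrite ltW// truncnS_gt.
- exact: cvg_cst.
- exact: cvg_expR_natmul.
Qed.

Lemma cvg_cutoff_gt (x y : R) : 0 <= y -> y < x ->
  (1 - expR (- (n%:R * x))) ^+ cutoff_exp y n @[n --> \oo] --> (1 : R).
Proof.
move=> y0 yx; have d0 : 0 < x - y by rewrite subr_gt0.
have x0 : 0 <= x by rewrite (le_trans y0)// ltW.
apply: (@squeeze_cvgr _ _ _ _ (fun n => 1 - 2 * expR (- (n%:R * (x - y)))) (cst 1)).
- apply: nearW => n; have e1 : expR (- (n%:R * x)) <= 1.
    by rewrite -[leRHS]expR0 ler_expR oppr_le0 mulr_ge0.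
  have e2 : 1 - expR (- (n%:R * x)) <= 1 by rewrite gerBl expR_ge0.
  rewrite /= exprn_ile1 ?subr_ge0// andbT.
  (* Since [0 <= y], the exponent is at most [2 * expR (n * y)], which explains the factor 2 in the
     lower bound. *)
  apply: le_trans (bernoulli_le _ _); last by rewrite expR_ge0 e1.
  rewrite lerD2l lerN2.
  have -> : expR (- (n%:R * (x - y))) = expR (n%:R * y) * expR (- (n%:R * x)).
    by rewrite -expRD; congr expR; ring.
  rewrite mulrA ler_wpM2r ?expR_ge0// /cutoff_exp -natr1.
  have ey : 1 <= expR (n%:R * y) by rewrite -[leLHS]expR0 ler_expR mulr_ge0.
  have : (Num.trunc (expR (n%:R * y)))%:R <= expR (n%:R * y) by rewrite truncn_le.
  by lra.
- suff : (1 - 2 * expR (- (n%:R * (x - y)))) @[n --> \oo] --> (1 - 2 * 0 : R).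
    by rewrite mulr0 subr0.
  apply: cvgB; first exact: cvg_cst.
  by apply: cvgM (cvg_expR_natmul d0); exact: cvg_cst.
- exact: cvg_cst.
Qed.

End sharp_cutoff.

(** * Density of polynomials times a Gaussian *)

Section completeness.
Context {R : realType}.
Variable mu : R.
Hypothesis hmu : - (1 / 2) < mu.
Local Notation leb := (@lebesgue_measure R).

(** The square root of the weight: multiplication by it leads from the weighted space to the
    unweighted one. *)
Definition rw (v : R) : R := `|v| `^ (mu + 1 / 2).
Definition gaussian (s c v : R) : R := expR (- (s * v ^+ 2 / 2) + c * v) * rw v.
Definition polygauss : set (R -> R) := [set F | exists p : {poly R},
  F = fun v => p.[v] * gaussian 1 0 v].

Lemma rw_ge0 v : 0 <= rw v. Proof. exact: powR_ge0. Qed.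
Lemma rw_gt0 v : v != 0 -> 0 < rw v. Proof. by move=> v0; rewrite powR_gt0// normr_gt0. Qed.

Lemma rw_sqr v : rw v ^+ 2 = `|v| `^ (2 * mu + 1).
Proof. by rewrite /rw -powR_mulrn ?powR_ge0// -powRrM; congr (_ `^ _); field. Qed.

Lemma gaussian_ge0 s c v : 0 <= gaussian s c v.
Proof. by rewrite mulr_ge0 ?rw_ge0 ?expR_ge0. Qed.

Lemma measurable_rw : measurable_fun [set: R] rw.
Proof. by rewrite /rw; mfun. Qed.

Lemma measurable_gaussian s c : measurable_fun [set: R] (gaussian s c).
Proof. by rewrite /gaussian /rw; mfun. Qed.

Lemma L2_polygauss_abs (p : {poly R}) (s c : R) : 0 < s ->
  L2 (fun v => `|p.[v]| * (expR (- (s * v ^+ 2 / 2) + c * `|v|) * rw v)).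
Proof.
move=> s0; have mp := measurable_horner p; have mr := measurable_rw.
split; first by mfun.
have s2 : 0 < s / 2 by rewrite divr_gt0.
have [K K0 HK] := horner_gw_dom hmu (p ^+ 2) s2.
have s4 : 0 < s / 2 / 2 by rewrite divr_gt0.
apply: (@integrable_gauss_dom _ _ (expR (2 * c ^+ 2 / s) * K) _ s4); first by mfun.
move=> v; rewrite ger0_norm ?sqr_ge0// !exprMn rw_sqr.
rewrite -[leRHS]mulrA; apply: (@le_trans _ _
  (expR (2 * c ^+ 2 / s) * (`|(p ^+ 2).[v]| * gw mu (s / 2) v))).
  rewrite horner_exp normrX /gw -expRM_natl.
  set P := `|p.[v]| ^+ 2; set W := _ `^ _; set A := expR _; set B := expR _; set C := expR _.
  have -> : P * (A * W) = P * W * A by ring.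
  have -> : B * (P * (W * C)) = P * W * (B * C) by ring.
  rewrite ler_wpM2l ?mulr_ge0 ?exprn_ge0 ?powR_ge0// -expRD ler_expR -subr_ge0.
  rewrite -(real_normK (num_real v)).
  have -> : 2 * c ^+ 2 / s + - (s / 2 * `|v| ^+ 2) - 2%:R * (- (s * `|v| ^+ 2 / 2) + c * `|v|) =
     s / 2 * (`|v| - 2 * c / s) ^+ 2 by field; rewrite gt_eqF.
  by rewrite mulr_ge0 ?sqr_ge0// ltW.
by rewrite ler_wpM2l ?expR_ge0.
Qed.

Lemma L2_polygauss (p : {poly R}) (s c : R) : 0 < s -> L2 (fun v => p.[v] * gaussian s c v).
Proof.
move=> s0; apply: L2_le (L2_polygauss_abs p `|c| s0) _.
  by apply: measurable_funM; [exact: measurable_horner|exact: measurable_gaussian].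
move=> v; rewrite !normrM normr_id ler_wpM2l//.
rewrite !(ger0_norm (expR_ge0 _)) (ger0_norm (rw_ge0 _)).
rewrite ler_wpM2r ?rw_ge0// ler_expR lerD2l.
by rewrite -normrM ler_norm.
Qed.

Lemma polygauss_L2 F : polygauss F -> L2 F.
Proof. by move=> [p ->]; exact: L2_polygauss. Qed.

Lemma polygauss_lin a F G : polygauss F -> polygauss G -> polygauss (fun v => a * F v + G v).
Proof.
move=> [p ->] [q ->]; exists (a *: p + q); apply/funext => v.
by rewrite hornerD hornerZ; ring.
Qed.

Local Notation apx := (approx polygauss).

Lemma series_exp_coeff_le (x : R) N : `|series (exp_coeff x) N| <= expR `|x|.
Proof.
apply: (@le_trans _ _ (series (exp_coeff `|x|) N)).
  rewrite /series/= (le_trans (ler_norm_sum _ _ _))//; apply: ler_sum => i _.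
  by rewrite /exp_coeff/= normrM normrX normfV normr_nat.
rewrite /expR; apply: nondecreasing_cvgn_le; last exact: is_cvg_series_exp_coeff.
by apply: nondecreasing_series => n _; rewrite /exp_coeff /= mulr_ge0 ?exprn_ge0.
Qed.

(* The factor [expR (- (t * v ^+ 2 / 2) + d * v)] is expanded in a Taylor series;
   [t < s] keeps the partial sums dominated in [L2]. *)
Lemma approx_gaussian_step (s c t d : R) : 0 <= t -> t < s ->
  (forall p : {poly R}, apx (fun v => p.[v] * gaussian s c v)) ->
  forall p : {poly R}, apx (fun v => p.[v] * gaussian (s + t) (c + d) v).
Proof.
move=> t0 ts H p; have st : 0 < s - t by rewrite subr_gt0.
pose q : {poly R} := (- (t / 2)) *: 'X^2 + d *: 'X.
have qE v : q.[v] = - (t * v ^+ 2 / 2) + d * v.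
  by rewrite hornerD !hornerZ hornerXn hornerX; ring.
have gE v : gaussian (s + t) (c + d) v = expR q.[v] * gaussian s c v.
  by rewrite /gaussian mulrA -expRD qE; congr (expR _ * _); field.
have ql v : `|q.[v]| <= t * v ^+ 2 / 2 + `|d| * `|v|.
  rewrite qE (le_trans (ler_normD _ _))// lerD//; last by rewrite normrM.
  by rewrite normrN ger0_norm// divr_ge0// mulr_ge0// sqr_ge0.
pose f N v := p.[v] * (series (exp_coeff q.[v]) N * gaussian s c v).
have bd (x v : R) : `|x| <= expR `|q.[v]| -> `|p.[v] * (x * gaussian s c v)| <=
    `|p.[v]| * (expR (- ((s - t) * v ^+ 2 / 2) + (`|c| + `|d|) * `|v|) * rw v).
  move=> xq; rewrite /gaussian !normrM ler_wpM2l// (ger0_norm (expR_ge0 _)).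
  rewrite (ger0_norm (rw_ge0 _)) mulrA ler_wpM2r ?rw_ge0//.
  apply: le_trans (ler_wpM2r (expR_ge0 _) xq) _.
  rewrite -expRD ler_expR; have := ql v; have := ler_norm (c * v); rewrite normrM.
  by lra.
apply: (approx_dominated polygauss_L2 _ (L2_polygauss_abs p (`|c| + `|d|) st)
  (f := f)).
- by apply: measurable_funM; [exact: measurable_horner|exact: measurable_gaussian].
- move=> N; pose r : {poly R} := \sum_(i < N) (i`!%:R)^-1 *: q ^+ i.
  have -> : f N = (fun v => (p * r).[v] * gaussian s c v).
    apply/funext => v; rewrite /f hornerM -mulrA; congr (_ * (_ * _)).
    rewrite /series/= big_mkord horner_sum; apply: eq_bigr => i _.
    by rewrite /exp_coeff/= hornerZ horner_exp mulrC.
  exact: H.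
- by move=> N v; apply: bd; exact: series_exp_coeff_le.
- move=> v; rewrite gE; apply: bd; rewrite ger0_norm ?expR_ge0// ler_expR.
  exact: ler_norm.
- apply: aeW => v; rewrite gE; apply: cvgM; first exact: cvg_cst.
  by apply: cvgM; [exact: is_cvg_series_exp_coeff|exact: cvg_cst].
Qed.

(** The parameter starts at 1 and grows by [1 / 2], always less than its current value, as the
    Taylor step demands. The tilt [c] is arbitrary already at [n = 0], by a step with [t = 0]. *)
Lemma approx_gaussian n (c : R) (p : {poly R}) :
  apx (fun v => p.[v] * gaussian (1 + n%:R / 2) c v).
Proof.
elim: n c p => [|n IH] c p.
  have -> : 1 + 0%:R / 2 = 1 + 0 :> R by rewrite mul0r.
  rewrite -[c]add0r; apply: approx_gaussian_step => //.
  by move=> {}p; apply: (approx_in polygauss_L2); exists p.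
have -> : 1 + n.+1%:R / 2 = (1 + n%:R / 2) + 1 / 2 :> R by rewrite -natr1; ring.
rewrite -[c]add0r; apply: approx_gaussian_step => //.
by have := ler0n R n; lra.
Qed.

Local Notation E := (gaussian 1 0).

Lemma measurable_E : measurable_fun [set: R] E. Proof. exact: measurable_gaussian. Qed.

Lemma E_ge0 v : 0 <= E v. Proof. exact: gaussian_ge0. Qed.

Lemma E_gt0 v : v != 0 -> 0 < E v.
Proof. by move=> v0; rewrite mulr_gt0 ?expR_gt0 ?rw_gt0. Qed.

Lemma L2_E : L2 E.
Proof.
have := L2_polygauss 1 0 (@ltr01 R).
by under [X in L2 X -> _]eq_fun do rewrite hornerC mul1r.
Qed.

Lemma approx_mulE (g : R -> R) (f : (R -> R)^nat) : measurable_fun [set: R] g ->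
  (forall v, 0 <= g v <= 1) -> (forall n v, 0 <= f n v <= 1) ->
  (forall n, apx (fun v => E v * f n v)) ->
  {ae leb, forall v, f n v @[n --> \oo] --> g v} ->
  apx (fun v => E v * g v).
Proof.
move=> mg g1 f1 af fg; have mE := measurable_E.
have b (x v : R) : 0 <= x <= 1 -> `|E v * x| <= E v.
  move=> /andP[x0 x1]; rewrite normrM !ger0_norm ?E_ge0//.
  by rewrite ler_piMr ?E_ge0.
apply: (approx_dominated polygauss_L2 _ L2_E af); first by mfun.
- by move=> n v; exact: b.
- by move=> v; exact: b.
- by apply: ae_imp fg _ => v fv; apply: cvgM fv; exact: cvg_cst.
Qed.

(** Expanding the square, [E] times the [n]-th power of the translated Gaussian is a constant times
    the Gaussian of parameter [1 + n / 2] and tilt [n * r / 2]. *)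
Lemma approx_E_poly (r : R) (q : {poly R}) :
  apx (fun v => E v * q.[expR (- ((v - r) ^+ 2 / 4))]).
Proof.
elim/(@poly_lin_ind R): q => [a p q IH1 IH2|n].
  have := approx_lin polygauss_L2 polygauss_lin a IH1 IH2.
  by under [X in apx X -> _]eq_fun do rewrite mulrCA -mulrDr -hornerZ -hornerD.
have := approxZ polygauss_L2 polygauss_lin (expR (- (n%:R * r ^+ 2 / 4)))
  (approx_gaussian n (n%:R * r / 2) 1).
congr (apx _); apply/funext => v; rewrite hornerC mul1r hornerXn -expRM_natl.
rewrite /gaussian mulrA -expRD [RHS]mulrAC -expRD; congr (expR _ * _).
by field.
Qed.

(** The cutoff at level [rho ^+ 2 / 4], evaluated at [(v - r) ^+ 2 / 4], tends to the indicator
    except at the two points [r - rho] and [r + rho]. *)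
Lemma approx_E_annulus (r rho : R) : 0 < rho ->
  apx (fun v => E v * \1_[set u | rho < `|u - r|] v).
Proof.
move=> rho0.
pose f n v : R := (1 - expR (- (n%:R * ((v - r) ^+ 2 / 4)))) ^+ cutoff_exp (rho ^+ 2 / 4) n.
apply: (@approx_mulE _ f).
- apply: measurable_indic.
  rewrite (_ : [set u | rho < `|u - r|] = (fun u => `|u - r|) @^-1` `]rho, +oo[%classic).
    by rewrite -[X in measurable X]setTI;
      apply: (_ : measurable_fun setT (fun u : R => `|u - r|)) => //; mfun.
  by apply/seteqP; split => u /=; rewrite in_itv/= andbT.
- by move=> v; rewrite indicE; case: (_ \in _); rewrite ?lexx ler01.
- move=> n v; have x0 : 0 <= (v - r) ^+ 2 / 4 by rewrite divr_ge0 ?sqr_ge0.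
  have e1 : expR (- (n%:R * ((v - r) ^+ 2 / 4))) <= 1.
    by rewrite -[leRHS]expR0 ler_expR oppr_le0 mulr_ge0.
  by rewrite /f exprn_ge0 ?subr_ge0//= exprn_ile1 ?subr_ge0// gerBl expR_ge0.
- move=> n; have := approx_E_poly r ((1 - 'X^n) ^+ cutoff_exp (rho ^+ 2 / 4) n).
  congr (apx _); apply/funext => v; rewrite /f horner_exp hornerD hornerN hornerXn hornerC.
  by rewrite -expRM_natl mulrN.
- exists [set r - rho; r + rho]; split.
  + by apply: measurableU.
  + by apply: countable_lebesgue_measure0; apply: finite_set_countable; exact: finite_set2.
  + move=> v /= h; apply: contrapT => /not_orP[v1 v2]; apply: h.
    have x0 : 0 <= (v - r) ^+ 2 / 4 by rewrite divr_ge0 ?sqr_ge0.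
    have e (a b : R) : 0 <= a -> 0 <= b -> (a ^+ 2 / 4 < b ^+ 2 / 4) = (a < b).
      by move=> a0 b0; rewrite ltr_pM2r// ltr_pXn2r.
    rewrite /f -(real_normK (num_real (v - r))) indicE.
    have [h|h|h] := ltgtP rho `|v - r|.
    * rewrite mem_set//=; apply: cvg_cutoff_gt; first by rewrite divr_ge0 ?sqr_ge0.
      by rewrite e// ltW.
    * rewrite memNset/=; last by apply/negP; rewrite -leNgt ltW.
      apply: cvg_cutoff_lt; first by rewrite divr_ge0 ?sqr_ge0.
      by rewrite e// ltW.
    * exfalso; have [vr|vr] := leP 0 (v - r).
        by apply: v2; rewrite h ger0_norm//; ring.
      by apply: v1; rewrite h ltr0_norm//; ring.
Qed.

Lemma approx_E : apx E.
Proof.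
have := approx_E_poly 0 1.
by under [X in apx X -> _]eq_fun do rewrite hornerC mulr1.
Qed.

Lemma approx_E_setC (A : set R) : apx (fun v => E v * \1_A v) ->
  apx (fun v => E v * \1_(~` A) v).
Proof.
move=> h; have := approx_lin polygauss_L2 polygauss_lin (-1) h approx_E.
congr (apx _); apply/funext => v; rewrite !indicE in_setC.
by case: (_ \in _) => /=; ring.
Qed.

Lemma indic_itv01 (A : set R) v : 0 <= (\1_A v : R) <= 1.
Proof. by rewrite indicE; case: (_ \in _); rewrite ?lexx ler01. Qed.

Lemma approx_E_itv (a b : R) : a < b -> apx (fun v => E v * \1_`[a, b] v).
Proof.
move=> ab; have r0 : 0 < (b - a) / 2 by rewrite divr_gt0// subr_gt0.
have := approx_E_setC (approx_E_annulus ((a + b) / 2) r0).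
rewrite (_ : ~` _ = `[a, b]%classic)//; apply/seteqP; split => v /=.
  move/negP; rewrite -leNgt in_itv/= ler_distl => /andP[h1 h2]; apply/andP.
  by split; [move: h1|move: h2]; lra.
rewrite in_itv/= => /andP[h1 h2]; apply/negP; rewrite -leNgt ler_distl; apply/andP.
by split; lra.
Qed.

Lemma approx_E_ray (a : R) : apx (fun v => E v * \1_`[a, +oo[ v).
Proof.
apply: (@approx_mulE _ (fun n => \1_`[a, a + n.+1%:R])).
- exact: measurable_indic.
- exact: indic_itv01.
- by move=> n v; exact: indic_itv01.
- by move=> n; apply: approx_E_itv; rewrite ltrDl.
- apply: aeW => v; have [av|va] := leP a v.
    pose N := Num.trunc (v - a).
    apply: cvg_near_cst; exists N => // n /= Nn.
    rewrite !indicE !mem_set//= in_itv/= av//= -lerBlDl.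
    by apply: le_trans (ltW (truncnS_gt _)) _; rewrite ler_nat ltnS.
  rewrite (_ : (fun n => _) = cst (\1_`[a, +oo[ v)); first exact: cvg_cst.
  by apply/funext => n; rewrite !indicE !memNset//=; rewrite in_itv/= leNgt va.
Qed.

Lemma indic_bigcup_cvg (F : (set R)^nat) v : trivIset setT F ->
  \sum_(0 <= i < n) \1_(F i) v @[n --> \oo] --> (\1_(\bigcup_i F i) v : R).
Proof.
move=> tF; have [[k _ Fk]|nF] := pselect ((\bigcup_i F i) v).
  apply: cvg_near_cst; exists k.+1 => // n /= kn.
  rewrite big_mkord (bigD1 (Ordinal kn))//= big1 ?addr0.
    by rewrite !indicE !mem_set//; exists k.
  move=> i ik; rewrite indicE memNset// => Fi; move/eqP: ik; apply.
  by apply: val_inj => /=; apply: tF => //; exists v.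
rewrite (_ : (fun n => _) = cst (\1_(\bigcup_i F i) v)); first exact: cvg_cst.
apply/funext => n; rewrite indicE memNset//= big1// => i _.
by rewrite indicE memNset// => Fi; apply: nF; exists i.
Qed.

Lemma indic_sum_le1 (F : (set R)^nat) n v : trivIset setT F ->
  0 <= (\sum_(0 <= i < n) \1_(F i) v : R) <= 1.
Proof.
move=> tF; rewrite sumr_ge0//=.
elim: n => [|n IH]; first by rewrite big_geq.
rewrite big_nat_recr//= [\1_(F n) v]indicE; case: (boolP (v \in F n)) => Fn; last by rewrite addr0.
rewrite big_nat big1 ?add0r// => i /= ni; rewrite indicE memNset// => Fi.
have : i = n by apply: tF => //; exists v; split => //; exact: set_mem.
by move=> ein; rewrite ein ltnn in ni.
Qed.

Lemma approx_E_sum (F : nat -> R -> R) n : (forall i, apx (fun v => E v * F i v)) ->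
  apx (fun v => E v * \sum_(0 <= i < n) F i v).
Proof.
move=> h; elim: n => [|n IH].
  have := approxZ polygauss_L2 polygauss_lin 0 approx_E.
  by congr (apx _); apply/funext => v; rewrite big_geq// mulr0 mul0r.
have := approx_lin polygauss_L2 polygauss_lin 1 IH (h n).
by congr (apx _); apply/funext => v; rewrite big_nat_recr//= mul1r mulrDr.
Qed.

(** Closed rays are stable under intersection and generate the Borel sets; the sets whose indicator
    is approximable after multiplication by [E] form a Dynkin system. *)
Lemma approx_E_measurable (A : set R) : measurable A -> apx (fun v => E v * \1_A v).
Proof.
move=> mA; suff H : forall S, <<s @RGenCInfty.G R >> S -> apx (fun v => E v * \1_S v).
  by apply: H; rewrite -[X in X A]RGenCInfty.measurableE.
apply: (@dynkin_induction _ (measurableTypeR R) (@RGenCInfty.G R)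
  [set A : set R | apx (fun v => E v * \1_A v)]) => //.
- exact: RGenCInfty.measurableE.
- move=> _ _ [a ->] [b ->]; exists (Num.max a b).
  by apply/seteqP; split => v /=; rewrite !in_itv/= !andbT ge_max => /andP.
- rewrite /= (_ : (fun v => _) = E); first exact: approx_E.
  by apply/funext => v; rewrite indicT mulr1.
- by move=> _ [a ->]; exact: approx_E_ray.
- by move=> S _; exact: approx_E_setC.
- move=> F mF tF aF /=.
  apply: (@approx_mulE _ (fun n v => \sum_(0 <= i < n) \1_(F i) v)).
  + by apply: measurable_indic; exact: bigcupT_measurable.
  + exact: indic_itv01.
  + by move=> n v; exact: indic_sum_le1.
  + by move=> n; exact: approx_E_sum.
  + by apply: aeW => v; exact: indic_bigcup_cvg.
Qed.

Import HBNNSimple.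

Lemma approx_E_nnsfun (h : {nnsfun R >-> R}) : apx (fun v => E v * h v).
Proof.
have [n [c hE]] : exists n (c : nat -> R), forall v,
    h v = \sum_(0 <= i < n) (c i * \1_(h @^-1` [set c i]) v).
  eexists; exists (nth 0 (finmap.enum_fset (fset_set (range h)))) => v.
  by rewrite [LHS]fimfunEord; symmetry; exact: big_mkord.
have -> : (fun v => E v * h v) = (fun v => E v *
    \sum_(0 <= i < n) (c i * \1_(h @^-1` [set c i]) v)).
  by apply/funext => v; rewrite -hE.
apply: approx_E_sum => i.
have mh : measurable (h @^-1` [set c i]) by [].
have := approxZ polygauss_L2 polygauss_lin (c i) (approx_E_measurable mh).
by congr (apx _); apply/funext => v; rewrite mulrCA.
Qed.

Lemma ae_neq0 : {ae leb, forall v : R, v != 0}.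
Proof.
exists [set 0]; split => //; first exact: lebesgue_measure_set1.
by move=> v /= /negP; rewrite negbK => /eqP.
Qed.

(** Simple functions increase to [F / E], and multiplication by [E] brings them back to [F] wherever
    [E] is not 0, that is off the origin. *)
Lemma approx_L2_ge0 (F : R -> R) : L2 F -> (forall v, 0 <= F v) -> apx F.
Proof.
move=> hF F0; have [mF iF] := hF.
have mE := measurable_E.
pose g v := (F v / E v)%:E.
have mg : measurable_fun [set: R] g.
  apply/measurable_EFinP; apply: measurable_funM => //.
  (* The formula holds at 0 too, since both the inverse of 0 and this negative power of 0 are 0. *)
  rewrite (_ : (fun v => (E v)^-1) = (fun v =>
      expR (1 * v ^+ 2 / 2 - 0 * v) * `|v| `^ (- (mu + 1 / 2)))); first by mfun.
  by apply/funext => v; rewrite /gaussian /rw invfM powRN -expRN opprD opprK.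
have g0 v : (0 <= g v)%E by rewrite lee_fin divr_ge0 ?E_ge0.
pose f n : R -> R := nnsfun_approx measurableT mg n.
have fle n v : f n v <= F v / E v.
  by rewrite -lee_fin /f nnsfun_approxE; apply: le_approx => // *; exact: g0.
have f0 n v : 0 <= f n v by exact: fun_ge0.
have Efle n v : E v * f n v <= F v.
  have [->|Ev] := eqVneq (E v) 0; first by rewrite mul0r.
  by rewrite mulrC -ler_pdivlMr ?lt0r ?Ev ?E_ge0//.
apply: (approx_dominated polygauss_L2 mF hF (f := fun n v => E v * f n v)).
- by move=> n; exact: approx_E_nnsfun.
- by move=> n v; rewrite ger0_norm// mulr_ge0 ?E_ge0.
- by move=> v; rewrite ger0_norm.
- apply: ae_imp ae_neq0 _ => v v0.
  have Ev : E v != 0 by rewrite gt_eqF// E_gt0.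
  have -> : F v = E v * (F v / E v) by rewrite mulrC divfK.
  apply: cvgM; first exact: cvg_cst.
  have := @cvg_nnsfun_approx _ _ _ _ measurableT _ mg (fun x _ => g0 x) v I.
  by move/fine_cvg.
Qed.

Lemma approx_polygauss (F : R -> R) : L2 F -> apx F.
Proof.
move=> hF; have [mF iF] := hF.
have hp : L2 (fun v => Num.max (F v) 0).
  apply: L2_le hF _; first exact: measurable_maxr.
  move=> v; have [F0|F0] := leP (F v) 0; last by [].
  by rewrite normr0.
have hn : L2 (fun v => Num.max (- F v) 0).
  apply: L2_le hF _; first by apply: measurable_maxr => //; mfun.
  move=> v; have [F0|F0] := leP (- F v) 0; last by rewrite normrN.
  by rewrite normr0.
have m0 (x : R) : 0 <= Num.max x 0 by rewrite le_max lexx orbT.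
have := approx_lin polygauss_L2 polygauss_lin (-1)
  (approx_L2_ge0 hn (fun v => m0 _)) (approx_L2_ge0 hp (fun v => m0 _)).
congr (apx _); apply/funext => v; have [F0|F0] := leP (F v) 0.
  by rewrite max_l ?oppr_ge0//; ring.
by rewrite max_r ?oppr_le0 ?ltW//; ring.
Qed.

End completeness.

(** * Bessel's inequality and best approximation for an orthogonal system *)

Section bessel_inequality.
Context {R : realType}.
Variables (e : nat -> R -> R) (kap : nat -> R).
Hypothesis L2e : forall n, L2 (e n).
Hypothesis ipe : forall n m, ip (e n) (e m) = if n == m then kap n else 0.
Hypothesis kap_gt0 : forall n, 0 < kap n.

Definition partial_sum (b : nat -> R) (N : nat) (v : R) : R := \sum_(0 <= n < N) b n * e n v.

Lemma partial_sumS b N :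
  partial_sum b N.+1 = (fun v => b N * e N v + partial_sum b N v).
Proof. by apply/funext => v; rewrite /partial_sum big_nat_recr//= addrC. Qed.

Lemma partial_sum0 b : partial_sum b 0 = fun=> 0.
Proof. by apply/funext => v; rewrite /partial_sum big_geq. Qed.

Lemma L2_partial_sum b N : L2 (partial_sum b N).
Proof.
elim: N => [|N IH]; first by rewrite partial_sum0; exact: L20.
by rewrite partial_sumS; exact: L2_lin.
Qed.

Lemma ip_partial_sum b N m : ip (partial_sum b N) (e m) = if (m < N)%N then b m * kap m else 0.
Proof.
elim: N => [|N IH]; first by rewrite partial_sum0 ip0l.
rewrite partial_sumS ip_linl//; last exact: L2_partial_sum.
rewrite IH ipe ltnS; have [->|mN] := eqVneq N m; first by rewrite leqnn ltnn addr0.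
by rewrite mulr0 add0r [(m <= N)%N]leq_eqVlt (eq_sym m) (negbTE mN).
Qed.

Definition fourier (F : R -> R) (n : nat) : R := ip F (e n) / kap n.
Definition residual (F : R -> R) (N : nat) (v : R) : R := F v - partial_sum (fourier F) N v.

Lemma L2_residual F N : L2 F -> L2 (residual F N).
Proof. by move=> hF; apply: L2B => //; exact: L2_partial_sum. Qed.

Lemma residual_norm F N : L2 F -> ip (residual F N) (residual F N) =
  ip F F - \sum_(0 <= n < N) ip F (e n) ^+ 2 / kap n.
Proof.
move=> hF; elim: N => [|N IH].
  rewrite big_geq// subr0 /residual partial_sum0.
  by rewrite (_ : (fun v => F v - 0) = F)//; apply/funext => v; rewrite subr0.
have rN : ip (e N) (residual F N) = ip F (e N).
  rewrite ipC ipBl//; last exact: L2_partial_sum.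
  by rewrite ip_partial_sum ltnn subr0.
have -> : residual F N.+1 = (fun v => - fourier F N * e N v + residual F N v).
  by apply/funext => v; rewrite /residual partial_sumS; ring.
rewrite ip_sqr_linE ?IH ?rN ?ipe ?eqxx//; last exact: L2_residual.
rewrite big_nat_recr//= /fourier; field; exact: lt0r_neq0.
Qed.

Lemma bessel F N : L2 F -> \sum_(0 <= n < N) ip F (e n) ^+ 2 / kap n <= ip F F.
Proof. by move=> hF; rewrite -subr_ge0 -residual_norm// ip_sqr_ge0. Qed.

Lemma residual_homo F M N : L2 F -> (M <= N)%N ->
  ip (residual F N) (residual F N) <= ip (residual F M) (residual F M).
Proof.
move=> hF MN; rewrite !residual_norm// lerD2l lerN2 (big_cat_nat _ MN)//= lerDl.
by apply: sumr_ge0 => n _; rewrite divr_ge0 ?sqr_ge0// ltW.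
Qed.

(** Subtracting a partial sum from [F] does not change its residual, so the formula for the norm of
    the residual can be used for the difference instead of [F]. *)
Lemma residual_best F b N : L2 F ->
  ip (residual F N) (residual F N) <=
  ip (fun v => F v - partial_sum b N v) (fun v => F v - partial_sum b N v).
Proof.
move=> hF; pose G v := F v - partial_sum b N v.
have hG : L2 G by apply: L2B => //; exact: L2_partial_sum.
have -> : residual F N = residual G N.
  apply/funext => v; rewrite /residual /G -addrA; congr (_ + _).
  rewrite -opprD; congr (- _); rewrite /partial_sum -big_split/=.
  apply: eq_big_nat => n /andP[_ nN]; rewrite -mulrDl; congr (_ * _).
  rewrite /fourier ipBl//; last exact: L2_partial_sum.
  rewrite ip_partial_sum nN; field; exact: lt0r_neq0.
by rewrite residual_norm// gerBl sumr_ge0// => n _; rewrite divr_ge0 ?sqr_ge0// ltW.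
Qed.

End bessel_inequality.

(** * Hermite expansions and the uncertainty inequality for coefficients *)

Section hermite_basis.
Context {R : realType}.
Variable mu : R.
Hypothesis hmu : - (1 / 2) < mu.
Local Notation leb := (@lebesgue_measure R).
Local Notation H := (hermite mu).
Local Notation E := (gaussian mu 1 0).

Definition hfun (n : nat) (v : R) : R := (H n).[v] * E v.
Definition hnorm (n : nat) : R := moment (gmoment mu 1) (H n * H n).
(** The coefficient of the three-term recurrence, and by [hnormS] also the ratio of consecutive
    squared norms. *)
Definition alpha (n : nat) : R := theta mu n / 2.

Lemma E_sqr v : E v * E v = gw mu 1 v.
Proof.
rewrite -expr2 /gaussian exprMn rw_sqr mulrC /gw -expRM_natl; congr (_ * expR _).
by field.
Qed.

Lemma ip_polygauss (p q : {poly R}) :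
  ip (fun v => p.[v] * E v) (fun v => q.[v] * E v) = moment (gmoment mu 1) (p * q).
Proof.
rewrite moment_gmoment//; apply: eq_Rintegral => v _.
by rewrite hornerM -E_sqr; ring.
Qed.

Lemma L2_hfun n : L2 (hfun n). Proof. exact: L2_polygauss. Qed.

Lemma gmoment1_odd1 : gmoment mu 1 1 = 0. Proof. exact: gmoment_odd. Qed.

Lemma ip_hfun n m : ip (hfun n) (hfun m) = if n == m then hnorm n else 0.
Proof.
rewrite ip_polygauss; have [<-//|nm] := eqVneq n m.
exact: (moment_hermite_orth gmoment1_odd1 (gmoment_oneSS hmu)).
Qed.

Lemma hnormS n : hnorm n.+1 = alpha n.+1 * hnorm n.
Proof. exact: (moment_hermite_normS gmoment1_odd1 (gmoment_oneSS hmu)). Qed.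

Lemma alpha0 : alpha 0 = 0. Proof. by rewrite /alpha theta0 mul0r. Qed.

Lemma alpha_ge0 n : 0 <= alpha n.
Proof. by rewrite divr_ge0// (le_trans _ (theta_ge hmu n)). Qed.

(** One of [n] and [n.+1] is odd, so the sum equals [n + mu + 1]: the constant is attained at
    [n = 0], the Gaussian itself. *)
Lemma alpha_addS n : mu + 1 <= alpha n + alpha n.+1.
Proof.
rewrite /alpha -mulrDl thetaS /theta; have := ler0n R n.
by rewrite -[(-1) ^+ n]signr_odd; case: (odd n) => /=; lra.
Qed.

Lemma hnorm_gt0 n : 0 < hnorm n.
Proof.
elim: n => [|n IH]; last by rewrite hnormS mulr_gt0// divr_gt0// theta_gt0.
rewrite /hnorm hermite0 mulr1 moment_gmoment//; apply: Rintegral_gt0.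
- exact: integrable_horner_gw.
- by move=> v; rewrite hornerC mul1r gw_ge0.
- by move=> v v0; rewrite hornerC mul1r mulr_gt0 ?expR_gt0// powR_gt0// normr_gt0.
Qed.

(** At [n = 0] the truncated predecessor is harmless because [alpha 0 = 0]; the same convention
    recurs below. *)
Lemma mulX_hfun n v : v * hfun n v = hfun n.+1 v + alpha n * hfun n.-1 v.
Proof.
rewrite /hfun; case: n => [|n].
  by rewrite alpha0 mul0r addr0 hermite0 hermite1 hornerC hornerX mul1r.
by rewrite hermiteSS hornerD hornerN hornerZ hornerM hornerX /= /alpha; ring.
Qed.

Lemma poly_hermite_span (p : {poly R}) : exists N (b : nat -> R),
  p = \sum_(0 <= n < N) b n *: H n.
Proof.
have widen (N M : nat) (b : nat -> R) : (N <= M)%N ->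
    \sum_(0 <= n < N) b n *: H n = \sum_(0 <= n < M) (if (n < N)%N then b n else 0) *: H n.
  move=> NM; rewrite (big_cat_nat _ NM)//=.
  have -> : \sum_(N <= i < M) (if (i < N)%N then b i else 0) *: H i = 0.
    by rewrite big_nat big1// => n /andP[Nn _]; rewrite ltnNge Nn/= scale0r.
  by rewrite addr0; apply: eq_big_nat => n /andP[_ ->].
elim/(@poly_lin_ind R): p => [a p q [N [b ->]] [M [c ->]]|n].
  exists (maxn N M), (fun n => a * (if (n < N)%N then b n else 0) + (if (n < M)%N then c n else 0)).
  rewrite (widen _ _ b (leq_maxl N M)) (widen _ _ c (leq_maxr N M)) scaler_sumr -big_split/=.
  by apply: eq_bigr => i _; rewrite scalerA scalerDl.
elim: n => [|n [N [b IH]]].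
  by exists 1%N, (fun=> 1); rewrite big_nat1 scale1r.
have E1 k : 'X * H k = H k.+1 + alpha k *: H k.-1.
  case: k => [|k]; last by rewrite hermiteSS /alpha subrK.
  by rewrite alpha0 scale0r addr0 hermite0 hermite1 mulr1.
rewrite exprS IH mulr_sumr.
have span k : exists M (c : nat -> R), 'X * (b k *: H k) = \sum_(0 <= n < M) c n *: H n.
  exists k.+2, (fun j => (if j == k.+1 then b k else 0) + (if j == k.-1 then b k * alpha k else 0)).
  rewrite -scalerAr E1 scalerDr scalerA.
  under [RHS]eq_bigr do rewrite scalerDl.
  rewrite big_split/=; congr (_ + _).
    rewrite big_nat_recr//= eqxx big_nat big1 ?add0r// => i /andP[_ ik].
    by rewrite ltn_eqF// scale0r.
  rewrite big_mkord (bigD1 (inord k.-1))//= inordK ?ltnS; last by rewrite (leq_trans (leq_pred _)).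
  rewrite eqxx big1 ?addr0// => i /eqP ik; case: eqP => [ei|_]; last by rewrite scale0r.
  by exfalso; apply: ik; apply: val_inj; rewrite /= inordK ?ei// ltnS (leq_trans (leq_pred _)).
elim: N {IH} => [|N [M [c IH]]].
  by exists 0%N, (fun=> 0); rewrite !big_geq.
have [K [d Hd]] := span N; rewrite big_nat_recr//= IH Hd.
exists (maxn M K), (fun n => (if (n < M)%N then c n else 0) + (if (n < K)%N then d n else 0)).
rewrite (widen _ _ c (leq_maxl M K)) (widen _ _ d (leq_maxr M K)) -big_split/=.
by apply: eq_bigr => i _; rewrite scalerDl.
Qed.

Local Notation res := (residual hfun hnorm).

(** Density puts a polynomial times the Gaussian close to [F]; it is a Hermite sum, and the residual
    is at least as small as the distance to any such sum. *)
Lemma parseval F (eps : R) : L2 F -> 0 < eps ->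
  exists N, forall M, (N <= M)%N -> ip (res F M) (res F M) < eps.
Proof.
move=> hF e0; have [_ /(_ _ e0)[G [p ->] h]] := approx_polygauss hmu hF.
have [N [b pE]] := poly_hermite_span p; exists N => M NM.
apply: le_lt_trans (residual_homo L2_hfun ip_hfun hnorm_gt0 hF NM) _.
apply: le_lt_trans (residual_best L2_hfun ip_hfun hnorm_gt0 b N hF) _.
rewrite (_ : partial_sum hfun b N = (fun v => p.[v] * E v))//.
apply/funext => v; rewrite pE horner_sum mulr_suml; apply: eq_bigr => i _.
by rewrite hornerZ /hfun mulrA.
Qed.

Lemma parseval_le F (eps : R) : L2 F -> 0 < eps ->
  exists N, forall M, (N <= M)%N ->
    ip F F - eps < \sum_(0 <= n < M) ip F (hfun n) ^+ 2 / hnorm n.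
Proof.
move=> hF e0; have [N h] := parseval hF e0; exists N => M /h.
rewrite (residual_norm L2_hfun ip_hfun hnorm_gt0)//; lra.
Qed.

Lemma fourier_mulX F n : L2 F -> L2 (fun v => v * F v) ->
  ip (fun v => v * F v) (hfun n) = ip F (hfun n.+1) + alpha n * ip F (hfun n.-1).
Proof.
move=> hF hvF.
transitivity (ip F (fun v => alpha n * hfun n.-1 v + hfun n.+1 v)).
  by apply: eq_Rintegral => v _; rewrite mulrAC mulX_hfun; ring.
by rewrite ip_linr; [rewrite addrC|exact: L2_hfun|exact: L2_hfun|exact: hF].
Qed.

(** By [hnormS] both squares become multiples of [u]. Once collected, [u k] carries
    [2 * (alpha k + alpha k.+1)]; its second share comes from [n = k + 1], hence the longer sum on
    the right. What is left over at the end is nonnegative. *)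
Lemma coef_inequality (c : nat -> R) N :
  2 * (mu + 1) * \sum_(0 <= n < N) c n ^+ 2 / hnorm n <=
  \sum_(0 <= n < N.+1) ((c n.+1 + alpha n * c n.-1) ^+ 2 +
    (- c n.+1 + alpha n * c n.-1) ^+ 2) / hnorm n.
Proof.
pose u n := c n ^+ 2 / hnorm n.
have u0 n : 0 <= u n by rewrite divr_ge0 ?sqr_ge0// ltW// hnorm_gt0.
have T n : ((c n.+1 + alpha n * c n.-1) ^+ 2 + (- c n.+1 + alpha n * c n.-1) ^+ 2) / hnorm n =
    2 * (alpha n.+1 * u n.+1) + 2 * (alpha n * u n.-1).
  rewrite /u hnormS; case: n => [|n] /=.
    rewrite alpha0; field; rewrite !lt0r_neq0 ?hnorm_gt0// divr_gt0// theta_gt0//.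
  rewrite hnormS; field.
  by rewrite !lt0r_neq0 ?hnorm_gt0// divr_gt0// theta_gt0.
under [leRHS]eq_bigr do rewrite T.
rewrite big_split/= [X in _ <= _ + X]big_nat_recl// alpha0 mul0r mulr0 add0r.
have -> : \sum_(0 <= i < N.+1) 2 * (alpha i.+1 * u i.+1) =
    \sum_(0 <= i < N) 2 * (alpha i * u i) + 2 * (alpha N * u N) + 2 * (alpha N.+1 * u N.+1).
  rewrite -big_nat_recr//= -[RHS]big_nat_recr//= [RHS]big_nat_recl// alpha0 mul0r mulr0 add0r//.
rewrite -!addrA [X in _ <= _ + X]addrC addrA.
apply: (@le_trans _ _ (\sum_(0 <= i < N) 2 * (alpha i * u i) +
   \sum_(0 <= i < N) 2 * (alpha i.+1 * u i.+1.-1))).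
  rewrite -big_split/= mulr_sumr; apply: ler_sum => i _.
  by have := alpha_addS i; have := u0 i; rewrite -/(u i); nra.
have := mulr_ge0 (alpha_ge0 N) (u0 N); have := mulr_ge0 (alpha_ge0 N.+1) (u0 N.+1).
by lra.
Qed.

(* [(q1, q2)] are the coefficients of the transform of the function with coefficients
   [(p1, p2)]: the phase ['i ^+ n] turns [c n.+1 + alpha n * c n.-1] into
   [- c n.+1 + alpha n * c n.-1], up to a common phase. *)
Lemma phase_sqr (p1 p2 q1 q2 : nat -> R) n :
  (forall k, q1 k = ci k * p1 k - si k * p2 k) ->
  (forall k, q2 k = ci k * p2 k + si k * p1 k) ->
  (q1 n.+1 + alpha n * q1 n.-1) ^+ 2 + (q2 n.+1 + alpha n * q2 n.-1) ^+ 2 =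
  (- p1 n.+1 + alpha n * p1 n.-1) ^+ 2 + (- p2 n.+1 + alpha n * p2 n.-1) ^+ 2.
Proof.
move=> e1 e2; have cs k : ci k ^+ 2 + si k ^+ 2 = 1 :> R.
  by rewrite /ci /si; case: ifP => _; rewrite expr0n/= ?add0r ?addr0 sqrr_sign.
rewrite !e1 !e2; case: n => [|n] /=.
  rewrite alpha0 !mul0r !addr0 !sqrrN.
  by rewrite /si /= expr0; ring.
rewrite !ciS !siS !ciS; set x := ci n; set y := si n.
transitivity ((x ^+ 2 + y ^+ 2) * ((- p1 n.+2 + alpha n.+1 * p1 n) ^+ 2 +
    (- p2 n.+2 + alpha n.+1 * p2 n) ^+ 2)); first by ring.
by rewrite cs mul1r.
Qed.

Section two_functions.
Variables P1 P2 Q1 Q2 : R -> R.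
Hypotheses (hP1 : L2 P1) (hP2 : L2 P2) (hQ1 : L2 Q1) (hQ2 : L2 Q2).
Hypothesis coef1 : forall n, ip Q1 (hfun n) = ci n * ip P1 (hfun n) - si n * ip P2 (hfun n).
Hypothesis coef2 : forall n, ip Q2 (hfun n) = ci n * ip P2 (hfun n) + si n * ip P1 (hfun n).

(** The phases preserve the sum of squared coefficients, which Parseval bounds below for the [P] and
    Bessel bounds above for the [Q]. *)
Lemma norm_le_transform : ip P1 P1 + ip P2 P2 <= ip Q1 Q1 + ip Q2 Q2.
Proof.
rewrite leNgt; apply/negP; rewrite -subr_gt0 => h.
set d := _ - _ in h; have d0 : 0 < d / 2 by rewrite divr_gt0.
have [N1 h1] := parseval_le hP1 d0; have [N2 h2] := parseval_le hP2 d0.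
pose M := maxn N1 N2; have := h1 M (leq_maxl _ _); have := h2 M (leq_maxr _ _).
have := bessel L2_hfun ip_hfun hnorm_gt0 M hQ1.
have := bessel L2_hfun ip_hfun hnorm_gt0 M hQ2.
have : \sum_(0 <= n < M) ip Q1 (hfun n) ^+ 2 / hnorm n +
    \sum_(0 <= n < M) ip Q2 (hfun n) ^+ 2 / hnorm n =
    \sum_(0 <= n < M) ip P1 (hfun n) ^+ 2 / hnorm n +
    \sum_(0 <= n < M) ip P2 (hfun n) ^+ 2 / hnorm n.
  rewrite -!big_split/=; apply: eq_bigr => n _; rewrite -!mulrDl; congr (_ / _).
  have cs k : ci k ^+ 2 + si k ^+ 2 = 1 :> R.
    by rewrite /ci /si; case: ifP => _; rewrite expr0n/= ?add0r ?addr0 sqrr_sign.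
  rewrite coef1 coef2 -[RHS]mul1r -(cs n); ring.
rewrite /d; lra.
Qed.

Hypotheses (hvP1 : L2 (fun v => v * P1 v)) (hvP2 : L2 (fun v => v * P2 v)).
Hypotheses (hvQ1 : L2 (fun v => v * Q1 v)) (hvQ2 : L2 (fun v => v * Q2 v)).
Local Notation sq F := (ip (fun v => v * F v) (fun v => v * F v)).

Lemma uncertainty_sum :
  2 * (mu + 1) * (ip P1 P1 + ip P2 P2) <= sq P1 + sq P2 + sq Q1 + sq Q2.
Proof.
apply/ler_addgt0Pr => eps e0.
have m0 : 0 < 2 * (mu + 1) by move: hmu; lra.
(* Two Parseval errors occur, each multiplied by [2 * (mu + 1)]; together they amount to [eps]. *)
have d0 : 0 < eps / (2 * (mu + 1)) / 2 by rewrite !divr_gt0.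
have [N1 h1] := parseval_le hP1 d0; have [N2 h2] := parseval_le hP2 d0.
pose M := maxn N1 N2; have := h1 M (leq_maxl _ _); have := h2 M (leq_maxr _ _).
have b F : L2 F -> L2 (fun v => v * F v) ->
    \sum_(0 <= n < M.+1) (ip F (hfun n.+1) + alpha n * ip F (hfun n.-1)) ^+ 2 / hnorm n <= sq F.
  move=> hF hvF; have := bessel L2_hfun ip_hfun hnorm_gt0 M.+1 hvF.
  by under eq_bigr do rewrite fourier_mulX//.
have := b _ hQ1 hvQ1; have := b _ hQ2 hvQ2; have := b _ hP1 hvP1; have := b _ hP2 hvP2.
have := coef_inequality (fun n => ip P1 (hfun n)) M.
have := coef_inequality (fun n => ip P2 (hfun n)) M.
have : \sum_(0 <= n < M.+1) (ip Q1 (hfun n.+1) + alpha n * ip Q1 (hfun n.-1)) ^+ 2 / hnorm n +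
    \sum_(0 <= n < M.+1) (ip Q2 (hfun n.+1) + alpha n * ip Q2 (hfun n.-1)) ^+ 2 / hnorm n =
    \sum_(0 <= n < M.+1) (- ip P1 (hfun n.+1) + alpha n * ip P1 (hfun n.-1)) ^+ 2 / hnorm n +
    \sum_(0 <= n < M.+1) (- ip P2 (hfun n.+1) + alpha n * ip P2 (hfun n.-1)) ^+ 2 / hnorm n.
  rewrite -!big_split/=; apply: eq_bigr => n _; rewrite -!mulrDl; congr (_ / _).
  exact: (@phase_sqr (fun n => ip P1 (hfun n)) (fun n => ip P2 (hfun n))
    (fun n => ip Q1 (hfun n)) (fun n => ip Q2 (hfun n))).
have split (c : nat -> R) : \sum_(0 <= n < M.+1)
    ((c n.+1 + alpha n * c n.-1) ^+ 2 + (- c n.+1 + alpha n * c n.-1) ^+ 2) / hnorm n =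
    \sum_(0 <= n < M.+1) (c n.+1 + alpha n * c n.-1) ^+ 2 / hnorm n +
    \sum_(0 <= n < M.+1) (- c n.+1 + alpha n * c n.-1) ^+ 2 / hnorm n.
  by rewrite -big_split/=; apply: eq_bigr => n _; rewrite mulrDl.
rewrite (split (fun n => ip P1 (hfun n))) (split (fun n => ip P2 (hfun n))).
move=> E c2 c1 b1 b2 b3 b4 p2 p1.
have q1 := ler_pM2l m0 (ip P1 P1 - eps / (2 * (mu + 1)) / 2)
  (\sum_(0 <= n < M) ip P1 (hfun n) ^+ 2 / hnorm n).
have q2 := ler_pM2l m0 (ip P2 P2 - eps / (2 * (mu + 1)) / 2)
  (\sum_(0 <= n < M) ip P2 (hfun n) ^+ 2 / hnorm n).
have e1 X : 2 * (mu + 1) * (X - eps / (2 * (mu + 1)) / 2) = 2 * (mu + 1) * X - eps / 2.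
  by field; rewrite lt0r_neq0//; move: hmu; lra.
move: q1 q2; rewrite !e1 (ltW p1) (ltW p2) => q1 q2.
move: c1 c2 b1 b2 b3 b4 E q1 q2 => /=.
rewrite mulrDr.
lra.
Qed.

End two_functions.

End hermite_basis.

(** * Chirped Gaussians are Schwartz functions *)

Section chirped_polygaussian.
Context {R : realType}.
Variables (a d s : R).
Hypothesis s0 : 0 < s.

(** A class closed under differentiation that contains the real and imaginary parts of the test
    functions; the Schwartz bounds then reduce to those of a polynomial times a Gaussian. *)
Definition chirp_gauss (p q : {poly R}) (v : R) : R :=
  (p.[v] * cos (a * v ^+ 2 + d * v) + q.[v] * sin (a * v ^+ 2 + d * v)) * expR (- (s * v ^+ 2)).

Definition dchirp : {poly R} := (2 * a) *: 'X + d%:P.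

Lemma is_derive_chirp_gauss (p q : {poly R}) (v : R) :
  is_derive v 1 (chirp_gauss p q) (chirp_gauss
    (p^`() + q * dchirp - (2 * s) *: ('X * p)) (q^`() - p * dchirp - (2 * s) *: ('X * q)) v).
Proof.
have hp := is_derive_poly p v; have hq := is_derive_poly q v.
have ht : is_derive v 1 (fun x => a * x ^+ 2 + d * x) (dchirp.[v]).
  apply: is_derive_eq; rewrite /dchirp hornerD hornerZ hornerX hornerC /GRing.scale/=; ring.
have hc : is_derive v 1 (fun x => cos (a * x ^+ 2 + d * x))
    (- sin (a * v ^+ 2 + d * v) * dchirp.[v]).
  exact: (is_derive1_comp (f := cos) (g := fun x => a * x ^+ 2 + d * x)).
have hs : is_derive v 1 (fun x => sin (a * x ^+ 2 + d * x)) (cos (a * v ^+ 2 + d * v) * dchirp.[v]).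
  exact: (is_derive1_comp (f := sin) (g := fun x => a * x ^+ 2 + d * x)).
have he : is_derive v 1 (fun x => expR (- (s * x ^+ 2))) (expR (- (s * v ^+ 2)) * (- (2 * s * v))).
  apply: (is_derive1_comp (f := expR) (g := fun x => - (s * x ^+ 2))).
  by apply: is_derive_eq; rewrite /GRing.scale/=; ring.
rewrite /chirp_gauss; apply: is_derive_eq.
rewrite /GRing.scale/= !(hornerD, hornerN, hornerM, hornerZ, hornerX).
by ring.
Qed.

Lemma derive1n_chirp_gauss n (p q : {poly R}) : exists p' q',
  derive1n n (chirp_gauss p q) = chirp_gauss p' q'.
Proof.
elim: n p q => [|n IH] p q; first by exists p, q.
have [p' [q' E]] := IH p q; rewrite derive1nS E.
do 2 eexists; apply/funext => v; rewrite derive1E.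
by have [_ ->] := is_derive_chirp_gauss p' q' v.
Qed.

Lemma horner_gauss_bounded (p : {poly R}) : exists2 K, 0 <= K &
  forall v, `|p.[v]| * expR (- (s * v ^+ 2)) <= K.
Proof.
elim/(@poly_lin_ind R): p => [b p q [K1 K10 h1] [K2 K20 h2]|n].
  exists (`|b| * K1 + K2); first by rewrite addr_ge0// mulr_ge0.
  move=> v; rewrite hornerD hornerZ.
  apply: (@le_trans _ _ (`|b| * (`|p.[v]| * expR (- (s * v ^+ 2))) +
    `|q.[v]| * expR (- (s * v ^+ 2)))).
    by rewrite mulrA -mulrDl ler_wpM2r ?expR_ge0// (le_trans (ler_normD _ _))// normrM.
  by rewrite lerD// ler_wpM2l.
have [K K0 HK] := gauss_growth 0 (ler0n R n) s0; exists K; first exact: ltW.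
move=> v; have := HK v; rewrite mul0r sub0r powR_mulrn// hornerXn normrX => h.
rewrite (le_trans h)// ler_piMr ?(ltW K0)//.
by rewrite -[leRHS]expR0 ler_expR oppr_le0 mulr_ge0 ?sqr_ge0// divr_ge0// (ltW s0).
Qed.

Lemma chirp_gauss_bounded m (p q : {poly R}) : exists K,
  forall v, `|v| ^+ m * `|chirp_gauss p q v| <= K.
Proof.
have [K1 K10 h1] := horner_gauss_bounded ('X^m * p).
have [K2 K20 h2] := horner_gauss_bounded ('X^m * q).
exists (K1 + K2) => v; rewrite /chirp_gauss normrM (ger0_norm (expR_ge0 _)).
apply: le_trans (lerD (h1 v) (h2 v)); rewrite !hornerM !hornerXn !normrM !normrX.
rewrite -mulrDl mulrA ler_wpM2r ?expR_ge0// -mulrDr ler_wpM2l ?exprn_ge0//.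
rewrite (le_trans (ler_normD _ _))// !normrM lerD// ler_piMr//.
  by rewrite ler_norml cos_geN1 cos_le1.
by rewrite ler_norml sin_geN1 sin_le1.
Qed.

Local Open Scope complex_scope.

Lemma cabsE (x y : R) : cabs (x +i* y) = Num.sqrt (x ^+ 2 + y ^+ 2). Proof. by []. Qed.

Lemma cabs_le (x y : R) : cabs (x +i* y) <= `|x| + `|y|.
Proof.
rewrite cabsE -[leRHS]ger0_norm ?addr_ge0// -sqrtr_sqr ler_sqrt ?sqr_ge0//.
rewrite -(real_normK (num_real x)) -(real_normK (num_real y)).
by have := normr_ge0 x; have := normr_ge0 y; nra.
Qed.

Lemma schwartz_chirp_gauss (p1 q1 p2 q2 : {poly R}) :
  schwartz (fun v => chirp_gauss p1 q1 v +i* chirp_gauss p2 q2 v).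
Proof.
split => [n x|m n] /=.
  have [p [q ->]] := derive1n_chirp_gauss n p1 q1.
  have [p' [q' ->]] := derive1n_chirp_gauss n p2 q2.
  by split; [have [] := is_derive_chirp_gauss p q x|have [] := is_derive_chirp_gauss p' q' x].
have [p [q E]] := derive1n_chirp_gauss n p1 q1.
have [p' [q' E']] := derive1n_chirp_gauss n p2 q2.
have [K1 h1] := chirp_gauss_bounded m p q; have [K2 h2] := chirp_gauss_bounded m p' q'.
exists (K1 + K2) => x; rewrite /cderive1n /= E E'.
apply: le_trans (lerD (h1 x) (h2 x)).
by rewrite -mulrDr ler_wpM2l ?exprn_ge0// cabs_le.
Qed.

End chirped_polygaussian.

Local Open Scope complex_scope.

(** * Complex arithmetic and measurability through real and imaginary parts *)

Section complex_facts.
Context {R : realType}.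
Implicit Types z : R[i].

Lemma cabs_sqr z : cabs z ^+ 2 = complex.Re z ^+ 2 + complex.Im z ^+ 2.
Proof. by case: z => x y; rewrite cabsE sqr_sqrtr// addr_ge0 ?sqr_ge0. Qed.

Lemma cabs_ge0 z : 0 <= cabs z.
Proof. by case: z => x y; rewrite cabsE sqrtr_ge0. Qed.

Lemma cabsM z1 z2 : cabs (z1 * z2) = cabs z1 * cabs z2.
Proof. exact: ComplexField.Normc.normcM. Qed.

Lemma cabs_cis (t : R) : cabs (cis t) = 1.
Proof. by rewrite cabsE cos2Dsin2 sqrtr1. Qed.

Lemma cabs_real (x : R) : cabs x%:C = `|x|.
Proof. by rewrite cabsE expr0n/= addr0 sqrtr_sqr. Qed.

Lemma cisD (s t : R) : cis (s + t) = cis s * cis t.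
Proof.
rewrite /cis cosD sinD; apply/eqP.
by rewrite eq_complex/= addrC [cos s * sin t + _]addrC !eqxx.
Qed.

Lemma cis0 : cis 0 = 1 :> R[i].
Proof. by rewrite /cis cos0 sin0. Qed.

Lemma cisN (t : R) : cis t * cis (- t) = 1.
Proof. by rewrite -cisD subrr cis0. Qed.

Lemma ReM z1 z2 : complex.Re (z1 * z2) =
  complex.Re z1 * complex.Re z2 - complex.Im z1 * complex.Im z2.
Proof. by case: z1; case: z2. Qed.

Lemma ImM z1 z2 : complex.Im (z1 * z2) =
  complex.Re z1 * complex.Im z2 + complex.Im z1 * complex.Re z2.
Proof. by case: z1; case: z2. Qed.

Lemma ReD z1 z2 : complex.Re (z1 + z2) = complex.Re z1 + complex.Re z2.
Proof. by case: z1; case: z2. Qed.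

Lemma ImD z1 z2 : complex.Im (z1 + z2) = complex.Im z1 + complex.Im z2.
Proof. by case: z1; case: z2. Qed.

Lemma ReB z1 z2 : complex.Re (z1 - z2) = complex.Re z1 - complex.Re z2.
Proof. by case: z1; case: z2. Qed.

Lemma ImB z1 z2 : complex.Im (z1 - z2) = complex.Im z1 - complex.Im z2.
Proof. by case: z1; case: z2. Qed.

Lemma measurable_cos : measurable_fun [set: R] (@cos R).
Proof. exact: (continuous_measurable_fun (@continuous_cos R)). Qed.

Lemma measurable_sin : measurable_fun [set: R] (@sin R).
Proof. exact: (continuous_measurable_fun (@continuous_sin R)). Qed.

Lemma cmeasurableM (f g : R -> R[i]) :
  cmeasurable f -> cmeasurable g -> cmeasurable (fun v => f v * g v).
Proof.
move=> [f1 f2] [g1 g2]; split.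
  by under eq_fun do rewrite ReM; mfun.
by under eq_fun do rewrite ImM; mfun.
Qed.

Lemma cmeasurableD (f g : R -> R[i]) :
  cmeasurable f -> cmeasurable g -> cmeasurable (fun v => f v + g v).
Proof.
move=> [f1 f2] [g1 g2]; split.
  by under eq_fun do rewrite ReD; mfun.
by under eq_fun do rewrite ImD; mfun.
Qed.

Lemma cmeasurable_cst z : cmeasurable (fun=> z).
Proof. by split; exact: measurable_cst. Qed.

Lemma cmeasurableB (f g : R -> R[i]) :
  cmeasurable f -> cmeasurable g -> cmeasurable (fun v => f v - g v).
Proof.
move=> [f1 f2] [g1 g2]; split.
  by under eq_fun do rewrite ReB; mfun.
by under eq_fun do rewrite ImB; mfun.
Qed.

Lemma cmeasurable_real (f : R -> R) : measurable_fun [set: R] f ->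
  cmeasurable (fun v => (f v)%:C).
Proof. by move=> mf; split => //=; exact: measurable_cst. Qed.

Lemma cmeasurable_cis (t : R -> R) : measurable_fun [set: R] t ->
  cmeasurable (fun v => cis (t v)).
Proof.
move=> mt; split => /=.
  exact: (measurableT_comp measurable_cos mt).
exact: (measurableT_comp measurable_sin mt).
Qed.

Lemma cmeasurable_mull (t : R) (f : R -> R[i]) :
  cmeasurable f -> cmeasurable (fun v => f (t * v)).
Proof.
move=> [f1 f2]; split.
  by apply: (measurableT_comp f1); exact: measurable_mull.
by apply: (measurableT_comp f2); exact: measurable_mull.
Qed.

Lemma cmeasurable_cabs_sqr (f : R -> R[i]) : cmeasurable f ->
  measurable_fun [set: R] (fun v => cabs (f v) ^+ 2).
Proof. by move=> [f1 f2]; under eq_fun do rewrite cabs_sqr; mfun. Qed.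

End complex_facts.

(** * Weighted norms and second moments *)

Section weighted_energy.
Context {R : realType}.
Variable mu : R.
Hypothesis hmu : - (1 / 2) < mu.
Local Notation leb := (@lebesgue_measure R).

Lemma weightE v : weight mu v = rw mu v ^+ 2.
Proof. by rewrite rw_sqr. Qed.

Lemma weight_ge0 v : 0 <= weight mu v. Proof. exact: powR_ge0. Qed.

Lemma weight_gt0 v : v != 0 -> 0 < weight mu v.
Proof. by move=> v0; rewrite powR_gt0// normr_gt0. Qed.

Lemma measurable_weight : measurable_fun [set: R] (weight mu).
Proof. by rewrite /weight; mfun. Qed.

Lemma weightM t v : weight mu (t * v) = weight mu t * weight mu v.
Proof. by rewrite /weight normrM powRM. Qed.

Definition energy (m : nat) (f : R -> R[i]) : \bar R :=
  (\int[leb]_v (`|v| ^+ (2 * m) * (cabs (f v) ^+ 2 * weight mu v))%:E)%E.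

Lemma energy_integrand_ge0 m (f : R -> R[i]) v :
  0 <= `|v| ^+ (2 * m) * (cabs (f v) ^+ 2 * weight mu v).
Proof. by rewrite !mulr_ge0 ?exprn_ge0 ?cabs_ge0 ?weight_ge0. Qed.

Lemma measurable_energy m (f : R -> R[i]) : cmeasurable f ->
  measurable_fun [set: R] (fun v => `|v| ^+ (2 * m) * (cabs (f v) ^+ 2 * weight mu v)).
Proof.
move=> /cmeasurable_cabs_sqr mf; have mw := measurable_weight.
by apply: measurable_funM; [mfun|exact: measurable_funM].
Qed.

Lemma energy_ge0 m f : (0 <= energy m f)%E.
Proof. by apply: integral_ge0 => v _; rewrite lee_fin energy_integrand_ge0. Qed.

Lemma energy0E f : energy 0 f = (\int[leb]_v (cabs (f v) ^+ 2 * weight mu v)%:E)%E.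
Proof. by apply: eq_integral => v _; rewrite muln0 expr0 mul1r. Qed.

Lemma energy1E f :
  energy 1 f = (\int[leb]_v (`|v| ^+ 2 * cabs (f v) ^+ 2 * weight mu v)%:E)%E.
Proof. by apply: eq_integral => v _; rewrite muln1 mulrA. Qed.

(** The factor [|v|^(2 m)] can vanish only at 0, a negligible point. *)
Lemma energy0_eq0 m f : cmeasurable f -> energy m f = 0%E -> energy 0 f = 0%E.
Proof.
move=> mf e0; have me := measurable_energy m mf.
have : (\int[leb]_v `|(`|v| ^+ (2 * m) * (cabs (f v) ^+ 2 * weight mu v))%:E|)%E = 0%E.
  by rewrite -e0; apply: eq_integral => v _; rewrite gee0_abs ?lee_fin ?energy_integrand_ge0.
move/(ae_eq_integral_abs leb measurableT (_ : measurable_fun setT _)) => h.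
have ae0 : {ae leb, forall v, (`|v| ^+ (2 * m) * (cabs (f v) ^+ 2 * weight mu v))%:E = 0%E}.
  have [|N [mN N0 sN]] := h; first exact/measurable_EFinP.
  by exists N; split => // v /= nv; apply: sN => /= /(_ I).
rewrite energy0E.
have [N [mN N0 sN]] := ae0.
have mw := measurable_weight.
rewrite -[RHS](integral0 leb setT); apply: ge0_ae_eq_integral => //.
- by apply/measurable_EFinP; apply: measurable_funM => //; exact: cmeasurable_cabs_sqr.
- by move=> v _; rewrite lee_fin mulr_ge0 ?weight_ge0// exprn_ge0// cabs_ge0.
exists (N `|` [set 0]); split.
- exact: measurableU.
- by apply/null_set_setU => //; exact: lebesgue_measure_set1.
move=> v /= nv; have [v0|v0] := eqVneq v 0; [by right|left].
apply: sN => /= -[/eqP]; rewrite mulf_eq0 expf_eq0 normr_eq0 (negbTE v0) andbF/= => /eqP e.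
by apply: nv => _; rewrite e.
Qed.

Lemma Lnorm_muE f : Lnorm_mu mu 2 f = (energy 0 f `^ 2^-1)%E.
Proof.
rewrite /Lnorm_mu energy0E; congr (_ `^ _)%E.
by apply: eq_integral => v _; rewrite powR_mulrn// cabs_ge0.
Qed.

Lemma Lnorm_mu_lt f (r : R) : 0 < r -> (Lnorm_mu mu 2 f < r%:E)%E = (energy 0 f < (r ^+ 2)%:E)%E.
Proof.
move=> r0; rewrite Lnorm_muE; have := energy_ge0 0 f.
case: (energy 0 f) => [x|_|//]; last by rewrite poweRyr ?invr_eq0// !ltNge !leey.
rewrite lee_fin => x0; rewrite poweR_EFin !lte_fin powR12_sqrt//.
rewrite -[in RHS](sqr_sqrtr x0) ltr_pXn2r// ?nnegrE ?sqrtr_ge0//; exact: ltW.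
Qed.

Lemma inLp_muP f : inLp_mu mu 2 f <-> cmeasurable f /\ (energy 0 f < +oo)%E.
Proof.
rewrite /inLp_mu Lnorm_muE; split => -[mf h]; split => //; last exact: poweR_lty.
have := energy_ge0 0 f; move: h; case: (energy 0 f) => [x _ _|h _|//]; first exact: ltry.
by move: h; rewrite poweRyr ?invr_eq0.
Qed.

Lemma inLp_mu_lin (z : R[i]) f g :
  inLp_mu mu 2 f -> inLp_mu mu 2 g -> inLp_mu mu 2 (fun v => z * f v + g v).
Proof.
move=> /inLp_muP[mf ef] /inLp_muP[mg eg]; apply/inLp_muP.
have mh : cmeasurable (fun v => z * f v + g v).
  by apply: cmeasurableD mg; apply: cmeasurableM mf; exact: cmeasurable_cst.
split => //; pose k := 2 * cabs z ^+ 2.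
have k0 : 0 <= k by rewrite mulr_ge0// sqr_ge0.
apply: (@le_lt_trans _ _ (k%:E * energy 0 f + 2%:E * energy 0 g)%E); last first.
  rewrite lte_add_pinfty//.
    by move: ef; case: (energy 0 f) (energy_ge0 0 f) => // x _ _; rewrite -EFinM ltry.
  by move: eg; case: (energy 0 g) (energy_ge0 0 g) => // x _ _; rewrite -EFinM ltry.
rewrite /energy -!ge0_integralZl//;
  try by move=> v _; rewrite lee_fin !mulr_ge0 ?exprn_ge0 ?cabs_ge0 ?weight_ge0.
  rewrite -ge0_integralD//; last 4 first.
  - by move=> v _; rewrite -EFinM lee_fin !mulr_ge0 ?exprn_ge0 ?cabs_ge0 ?weight_ge0.
  - by apply/measurable_EFinP; apply: measurable_funM => //; exact: measurable_energy.
  - by move=> v _; rewrite -EFinM lee_fin !mulr_ge0 ?exprn_ge0 ?cabs_ge0 ?weight_ge0.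
  - by apply/measurable_EFinP; apply: measurable_funM => //; exact: measurable_energy.
  apply: ge0_le_integral => //.
  - by move=> v _; rewrite lee_fin !mulr_ge0 ?exprn_ge0 ?cabs_ge0 ?weight_ge0.
  - by apply/measurable_EFinP; exact: measurable_energy.
  - apply/measurable_EFinP; apply: measurable_funD; apply: measurable_funM => //;
      exact: measurable_energy.
  move=> v _; rewrite -!EFinM -EFinD lee_fin muln0 !expr0 !mul1r.
  have h : cabs (z * f v + g v) ^+ 2 <= k * cabs (f v) ^+ 2 + 2 * cabs (g v) ^+ 2.
    rewrite /k -mulrA -exprMn -cabsM !cabs_sqr ReD ImD.
    set x := complex.Re (z * f v); set y := complex.Im (z * f v).
    have := sqr_ge0 (x - complex.Re (g v)); have := sqr_ge0 (y - complex.Im (g v)).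
    by nra.
  by apply: le_trans (ler_wpM2r (weight_ge0 v) h) _; rewrite mulrDl !mulrA.
- by apply/measurable_EFinP; exact: measurable_energy.
- by apply/measurable_EFinP; exact: measurable_energy.
Qed.

Lemma energy_aeq m f g : cmeasurable f -> cmeasurable g -> aeq f g ->
  energy m f = energy m g.
Proof.
move=> mf mg [N [mN N0 sN]]; apply: ge0_ae_eq_integral => //.
- by apply/measurable_EFinP; exact: measurable_energy.
- by apply/measurable_EFinP; exact: measurable_energy.
- by move=> v _; rewrite lee_fin !mulr_ge0 ?exprn_ge0 ?cabs_ge0 ?weight_ge0.
- by move=> v _; rewrite lee_fin !mulr_ge0 ?exprn_ge0 ?cabs_ge0 ?weight_ge0.
by exists N; split => // v /= nv; apply: sN => /= fg; apply: nv => _; rewrite fg.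
Qed.

End weighted_energy.

(** * Passage from the weighted space to the unweighted one *)

Section pullback.
Context {R : realType}.
Variable mu : R.
Hypothesis hmu : - (1 / 2) < mu.
Local Notation leb := (@lebesgue_measure R).
Local Notation rw := (rw mu).

Lemma complex_energy (m : nat) (G : R -> R[i]) : cmeasurable G ->
  (\int[leb]_v (`|v| ^+ (2 * m) * cabs (G v) ^+ 2)%:E < +oo)%E ->
  let G1 v := v ^+ m * complex.Re (G v) in let G2 v := v ^+ m * complex.Im (G v) in
  [/\ L2 G1, L2 G2 &
    (\int[leb]_v (`|v| ^+ (2 * m) * cabs (G v) ^+ 2)%:E = (ip G1 G1 + ip G2 G2)%:E)%E].
Proof.
move=> [mG1 mG2] fin G1 G2.
have m1 : measurable_fun [set: R] G1 by rewrite /G1; mfun.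
have m2 : measurable_fun [set: R] G2 by rewrite /G2; mfun.
have E v : `|v| ^+ (2 * m) * cabs (G v) ^+ 2 = G1 v ^+ 2 + G2 v ^+ 2.
  by rewrite cabs_sqr exprM real_normK ?num_real// -exprM mulnC exprM /G1 /G2 !exprMn mulrDr.
have iE : (\int[leb]_v (`|v| ^+ (2 * m) * cabs (G v) ^+ 2)%:E =
    \int[leb]_v (G1 v ^+ 2 + G2 v ^+ 2)%:E)%E by apply: eq_integral => v _; rewrite E.
rewrite iE in fin *.
have iS : leb.-integrable [set: R] (EFin \o (fun v => G1 v ^+ 2 + G2 v ^+ 2)).
  apply/integrableP; split; first by apply/measurable_EFinP; mfun.
  apply: le_lt_trans fin; apply: ge0_le_integral => //.
  - by apply/measurable_EFinP; apply: measurableT_comp => //; mfun.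
  - by apply/measurable_EFinP; mfun.
  - by move=> v _; rewrite lee_fin ger0_norm// addr_ge0 ?sqr_ge0.
have L1 : L2 G1.
  split => //; apply: integrable_le iS _; first by mfun.
  by move=> v; rewrite ger0_norm ?sqr_ge0// lerDl sqr_ge0.
have L2' : L2 G2.
  split => //; apply: integrable_le iS _; first by mfun.
  by move=> v; rewrite ger0_norm ?sqr_ge0// lerDr sqr_ge0.
split => //; rewrite /ip -RintegralD//; try exact: integrable_mul.
rewrite /Rintegral fineK; first by apply: eq_integral => v _; rewrite !expr2.
by have := integrable_fin_num measurableT iS; congr (_ \is a fin_num);
  apply: eq_integral => v _; rewrite /= !expr2.
Qed.

(* The unitary equivalence, up to a constant factor, between the weighted space and the
   unweighted L^2, composed with a dilation and a modulation. *)
Definition pull (r t : R) (ph : R -> R) (f : R -> R[i]) (v : R) : R[i] :=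
  f (t * v) * cis (ph v) * (r * rw v)%:C.

(** The Jacobian of the dilation and the homogeneity of the weight, divided by the square of the
    scalar [r] built into [pull]. *)
Definition pull_fac (r t : R) : R := `|t| * weight mu t / r ^+ 2.

Section one_pullback.
Variables (r t : R) (ph : R -> R).
Hypotheses (r0 : r != 0) (t0 : t != 0) (mph : measurable_fun [set: R] ph).
Local Notation p := (pull r t ph).

Lemma pull_fac_gt0 : 0 < pull_fac r t.
Proof. by rewrite /pull_fac divr_gt0// ?exprn_even_gt0// mulr_gt0 ?normr_gt0 ?weight_gt0. Qed.

Lemma cmeasurable_pull f : cmeasurable f -> cmeasurable (p f).
Proof.
move=> mf; apply: cmeasurableM; first apply: cmeasurableM.
- exact: cmeasurable_mull.
- exact: cmeasurable_cis.
- by apply: cmeasurable_real; have := measurable_rw mu; mfun.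
Qed.

Lemma energy_pullE m f : cmeasurable f ->
  energy mu m f = ((`|t| ^+ (2 * m) * pull_fac r t)%:E *
    \int[leb]_v (`|v| ^+ (2 * m) * cabs (p f v) ^+ 2)%:E)%E.
Proof.
move=> mf; have k0 := pull_fac_gt0; have mp := cmeasurable_pull mf.
have tm : 0 < `|t| ^+ (2 * m) by rewrite exprn_gt0 ?normr_gt0.
have mE : measurable_fun [set: R] (fun v => `|v| ^+ (2 * m) * cabs (p f v) ^+ 2).
  by have := cmeasurable_cabs_sqr mp; mfun.
rewrite -ge0_integralZl//; last 3 first.
- exact/measurable_EFinP.
- by move=> v _; rewrite lee_fin mulr_ge0 ?sqr_ge0 ?exprn_ge0.
- by rewrite lee_fin mulr_ge0 ?ltW.
rewrite /energy (ge0_integral_mull t0)/=; last 2 first.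
- by apply/measurable_EFinP; exact: measurable_energy.
- by move=> v; rewrite lee_fin !mulr_ge0 ?exprn_ge0 ?cabs_ge0 ?weight_ge0.
rewrite -ge0_integralZl//; last 2 first.
- apply/measurable_EFinP; apply: (measurableT_comp (measurable_energy mu m mf)).
  exact: measurable_mull.
- by move=> v _; rewrite lee_fin !mulr_ge0 ?exprn_ge0 ?cabs_ge0 ?weight_ge0.
apply: eq_integral => v _; rewrite -!EFinM; congr (_%:E).
rewrite /pull !cabsM cabs_cis mulr1 cabs_real (normrM r) (ger0_norm (rw_ge0 _ _)).
rewrite (normrM t) exprMn weightM /pull_fac [weight mu v]weightE !exprMn real_normK ?num_real//.
by field.
Qed.

Lemma pull_energy m f : cmeasurable f -> (energy mu m f < +oo)%E ->
  let G1 v := v ^+ m * complex.Re (p f v) in let G2 v := v ^+ m * complex.Im (p f v) in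
  [/\ L2 G1, L2 G2 &
    energy mu m f = (`|t| ^+ (2 * m) * pull_fac r t * (ip G1 G1 + ip G2 G2))%:E].
Proof.
move=> mf fin G1 G2; have k0 := pull_fac_gt0; have mp := cmeasurable_pull mf.
have tm : 0 < `|t| ^+ (2 * m) by rewrite exprn_gt0 ?normr_gt0.
have E := energy_pullE m mf; move: fin; rewrite E => fin.
have fin' : (\int[leb]_v (`|v| ^+ (2 * m) * cabs (p f v) ^+ 2)%:E < +oo)%E.
  move: fin; case: (integral _ _ _) => [x _| |//]; first exact: ltry.
  by rewrite gt0_muley// lte_fin mulr_gt0.
by have [h1 h2 ->] := complex_energy mp fin'; split.
Qed.

Lemma energy_pull_lty f : cmeasurable f ->
  L2 (fun v => complex.Re (p f v)) -> L2 (fun v => complex.Im (p f v)) ->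
  (energy mu 0 f < +oo)%E.
Proof.
move=> mf [_ h1] [_ h2]; rewrite (energy_pullE 0 mf).
have := integrable_lty measurableT (integrable_add h1 h2); rewrite /=.
have -> : (\int[leb]_v (`|v| ^+ (2 * 0) * cabs (p f v) ^+ 2)%:E =
    \int[leb]_v (complex.Re (p f v) ^+ 2 + complex.Im (p f v) ^+ 2)%:E)%E.
  by apply: eq_integral => v _; rewrite muln0 expr0 mul1r cabs_sqr.
have : (0 <= \int[leb]_v (complex.Re (p f v) ^+ 2 + complex.Im (p f v) ^+ 2)%:E)%E.
  by apply: integral_ge0 => v _; rewrite lee_fin addr_ge0 ?sqr_ge0.
by case: (integral _ _ _) => // x _ _; rewrite -EFinM ltry.
Qed.

Lemma pull_norm f : cmeasurable f -> (energy mu 0 f < +oo)%E ->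
  let G1 v := complex.Re (p f v) in let G2 v := complex.Im (p f v) in
  [/\ L2 G1, L2 G2 & energy mu 0 f = (pull_fac r t * (ip G1 G1 + ip G2 G2))%:E].
Proof.
move=> mf fin /=; have [] := pull_energy mf fin => /=.
have e g : (fun v : R => v ^+ 0 * g v) = g by apply/funext => v; rewrite expr0 mul1r.
by rewrite !e muln0 expr0 mul1r; split.
Qed.

Lemma pull_sub f g v : p (fun u => f u - g u) v = p f v - p g v.
Proof. by rewrite /pull; ring. Qed.

End one_pullback.
End pullback.

(** * The quadratic-phase transform of chirped Hermite functions *)

Section test_functions.
Context {R : realType}.
Variables (a b c d e mu sg : R).
Hypotheses (hb : b != 0) (hmu : - (1 / 2) < mu) (sg0 : 0 < sg).
Local Notation leb := (@lebesgue_measure R).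

Definition hermite_fun (n : nat) (u : R) : R := (hermite mu n).[u] * expR (- (u ^+ 2 / 2)).

(** The chirp cancels the one that [qp_kernel] carries in [v], which leaves the Dunkl transform of a
    dilated Hermite function. *)
Definition test_fun (n : nat) (v : R) : R[i] :=
  cis (a * v ^+ 2 + d * v) * (hermite_fun n (sg * v))%:C.

Lemma schwartz_test_fun n : schwartz (test_fun n).
Proof.
have s0 : 0 < sg ^+ 2 / 2 by rewrite divr_gt0 ?exprn_gt0.
pose h := hermite mu n \Po (sg *: 'X).
have -> : test_fun n = (fun v => chirp_gauss a d (sg ^+ 2 / 2) h 0 v +i*
    chirp_gauss a d (sg ^+ 2 / 2) 0 h v).
  apply/funext => v; rewrite /test_fun /chirp_gauss /hermite_fun horner0 /h.
  rewrite horner_comp hornerZ hornerX; have -> : sg ^+ 2 / 2 * v ^+ 2 = (sg * v) ^+ 2 / 2 by field.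
  by apply/eqP; rewrite eq_complex/=; apply/andP; split; apply/eqP; ring.
exact: schwartz_chirp_gauss.
Qed.

Definition dil_fac : R := sg * weight mu sg.
(** The output chirp together with the phase of [cpow ('i * b%:C) (mu + 1)], to be removed by the
    modulation in [pull]. *)
Definition out_phase (w : R) : R := c * w ^+ 2 + e * w + (mu + 1) * carg ('i * b%:C).
Definition out_fac : R := (dil_fac * (`|b| `^ (mu + 1)))^-1.

Lemma dil_fac_gt0 : 0 < dil_fac.
Proof. by rewrite mulr_gt0// weight_gt0// gt_eqF. Qed.

Lemma out_fac_gt0 : 0 < out_fac.
Proof. by rewrite invr_gt0 mulr_gt0 ?dil_fac_gt0// powR_gt0 ?normr_gt0. Qed.

(** [c_mu] normalizes the weighted Gaussian to total mass 1; this is why the eigenvalues are exactly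
    ['i ^+ n]. *)
Lemma c_mu_gmoment : c_mu mu * gmoment mu (1 / 2) 0 = 1.
Proof.
have := gmoment_half hmu 0; rewrite double0 => ->; rewrite add0r /c_mu mulVf//.
by rewrite mulf_neq0// gt_eqF// ?powR_gt0// Gamma_gt0//; move: hmu; lra.
Qed.

Lemma cabs_ib : cabs ('i * b%:C) = `|b|.
Proof.
rewrite cabsM cabs_real -[RHS]mul1r; congr (_ * _).
by rewrite /cabs /= expr0n expr1n add0r sqrtr1.
Qed.

Lemma cintegral_mull (z : R[i]) (F1 F2 : R -> R) :
  leb.-integrable [set: R] (EFin \o F1) -> leb.-integrable [set: R] (EFin \o F2) ->
  cintegral (fun v => z * (F1 v +i* F2 v)) =
  z * ((\int[leb]_v F1 v) +i* (\int[leb]_v F2 v)).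
Proof.
move=> i1 i2; case: z => x y; rewrite /cintegral /=.
have iZ k F : leb.-integrable [set: R] (EFin \o F) ->
    leb.-integrable [set: R] (EFin \o (fun v => k * F v)).
  by move=> iF; have := integrableZl measurableT k iF.
apply/eqP; rewrite eq_complex /=; apply/andP; split; apply/eqP.
  by rewrite RintegralB ?RintegralZl//; apply: iZ.
by rewrite RintegralD ?RintegralZl//; apply: iZ.
Qed.

Lemma qp_dunkl_test_fun n w : qp_dunkl a b c d e mu (test_fun n) w =
  out_fac%:C * cis (- out_phase w) * (ci n +i* si n) * (hermite_fun n (- (w / b) / sg))%:C.
Proof.
have mu1 : 0 < mu + 1 by move: hmu; lra.
have w0 : weight mu sg != 0 by rewrite gt_eqF ?weight_gt0 ?gt_eqF.
have sgn0 : sg != 0 by rewrite gt_eqF.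
(* Substituting [u = sg * v] moves the dilation from the Hermite function to the kernel, whose
   argument becomes [xi * u]; homogeneity of the weight leaves the factor [(weight mu sg)^-1] in
   [G]. *)
pose xi := - (w / b) / sg.
pose g eps u := dunkl_ser mu eps (xi * u) * ((hermite mu n).[u] * gw mu (1 / 2) u).
pose G eps v := (weight mu sg)^-1 * g eps (sg * v).
have ig eps : (forall n, `|eps n| <= 1) -> leb.-integrable [set: R] (EFin \o g eps).
  by move=> he; have [] := dtrans_cvg hmu he (hermite mu n) xi.
have iG eps : (forall n, `|eps n| <= 1) -> leb.-integrable [set: R] (EFin \o G eps).
  by move=> /ig h; have := integrableZl measurableT (weight mu sg)^-1 (integrable_mull sgn0 h).
have GE eps : (forall n, `|eps n| <= 1) ->
    \int[leb]_v G eps v = dil_fac^-1 * dtrans mu eps (hermite mu n) xi.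
  move=> /ig h; rewrite /dtrans -/(g eps) RintegralZl//; last exact: (integrable_mull sgn0 h).
  by rewrite (Rintegral_mull sgn0 h) gtr0_norm// /dil_fac invfM mulrCA mulrA mulVKf.
rewrite /qp_dunkl.
have -> : (fun v => qp_kernel a b c d e mu w v * test_fun n v * (weight mu v)%:C) =
    (fun v => cis (- (c * w ^+ 2 + e * w)) * (G ci v +i* G si v)).
  apply/funext => v; rewrite /qp_kernel /test_fun (dunkl_EE hmu).
  have -> : - (a * v ^+ 2 + c * w ^+ 2 + d * v + e * w) =
    - (c * w ^+ 2 + e * w) - (a * v ^+ 2 + d * v) by ring.
  rewrite cisD -!mulrA; congr (_ * _).
  rewrite [X in X = _](_ : _ = (cis (a * v ^+ 2 + d * v) * cis (- (a * v ^+ 2 + d * v))) *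
    ((dunkl_ser mu ci (- (w / b) * v) +i* dunkl_ser mu si (- (w / b) * v)) *
     ((hermite_fun n (sg * v))%:C * (weight mu v)%:C))); last by ring.
  rewrite cisN mul1r -rmorphM/= /G /g.
  have -> : xi * (sg * v) = - (w / b) * v by rewrite /xi; field; rewrite hb.
  have -> : gw mu (1 / 2) (sg * v) = weight mu sg * weight mu v * expR (- ((sg * v) ^+ 2 / 2)).
    by rewrite -weightM /gw /weight; congr (_ * expR _); field.
  rewrite /hermite_fun.
  by apply/eqP; rewrite eq_complex/=; apply/andP; split; apply/eqP; field.
rewrite cintegral_mull; [|exact: iG ci_le1|exact: iG si_le1].
rewrite !GE; [|exact: si_le1|exact: ci_le1].
have [-> ->] := dtrans_hermite hmu n xi.
rewrite -/(hermite_fun n xi) /out_phase /cpow cabs_ib.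
set th := (mu + 1) * _; set X := c * w ^+ 2 + e * w.
rewrite (opprD X th) (cisD (- X)).
have th0 : cis th != 0.
  apply/eqP => h; have := cisN th.
  by rewrite h mul0r => /eqP; rewrite eq_sym oner_eq0.
have icis : (cis th)^-1 = cis (- th) by apply: (mulfI th0); rewrite cisN divff.
set B := _ `^ (mu + 1); set gm := gmoment mu (1 / 2) 0; set H := hermite_fun n xi.
have -> : (c_mu mu)%:C / (B%:C * cis th) = (c_mu mu)%:C * ((B^-1)%:C * cis (- th)).
  by rewrite invfM icis -fmorphV.
have -> : out_fac%:C = (dil_fac^-1)%:C * (B^-1)%:C by rewrite /out_fac invfM rmorphM.
have -> : (dil_fac^-1 * (ci n * gm * H) +i* (dil_fac^-1 * (si n * gm * H))) =
    (dil_fac^-1)%:C * (gm%:C * (ci n +i* si n) * H%:C).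
  by apply/eqP; rewrite eq_complex/=; apply/andP; split; apply/eqP; ring.
have cg : (c_mu mu)%:C * gm%:C = 1 by rewrite -rmorphM/= c_mu_gmoment.
rewrite -[RHS]mul1r -cg.
set C1 := (c_mu mu)%:C; set C2 := (B^-1)%:C; set C3 := (dil_fac^-1)%:C; set C4 := gm%:C.
set C5 := H%:C; set C6 := cis (- X); set C7 := cis (- th); set C8 := ci n +i* si n.
by ring.
Qed.

(** The dilation [- (b * sg)] inverts [w |-> - (w / b) / sg], so a test function and its transform
    are both pulled back to [hfun n] in the same variable, up to the phase. *)
Local Notation pin := (pull mu 1 sg^-1 (fun v => - (a * (sg^-1 * v) ^+ 2 + d * (sg^-1 * v)))).
Local Notation pout := (pull mu out_fac^-1 (- (b * sg)) (fun v => out_phase (- (b * sg) * v))).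

Lemma gaussianE v : gaussian mu 1 0 v = expR (- (v ^+ 2 / 2)) * rw mu v.
Proof. by rewrite /gaussian mul0r addr0 mul1r. Qed.

Lemma pull_test_fun n v : pin (test_fun n) v = (hfun mu n v)%:C.
Proof.
rewrite /pull /test_fun .
have E : forall z1 z2 z3 : R[i], z1 * z2 = 1 -> z1 * z3 * z2 = z3.
  by move=> z1 z2 z3 h; rewrite mulrAC h mul1r.
rewrite (E _ _ _ (cisN _)) mul1r -rmorphM /hfun gaussianE /hermite_fun mulVKf ?gt_eqF// mulrA.
by [].
Qed.

Lemma pull_qp_test_fun n v :
  pout (qp_dunkl a b c d e mu (test_fun n)) v = (ci n +i* si n) * (hfun mu n v)%:C.
Proof.
rewrite /pull qp_dunkl_test_fun.
have -> : - (- (b * sg) * v / b) / sg = v by field; rewrite hb gt_eqF.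
rewrite /hfun gaussianE /hermite_fun.
have K0 := gt_eqF out_fac_gt0.
have o : out_fac%:C * (out_fac^-1 * rw mu v)%:C = (rw mu v)%:C.
  by rewrite -rmorphM/= mulVKf// K0.
set z := out_phase _; have := cisN z.
set z1 := cis z; set z2 := cis (- z); set i := ci n +i* si n; rewrite !rmorphM/= => cz.
rewrite rmorphM/= in o.
transitivity ((z1 * z2) * (out_fac%:C * ((out_fac^-1)%:C * (rw mu v)%:C)) *
  (i * (((hermite mu n).[v])%:C * (expR (- (v ^+ 2 / 2)))%:C))); first by ring.
by rewrite cz o; ring.
Qed.

Lemma weightV (t : R) : t != 0 -> weight mu t^-1 = (weight mu t)^-1.
Proof.
move=> t0; have w0 := gt_eqF (weight_gt0 mu t0).
apply: (mulfI (negbT w0)); rewrite -weightM !divff ?w0//.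
by rewrite /weight normr1 powR1.
Qed.

Lemma pull_fac_in : pull_fac mu 1 sg^-1 = dil_fac^-1.
Proof.
have s0 := gt_eqF sg0; rewrite /pull_fac expr1n divr1 weightV ?s0//.
by rewrite gtr0_norm ?invr_gt0// -invfM.
Qed.

Lemma normr_weight : `|b| * weight mu b = (`|b| `^ (mu + 1)) ^+ 2.
Proof.
have nb : `|b| != 0 by rewrite normr_eq0.
rewrite -powR_mulrn ?powR_ge0// -powRrM /weight.
have -> : (mu + 1) * 2%:R = 1 + (2 * mu + 1) by ring.
by rewrite [RHS]powRD ?powRr1// nb implybT.
Qed.

Lemma weightN (t : R) : weight mu (- t) = weight mu t.
Proof. by rewrite /weight normrN. Qed.

(** The same factor as on the input side, so the norms of [f] and [D f] compare as those of their
    pullbacks. *)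
Lemma pull_fac_out : pull_fac mu out_fac^-1 (- (b * sg)) = dil_fac^-1.
Proof.
have s0 := gt_eqF sg0; have w0 := gt_eqF (weight_gt0 mu (negbT s0)).
have B0 : `|b| `^ (mu + 1) != 0 by rewrite gt_eqF// powR_gt0 ?normr_gt0.
rewrite /pull_fac normrN weightN weightM normrM (gtr0_norm sg0) mulrACA normr_weight.
rewrite /out_fac invrK exprMn /dil_fac.
by field; rewrite B0 w0 s0.
Qed.

End test_functions.

(** * Coefficients of [D f] and the product inequality *)

Section two_negligible.
Context {R : realType}.

Lemma ae_imp2 (P Q S : R -> Prop) :
  {ae @lebesgue_measure R, forall v, P v} -> {ae @lebesgue_measure R, forall v, Q v} ->
  (forall v, P v -> Q v -> S v) -> {ae @lebesgue_measure R, forall v, S v}.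
Proof.
move=> [N [mN N0 sN]] [M [mM M0 sM]] PQ; exists (N `|` M); split => //.
- exact: measurableU.
- exact: null_set_setU.
move=> v /= nS; have [Pv|nP] := pselect (P v); last by left; exact: sN.
by have [Qv|nQ] := pselect (Q v); [case: nS; exact: PQ|right; exact: sM].
Qed.

End two_negligible.

Section extension.
Context {R : realType}.
Variables (a b c d e mu : R).
Hypotheses (hb : b != 0) (hmu : - (1 / 2) < mu).
Variable D : (R -> R[i]) -> (R -> R[i]).
Hypothesis hD : is_qp_dunkl_L2 a b c d e mu D.
Variable f : R -> R[i].
Hypothesis hf : inLp_mu mu 2 f.
Local Notation leb := (@lebesgue_measure R).
Local Notation h := (hfun mu).

Section dilation.
Variable sg : R.
Hypothesis sg0 : 0 < sg.
Local Notation phi := (test_fun a d mu sg).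
Local Notation Phi n := (qp_dunkl a b c d e mu (phi n)).
Local Notation pin := (pull mu 1 sg^-1 (fun v => - (a * (sg^-1 * v) ^+ 2 + d * (sg^-1 * v)))).
Local Notation pout :=
  (pull mu (out_fac b mu sg)^-1 (- (b * sg)) (fun v => out_phase b c e mu (- (b * sg) * v))).
Local Notation SG := (dil_fac mu sg).
Local Notation P1 := (fun v => complex.Re (pin f v)).
Local Notation P2 := (fun v => complex.Im (pin f v)).
Local Notation Q1 := (fun v => complex.Re (pout (D f) v)).
Local Notation Q2 := (fun v => complex.Im (pout (D f) v)).

Let tin : sg^-1 != 0. Proof. by rewrite invr_eq0 gt_eqF. Qed.
Let tout : - (b * sg) != 0. Proof. by rewrite oppr_eq0 mulf_neq0// gt_eqF. Qed.
Let rout : (out_fac b mu sg)^-1 != 0. Proof. by rewrite invr_eq0 gt_eqF// out_fac_gt0. Qed.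
Let mphin : measurable_fun [set: R] (fun v => - (a * (sg^-1 * v) ^+ 2 + d * (sg^-1 * v))).
Proof. by mfun. Qed.
Let mphout : measurable_fun [set: R] (fun v => out_phase b c e mu (- (b * sg) * v)).
Proof. by rewrite /out_phase; mfun. Qed.

Let nin m g := @pull_energy R mu 1 sg^-1 _ (oner_neq0 R) tin mphin m g.
Let nout m g := @pull_energy R mu _ _ _ rout tout mphout m g.
Let nin0 g := @pull_norm R mu 1 sg^-1 _ (oner_neq0 R) tin mphin g.
Let nout0 g := @pull_norm R mu _ _ _ rout tout mphout g.

Lemma measurable_hermite_fun n : measurable_fun [set: R] (@hermite_fun R mu n).
Proof. by apply: measurable_funM; [exact: measurable_horner|mfun]. Qed.

Lemma cmeasurable_test_fun n : cmeasurable (phi n).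
Proof.
apply: cmeasurableM; first by apply: cmeasurable_cis; mfun.
apply: cmeasurable_real; apply: (measurableT_comp (measurable_hermite_fun n)).
exact: measurable_mull.
Qed.

Lemma inLp_test_fun n : inLp_mu mu 2 (phi n).
Proof.
apply/inLp_muP; split; first exact: cmeasurable_test_fun.
apply: (energy_pull_lty (oner_neq0 R) tin mphin (cmeasurable_test_fun n)).
  rewrite (_ : (fun v => _) = h n); first exact: L2_hfun.
  by apply/funext => v; rewrite pull_test_fun.
rewrite (_ : (fun v => _) = fun=> 0); first exact: L20.
by apply/funext => v; rewrite pull_test_fun.
Qed.

Lemma cmeasurable_qp_test_fun n : cmeasurable (Phi n).
Proof.
rewrite (_ : qp_dunkl _ _ _ _ _ _ _ = fun w => (out_fac b mu sg)%:C * cis (- out_phase b c e mu w) *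
  (ci n +i* si n) * (hermite_fun mu n (- (w / b) / sg))%:C); last first.
  by apply/funext => w; rewrite qp_dunkl_test_fun.
apply: cmeasurableM; first apply: cmeasurableM; first apply: cmeasurableM.
- exact: cmeasurable_cst.
- by apply: cmeasurable_cis; rewrite /out_phase; mfun.
- exact: cmeasurable_cst.
- by apply: cmeasurable_real; apply: (measurableT_comp (measurable_hermite_fun n)); mfun.
Qed.

Definition csum (F : nat -> R -> R[i]) (z : nat -> R[i]) (N : nat) (v : R) : R[i] :=
  \sum_(0 <= n < N) z n * F n v.

Lemma csumS F z N : csum F z N.+1 = fun v => z N * F N v + csum F z N v.
Proof. by apply/funext => v; rewrite /csum big_nat_recr//= addrC. Qed.

Lemma csum0 F z : csum F z 0 = fun=> 0.
Proof. by apply/funext => v; rewrite /csum big_geq. Qed.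

Lemma cmeasurable_csum F z N : (forall n, cmeasurable (F n)) -> cmeasurable (csum F z N).
Proof.
move=> mF; elim: N => [|N IH]; first by rewrite csum0; exact: cmeasurable_cst.
rewrite csumS; apply: cmeasurableD IH; apply: cmeasurableM => //; exact: cmeasurable_cst.
Qed.

Lemma pull_csum r t ph F z N v :
  pull mu r t ph (csum F z N) v = csum (fun n => pull mu r t ph (F n)) z N v.
Proof. by rewrite /pull /csum !mulr_suml; apply: eq_bigr => n _; rewrite !mulrA. Qed.

Lemma csum_hfun (x y : nat -> R) N v :
  csum (fun n v => (h n v)%:C) (fun n => x n +i* y n) N v =
  partial_sum h x N v +i* partial_sum h y N v.
Proof.
elim: N => [|N IH]; first by rewrite csum0 !partial_sum0.
rewrite csumS IH !partial_sumS.
by apply/eqP; rewrite eq_complex/=; apply/andP; split; apply/eqP; ring.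
Qed.

Lemma inLp_mu0 : inLp_mu mu 2 (fun=> 0 : R[i]).
Proof.
have := inLp_mu_lin (-1) hf hf.
by rewrite (_ : (fun v => _) = fun=> 0)//; apply/funext => v; rewrite mulN1r addNr.
Qed.

Lemma inLp_csum z N : inLp_mu mu 2 (csum phi z N).
Proof.
elim: N => [|N IH]; first by rewrite csum0; exact: inLp_mu0.
rewrite csumS; exact: (inLp_mu_lin (z N) (inLp_test_fun N) IH).
Qed.

Lemma D_csum z N : aeq (D (csum phi z N)) (csum (fun n => Phi n) z N).
Proof.
elim: N => [|N IH].
  (* Linearity at the combination [-1 * 0 + 0] shows that [D] maps 0 to a function vanishing almost
     everywhere. *)
  rewrite !csum0; have := qpL2_linear hD (-1) inLp_mu0 inLp_mu0.
  rewrite (_ : (fun v : R => -1 * 0 + 0) = fun=> 0); last first.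
    by apply/funext => v; rewrite mulr0 addr0.
  by move/ae_imp; apply => v ->; rewrite mulN1r addNr.
rewrite !csumS; have hl := qpL2_linear hD (z N) (inLp_test_fun N) (inLp_csum z N).
have hs := qpL2_schwartz hD (schwartz_test_fun a d mu sg0 N).
apply: ae_imp2 hl (ae_imp2 IH hs (fun v p q => conj p q)) _ => v -> [-> ->].
by [].
Qed.

Let mf : cmeasurable f. Proof. by have /inLp_muP[] := hf. Qed.
Let ef : (energy mu 0 f < +oo)%E. Proof. by have /inLp_muP[] := hf. Qed.
Let mDf : cmeasurable (D f). Proof. by have /inLp_muP[] := qpL2_stable hD hf. Qed.
Let eDf : (energy mu 0 (D f) < +oo)%E. Proof. by have /inLp_muP[] := qpL2_stable hD hf. Qed.

Local Notation coef1 := (fourier h (hnorm mu) P1).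
Local Notation coef2 := (fourier h (hnorm mu) P2).
Local Notation coef := (fun n => coef1 n +i* coef2 n).

Lemma L2_P1 : L2 P1. Proof. by have [] := nin0 mf ef. Qed.
Lemma L2_P2 : L2 P2. Proof. by have [] := nin0 mf ef. Qed.
Lemma L2_Q1 : L2 Q1. Proof. by have [] := nout0 mDf eDf. Qed.
Lemma L2_Q2 : L2 Q2. Proof. by have [] := nout0 mDf eDf. Qed.

Lemma pin_residual N v : pin (fun u => csum phi coef N u - f u) v =
  (- residual h (hnorm mu) P1 N v) +i* (- residual h (hnorm mu) P2 N v).
Proof.
rewrite pull_sub pull_csum.
have -> : (fun n => pin (phi n)) = (fun n v => (h n v)%:C).
  by apply/funext => n; apply/funext => u; rewrite pull_test_fun.
rewrite csum_hfun /residual; case: (pin f v) => x y /=.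
by apply/eqP; rewrite eq_complex/=; apply/andP; split; apply/eqP; ring.
Qed.

Definition out_coef1 n := ci n * coef1 n - si n * coef2 n.
Definition out_coef2 n := ci n * coef2 n + si n * coef1 n.

Lemma pout_sum N v : pout (csum (fun n => Phi n) coef N) v =
  partial_sum h out_coef1 N v +i* partial_sum h out_coef2 N v.
Proof.
rewrite pull_csum -csum_hfun /csum; apply: eq_bigr => n _.
rewrite pull_qp_test_fun// mulrA; congr (_ * _).
rewrite /out_coef1 /out_coef2; apply/eqP; rewrite eq_complex/=.
by apply/andP; split; apply/eqP; ring.
Qed.

Lemma energy_in_lt (eps : R) : 0 < eps -> exists N0, forall N, (N0 <= N)%N ->
  (energy mu 0 (fun v => (csum phi coef N v - f v)%R) < eps%:E)%E.
Proof.
move=> e0; have S0 : 0 < SG by exact: dil_fac_gt0.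
have e2 : 0 < eps * SG / 2 by rewrite !divr_gt0// mulr_gt0.
have [N1 h1] := parseval hmu L2_P1 e2; have [N2 h2] := parseval hmu L2_P2 e2.
exists (maxn N1 N2) => N; rewrite geq_max => /andP[/h1 r1 /h2 r2].
have [hc ec] : cmeasurable (fun v => csum phi coef N v - f v) /\
    (energy mu 0 (fun v => (csum phi coef N v - f v)%R) < +oo)%E.
  have := inLp_mu_lin (-1) hf (inLp_csum coef N) => /inLp_muP.
  rewrite (_ : (fun v => -1 * f v + _) = fun v => csum phi coef N v - f v)//.
  by apply/funext => v; rewrite mulN1r addrC.
have [_ _ ->] := nin0 hc ec.
rewrite pull_fac_in// lte_fin.
have ipN F : ip (fun v => - F v) (fun v => - F v) = ip F F.
  by apply: eq_Rintegral => v _; rewrite mulrNN.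
have -> : (fun v => complex.Re (pin (fun v => csum phi coef N v - f v) v)) =
    (fun v => - residual h (hnorm mu) P1 N v) by apply/funext => v; rewrite pin_residual.
have -> : (fun v => complex.Im (pin (fun v => csum phi coef N v - f v) v)) =
    (fun v => - residual h (hnorm mu) P2 N v) by apply/funext => v; rewrite pin_residual.
rewrite !ipN.
move: r1 r2; set x1 := ip _ _; set x2 := ip _ _; move: x1 x2 => x1 x2 r1 r2.
by rewrite mulrC ltr_pdivrMr// [ltRHS]splitr ltrD.
Qed.

(** Continuity of [D] at [f], along the Hermite partial sums, whose images [D_csum] identifies. *)
Lemma energy_out_lt (eps : R) : 0 < eps -> exists N0, forall N, (N0 <= N)%N ->
  (energy mu 0 (fun w => (csum (fun n => Phi n) coef N w - D f w)%R) < eps%:E)%E.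
Proof.
move=> e0; have s0 : 0 < Num.sqrt eps by rewrite sqrtr_gt0.
have [dl dl0 hc] := qpL2_continuous hD hf s0.
have [N0 hN] := energy_in_lt (exprn_gt0 2 dl0); exists N0 => N /hN.
rewrite -Lnorm_mu_lt// => /(hc _ (inLp_csum coef N)).
rewrite Lnorm_mu_lt// sqr_sqrtr ?(ltW e0)//; congr (_ < _)%E.
have [ms _] : cmeasurable (D (csum phi coef N)) /\ _ :=
  (inLp_muP _ _).1 (qpL2_stable hD (inLp_csum coef N)).
apply: energy_aeq.
- exact: cmeasurableB.
- by apply: cmeasurableB => //; apply: cmeasurable_csum; exact: cmeasurable_qp_test_fun.
by apply: ae_imp (D_csum coef N) _ => v ->.
Qed.

(** The images of the partial sums have the asserted coefficient as soon as [n < N]; since they tend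
    to [D f], Cauchy-Schwarz against [h n] carries it to the limit. *)
Lemma coef_out (n : nat) :
  ip Q1 (h n) = ci n * ip P1 (h n) - si n * ip P2 (h n) /\
  ip Q2 (h n) = ci n * ip P2 (h n) + si n * ip P1 (h n).
Proof.
have k0 := hnorm_gt0 hmu n; have S0 : 0 < SG by exact: dil_fac_gt0.
have small (x : R) : (forall eps, 0 < eps -> x ^+ 2 <= eps) -> x = 0.
  move=> hx; apply/eqP; rewrite -sqrf_eq0; apply/eqP/le_anti; rewrite sqr_ge0 andbT.
  by apply/ler_addgt0Pl => eps /hx; rewrite addr0.
have step eps : 0 < eps ->
    (ci n * ip P1 (h n) - si n * ip P2 (h n) - ip Q1 (h n)) ^+ 2 <= eps /\
    (ci n * ip P2 (h n) + si n * ip P1 (h n) - ip Q2 (h n)) ^+ 2 <= eps.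
  (* [SG] offsets the factor of the pullback, [hnorm mu n] the squared norm of [h n] in
     Cauchy-Schwarz. *)
  move=> e0; have e1 : 0 < eps / hnorm mu n / SG by rewrite !divr_gt0.
  have [N0 hN] := energy_out_lt e1; pose N := maxn N0 n.+1.
  have nN : (n < N)%N by rewrite leq_max leqnn orbT.
  have := hN N (leq_maxl _ _); set T := csum _ _ _ => eT.
  have mT : cmeasurable (fun w => T w - D f w).
    by apply: cmeasurableB => //; apply: cmeasurable_csum; exact: cmeasurable_qp_test_fun.
  have [] := nout0 mT (lt_trans eT (ltry _)).
  have p1 : (fun v => complex.Re (pout (fun w => T w - D f w) v)) =
      (fun v => partial_sum h out_coef1 N v - Q1 v).
    by apply/funext => v; rewrite pull_sub pout_sum ReB.
  have p2 : (fun v => complex.Im (pout (fun w => T w - D f w) v)) =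
      (fun v => partial_sum h out_coef2 N v - Q2 v).
    by apply/funext => v; rewrite pull_sub pout_sum ImB.
  rewrite p1 p2 => l1 l2 eE; move: eT.
  rewrite eE pull_fac_out// lte_fin mulrC ltr_pdivrMr// divfK ?gt_eqF//.
  rewrite ltr_pdivlMr// mulrDl => lt.
  have c1 := cauchy_schwarz l1 (L2_hfun hmu n); have c2 := cauchy_schwarz l2 (L2_hfun hmu n).
  have Lp x := L2_partial_sum (L2_hfun hmu) x N.
  move: c1 c2; rewrite !ip_hfun// eqxx.
  rewrite (ipBl (Lp _) L2_Q1 (L2_hfun hmu n)) (ipBl (Lp _) L2_Q2 (L2_hfun hmu n)).
  rewrite !(ip_partial_sum (L2_hfun hmu) (ip_hfun hmu)) nN.
  have -> : out_coef1 n * hnorm mu n = ci n * ip P1 (h n) - si n * ip P2 (h n).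
    by rewrite /out_coef1 /fourier; field; rewrite gt_eqF.
  have -> : out_coef2 n * hnorm mu n = ci n * ip P2 (h n) + si n * ip P1 (h n).
    by rewrite /out_coef2 /fourier; field; rewrite gt_eqF.
  have i1 := ip_sqr_ge0 (fun v => partial_sum h out_coef1 N v - Q1 v).
  have i2 := ip_sqr_ge0 (fun v => partial_sum h out_coef2 N v - Q2 v).
  have j1 := mulr_ge0 i1 (ltW k0); have j2 := mulr_ge0 i2 (ltW k0).
  by move=> c1 c2; split; [apply: le_trans c1 _|apply: le_trans c2 _]; move: lt j1 j2; lra.
split; apply/esym/eqP; rewrite -subr_eq0; apply/eqP/small => eps /step[]//.
Qed.

(** This excludes that [D f] is null while [f] is not, in the degenerate cases of the product. *)
Lemma energy_le_transform : (energy mu 0 f <= energy mu 0 (D f))%E.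
Proof.
have [_ _ ->] := nin0 mf ef; have [_ _ ->] := nout0 mDf eDf.
rewrite pull_fac_in// pull_fac_out// lee_fin ler_pM2l ?invr_gt0 ?dil_fac_gt0//.
apply: (norm_le_transform hmu L2_P1 L2_P2 L2_Q1 L2_Q2) => n; first exact: (coef_out n).1.
exact: (coef_out n).2.
Qed.

Lemma uncertainty_dilated (I A B : R) : energy mu 0 f = I%:E ->
  energy mu 1 f = A%:E -> energy mu 1 (D f) = B%:E ->
  2 * (mu + 1) * I <= sg ^+ 2 * A + B / (b ^+ 2 * sg ^+ 2).
Proof.
move=> If Af Bf; have S0 : 0 < SG by exact: dil_fac_gt0.
have [a1 a2] := nin mf (ltac:(by rewrite Af ltry) : (energy mu 1 f < +oo)%E).
rewrite Af => -[AE]; have [b1 b2] := nout mDf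
  (ltac:(by rewrite Bf ltry) : (energy mu 1 (D f) < +oo)%E).
rewrite Bf => -[BE]; have [_ _] := nin0 mf ef; rewrite If => -[IE].
have := uncertainty_sum hmu L2_P1 L2_P2 L2_Q1 L2_Q2 (fun n => (coef_out n).1)
  (fun n => (coef_out n).2) a1 a2 b1 b2.
rewrite IE AE BE pull_fac_in// pull_fac_out// muln1 normrN normrM.
set sP1 := ip (fun v => v * P1 v) _; set sP2 := ip (fun v => v * P2 v) _.
set sQ1 := ip (fun v => v * Q1 v) _; set sQ2 := ip (fun v => v * Q2 v) _.
move=> ineq; rewrite -/sP1 -/sP2 -/sQ1 -/sQ2.
have -> : sg ^+ 2 * (`|sg^-1| ^+ 2 / SG * (sP1 + sP2)) = (sP1 + sP2) / SG.
  by rewrite real_normK ?num_real//; field; rewrite !gt_eqF.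
have -> : (`|b| * `|sg|) ^+ 2 / SG * (sQ1 + sQ2) / (b ^+ 2 * sg ^+ 2) = (sQ1 + sQ2) / SG.
  by rewrite exprMn !real_normK ?num_real//; field; rewrite hb !gt_eqF.
rewrite -mulrDl mulrCA mulrC ler_pM2r ?invr_gt0//; apply: le_trans ineq _; lra.
Qed.

End dilation.

Lemma uncertainty_product (I A B : R) : energy mu 0 f = I%:E ->
  energy mu 1 f = A%:E -> energy mu 1 (D f) = B%:E ->
  b ^+ 2 * (mu + 1 / 2) ^+ 2 * I ^+ 2 <= A * B.
Proof.
move=> If Af Bf.
have I0 : 0 <= I by have := energy_ge0 mu 0 f; rewrite If lee_fin.
have A0 : 0 <= A by have := energy_ge0 mu 1 f; rewrite Af lee_fin.
have B0 : 0 <= B by have := energy_ge0 mu 1 (D f); rewrite Bf lee_fin.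
have [mf ef] := (inLp_muP mu f).1 hf; have [mDf eDf] := (inLp_muP mu (D f)).1 (qpL2_stable hD hf).
have h s : 0 < s -> 2 * (mu + 1) * I <= s * A + B / (b ^+ 2 * s).
  move=> s0; have q0 : 0 < Num.sqrt s by rewrite sqrtr_gt0.
  by have := uncertainty_dilated q0 If Af Bf; rewrite sqr_sqrtr// ltW.
(* If a second moment is 0, the function itself is null; for [B] this reaches [f] through
   [energy_le_transform]. *)
have [A1|A1] := eqVneq A 0.
  have /eqP := energy0_eq0 mf (etrans Af (congr1 EFin A1)).
  by rewrite If eqe => /eqP ->; rewrite expr0n mulr0 mulr_ge0.
have [B1|B1] := eqVneq B 0.
  have E := energy0_eq0 mDf (etrans Bf (congr1 EFin B1)).
  have := energy_le_transform ltr01; rewrite E If lee_fin => I1.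
  have -> : I = 0 by apply/le_anti; rewrite I1.
  by rewrite expr0n mulr0 mulr_ge0.
have Ap : 0 < A by rewrite lt_neqAle eq_sym A1.
have Bp : 0 < B by rewrite lt_neqAle eq_sym B1.
have b2 : 0 < b ^+ 2 by rewrite exprn_even_gt0.
(* The choice [s = q / A] balances the two terms of [h]: each of them equals [q]. *)
pose q := Num.sqrt (A * B / b ^+ 2).
have q0 : 0 < q by rewrite sqrtr_gt0 divr_gt0// mulr_gt0.
have qq : q ^+ 2 = A * B / b ^+ 2 by rewrite sqr_sqrtr// ltW// divr_gt0// mulr_gt0.
have := h (q / A) (divr_gt0 q0 Ap).
have -> : q / A * A + B / (b ^+ 2 * (q / A)) = 2 * q.
  have -> : B / (b ^+ 2 * (q / A)) = (A * B / b ^+ 2) / q by field; rewrite hb !gt_eqF.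
  by rewrite -qq divfK// expr2 mulfK ?gt_eqF// mulr2n mulrDl mul1r.
(* Here [mu + 1] is weakened to [mu + 1 / 2], using [0 <= I]. *)
move=> h1; have h2 : (mu + 1 / 2) * I <= q by nra.
have -> : A * B = b ^+ 2 * q ^+ 2 by rewrite qq; field.
rewrite -mulrA ler_pM2l// -exprMn lerXn2r// ?nnegrE ?(ltW q0)// mulr_ge0//; move: hmu; lra.
Qed.

End extension.

Theorem theorem6p2 (R : realType) (a b c d e mu : R)
    (hb : b != 0) (hmu : - (1 / 2) < mu)
    (D : (R -> R[i]) -> (R -> R[i])) (hD : is_qp_dunkl_L2 a b c d e mu D)
    (f : R -> R[i]) (hf : inLp_mu mu 2 f) :
  ((\int[@lebesgue_measure R]_v
      (`|v| ^+ 2 * cabs (f v) ^+ 2 * weight mu v)%:E) *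
   (\int[@lebesgue_measure R]_w
      (`|w| ^+ 2 * cabs (D f w) ^+ 2 * weight mu w)%:E)
   >= (`|b| ^+ 2 * (mu + 1 / 2) ^+ 2)%:E *
      (\int[@lebesgue_measure R]_v
         (cabs (f v) ^+ 2 * weight mu v)%:E) ^+ 2)%E.
Proof.
rewrite -!energy1E -energy0E real_normK ?num_real//.
have [mf ef] := (inLp_muP mu f).1 hf.
have [mDf eDf] := (inLp_muP mu (D f)).1 (qpL2_stable hD hf).
have [I If] : exists I, energy mu 0 f = I%:E.
  by move: ef (energy_ge0 mu 0 f); case: (energy mu 0 f) => // r _ _; exists r.
have trivial : I = 0 -> (((b ^+ 2 * (mu + 1 / 2) ^+ 2)%:E * energy mu 0 f ^+ 2 <=
    energy mu 1 f * energy mu 1 (D f))%E).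
  move=> I0; rewrite If I0 expe2 !mule0 mule_ge0 ?energy_ge0//.
(* In [\bar R] the product of 0 and [+oo] is 0, so an infinite moment settles the claim only when
   the other one is positive. *)
have pos g : cmeasurable g -> energy mu 0 g != 0%E -> (0 < energy mu 1 g)%E.
  move=> mg g0; rewrite lt_neqAle energy_ge0 andbT eq_sym; apply: contra g0 => /eqP.
  by move/(energy0_eq0 mg) => ->.
have [/trivial//|I0] := eqVneq I 0.
have f0 : energy mu 0 f != 0%E by rewrite If eqe.
have Df0 : energy mu 0 (D f) != 0%E.
  rewrite gt_eqF//; apply: lt_le_trans (energy_le_transform hb hmu hD hf ltr01).
  by rewrite lt_neqAle energy_ge0 andbT eq_sym.
have pA := pos _ mf f0; have pB := pos _ mDf Df0.
case EA : (energy mu 1 f) (pA) => [A| |//] _; last by rewrite gt0_mulye// leey.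
case EB : (energy mu 1 (D f)) (pB) => [B| |//] _; last by rewrite gt0_muley -?EA// leey.
rewrite If -EFin_expe -!EFinM lee_fin.
exact: (uncertainty_product hb hmu hD hf If EA EB).
Qed.
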